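(* There exists a randomized algorithm for $4$-SAT with one-sided error whose running time is $O(1.46899^n)$, where $n$ is the number of variables of the input formula.
   Context: $4$-SAT is the decision problem: given a CNF formula in which every clause has at most $4$ literals, over $n$ Boolean variables, decide whether it has a satisfying assignment. A randomized algorithm with one-sided error never wrongly reports an unsatisfiable formula as satisfiable (e.g. it answers ''satisfiable'' only when it has found a satisfying assignment), and on a satisfiable input it answers ''satisfiable'' with probability at least $1/2$ (or any fixed constant). *)

(* Defs.v *)
From Stdlib Require Import Reals.
From mathcomp Require Import all_boot.

Set Implicit Arguments.
Unset Strict Implicit.
Unset Printing Implicit Defensive.

(** * CNF formulas *)

(* [(i, b)] is the variable [i] if [b = true] and its negation otherwise. *)
Definition literal (n : nat) : Type := ('I_n * bool)%type.
Definition clause (n : nat) : Type := seq (literal n).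
Definition cnf (n : nat) : Type := seq (clause n).

Definition lit_true n (a : {ffun 'I_n -> bool}) (l : literal n) : bool :=
  a l.1 == l.2.

Definition satisfies n (a : {ffun 'I_n -> bool}) (F : cnf n) : bool :=
  all (has (lit_true a)) F.

Definition satisfiable n (F : cnf n) : bool :=
  [exists a : {ffun 'I_n -> bool}, satisfies a F].

(* A formula is a set of clauses and a clause is a set of literals, presented
   as repetition-free sequences in an arbitrary order.  With repetitions the
   input would be arbitrarily long for fixed [n], and no algorithm reading it
   could have a running time bounded in terms of [n] only. *)
Definition is_kcnf (k n : nat) (F : cnf n) : bool :=
  uniq (F : seq (seq ('I_n * bool))) &&
  all (fun C : seq ('I_n * bool) => uniq C && (size C <= k)) F.

(** * Randomized programs

    The machine model is the imperative language WHILE of N. D. Jones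
    (Computability and Complexity from a Programming Perspective, 1997) in
    three-address form, extended with a fair coin.  The data are binary trees,
    which a machine stores as pointers to shared cells.  Every elementary step
    touches boundedly many cells: there is no unit-cost arithmetic and no
    unit-cost comparison of trees. *)

Inductive tree : Type := Leaf | Node of tree & tree.

Definition is_leaf (t : tree) : bool := if t is Leaf then true else false.
Definition hd (t : tree) : tree := if t is Node l _ then l else Leaf.
Definition tl (t : tree) : tree := if t is Node _ r then r else Leaf.

(* Program variables are named by natural numbers; a program mentions finitely
   many of them. *)
Inductive cmd : Type :=
| SetLeaf of nat                  (* x := leaf *)
| Copy    of nat & nat            (* x := y *)
| SetNode of nat & nat & nat      (* x := node y z *)
| SetHd   of nat & nat            (* x := hd y *)
| SetTl   of nat & nat            (* x := tl y *)
| Flip    of nat                  (* x := fair coin *)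
| Seq     of cmd & cmd            (* c ; d *)
| If      of nat & cmd & cmd      (* if x is not leaf then c else d *)
| While   of nat & cmd.           (* while x is not leaf do c *)

Definition store : Type := nat -> tree.

Definition update (s : store) (x : nat) (t : tree) : store :=
  fun y => if y == x then t else s y.

(* The commands still to be executed, first one first, and the store. *)
Definition config : Type := (seq cmd * store)%type.

Definition enc_bool (b : bool) : tree := if b then Node Leaf Leaf else Leaf.

(* One step of time.  As in a probabilistic Turing machine, a fresh fair coin
   [b] is tossed at every step; only [Flip] looks at it. *)
Definition step (cf : config) (b : bool) : config :=
  let: (k, s) := cf in
  match k with
  | [::] => cf
  | SetLeaf x :: k' => (k', update s x Leaf)
  | Copy x y :: k' => (k', update s x (s y))
  | SetNode x y z :: k' => (k', update s x (Node (s y) (s z)))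
  | SetHd x y :: k' => (k', update s x (hd (s y)))
  | SetTl x y :: k' => (k', update s x (tl (s y)))
  | Flip x :: k' => (k', update s x (enc_bool b))
  | Seq c d :: k' => (c :: d :: k', s)
  | If x c d :: k' => ((if is_leaf (s x) then d else c) :: k', s)
  | While x c :: k' => ((if is_leaf (s x) then k' else c :: k), s)
  end.

Definition halted (cf : config) : bool := nilp cf.1.

(* Variable 0 holds the input at the start and the answer at the end. *)
Definition init (p : cmd) (input : tree) : config :=
  ([:: p], update (fun=> Leaf) 0 input).

(* [size w] steps with coin tosses [w]. *)
Definition run (p : cmd) (input : tree) (w : seq bool) : config :=
  foldl step (init p input) w.

Definition accepts (p : cmd) (input : tree) (w : seq bool) : bool :=
  let cf := run p input w in halted cf && ~~ is_leaf (cf.2 0).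

Definition halts_within (p : cmd) (input : tree) (t : nat) : Prop :=
  forall w : t.-tuple bool, halted (run p input w).

Local Open Scope R_scope.

(* Halted configurations are stationary, so for any [t] with
   [halts_within p input t] this is the probability that [p] accepts. *)
Definition prob_accept (p : cmd) (input : tree) (t : nat) : R :=
  INR #|[set w : t.-tuple bool | accepts p input w]| / 2 ^ t.

(** * Input encoding *)

(* Numbers are written in unary; compared with binary this changes the length
   of the input by a factor at most [n]. *)
Definition enc_nat (m : nat) : tree := iter m (Node Leaf) Leaf.

Definition enc_seq (T : Type) (enc : T -> tree) (s : seq T) : tree :=
  foldr (fun x t => Node (enc x) t) Leaf s.

Definition enc_literal n (l : literal n) : tree :=
  Node (enc_bool l.2) (enc_nat l.1).

(* As in the DIMACS format, the number of variables precedes the clauses. *)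
Definition enc_cnf n (F : cnf n) : tree :=
  Node (enc_nat n) (enc_seq (enc_seq (@enc_literal n)) F).

(** * Algorithms for k-SAT *)

(* [T] bounds the running time for all formulas over [n] variables and all
   outcomes of the coin tosses. *)
Definition runs_in_time_on_ksat (k : nat) (p : cmd) (T : nat -> nat) : Prop :=
  forall n (F : cnf n), is_kcnf k F -> halts_within p (enc_cnf F) (T n).

Definition one_sided_error_ksat (k : nat) (p : cmd) (T : nat -> nat) : Prop :=
  forall n (F : cnf n), is_kcnf k F ->
    (~~ satisfiable F -> forall w : seq bool, ~~ accepts p (enc_cnf F) w) /\
    (satisfiable F -> 1 / 2 <= prob_accept p (enc_cnf F) (T n)).

Definition is_bigO (f g : nat -> R) : Prop :=
  exists (C : R) (N : nat),
    forall n, (N <= n)%N -> Rabs (f n) <= C * Rabs (g n).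

(* Main.v *)
Require Import Defs.
From Stdlib Require Import Reals FunctionalExtensionality.
From mathcomp Require Import all_boot all_order all_algebra Rstruct.
From mathcomp Require Import ring lra zify.

(** PPSZ: assign the variables in random order; a variable is set as a bounded-depth
    search for a refutation dictates, and by a fair coin if the search finds nothing.

    If a variable is frozen (it has the same value in all remaining solutions), then
    flipping it and any further variables falsifies some clause, which grows a ternary
    tree of critical clauses.  When the variable comes at time [r] of a uniform order,
    Harris' inequality bounds the probability that the tree is cut, hence that the value
    is found by the search, by the least root of [Q = (r + (1 - r) Q)^3] in the limit of
    deep trees.  Integration over [r] bounds the probability of a coin toss by
    [420 / 757 < log 1.46899 / log 2].

    A variable that is not frozen has at least two good values.  Following Hertli, a
    random solution is drawn by repeatedly fixing a uniform literal that keeps the formula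
    satisfiable; charging [S >= 1/2] coin tosses to every variable that is not frozen, the
    expected cost decreases in each step by as much as the success probability loses, by
    convexity of [2 ^ - c].

    The trials are repeated about [c ^ n] times, [2 ^ (420 / 757) < c < 1.46899]. *)

Set Implicit Arguments.
Unset Strict Implicit.
Unset Printing Implicit Defensive.
Import Order.TTheory GRing.Theory Num.Theory.

(** * Hertli's analysis of PPSZ with several satisfying assignments *)

(** The bound [rho_int 1] on the exponent lies strictly below the target exponent, and all losses
    are paid from this gap: the finite search depth ([de] in [frozen_cost_bound]), the rational base
    of the number of trials, the polynomial time of a trial, and the bias of a variable that is
    chosen by reducing coin bits modulo the number of remaining variables ([2 ^ - L0] per step). No
    measure or integral is constructed: expectations are recursions over lists of variables or bits,
    and integrals are differences of explicit antiderivatives, compared by the mean value theorem. A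
    second obstacle is that one fixed program serves all [n], while the bounds on its loops depend
    on [n]. These bounds are therefore annotations that are erased, and the coins of a trial are
    tossed onto a tape in advance, so that everything except the tossing is deterministic. *)

Section Formula.
Variables (n : nat) (F : cnf n).
Implicit Types (U : {set 'I_n}) (f g h : {ffun 'I_n -> bool}) (x y : 'I_n).
Implicit Types (a : seq ('I_n * bool)).

(* Partial assignments are lists of literals that are assumed to be false.  Branching on a
   variable that is already assigned is harmless: one of the branches is contradictory. *)
Fixpoint refuted d a : bool :=
  if d is d'.+1 then
    has (fun y => refuted d' ((y, true) :: a) && refuted d' ((y, false) :: a))
      (enum 'I_n)
  else has (all (mem a)) (F : seq (seq ('I_n * bool))).

Lemma refuted_mono d a a' : {subset a <= a'} -> refuted d a -> refuted d a'.
Proof.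
elim: d a a' => [|d IH] a a' sub /= /hasP[].
  move=> C CF /allP Ca; apply/hasP; exists C => //; apply/allP => l /Ca; exact: sub.
move=> y _ /andP[r1 r2]; apply/hasP; exists y; first by rewrite mem_enum.
have sub' b : {subset (y, b) :: a <= (y, b) :: a'}.
  by move=> l; rewrite !inE => /orP[->//|/sub ->]; rewrite orbT.
by rewrite (IH _ _ _ r1) // (IH _ _ _ r2).
Qed.

Lemma refuted_leq d d' a : 'I_n -> d <= d' -> refuted d a -> refuted d' a.
Proof.
move=> x /subnK <-; elim: (d' - d) => // k IH r.
rewrite addSn /=; apply/hasP; exists x; first by rewrite mem_enum.
by rewrite !(refuted_mono _ (IH r)) // => l la; rewrite inE la orbT.
Qed.

Lemma refuted_sound d a g : satisfies g F -> (forall l, l \in a -> ~~ lit_true g l) ->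
  ~~ refuted d a.
Proof.
move=> gF; elim: d a => [|d IH] a ga /=; apply/hasPn.
  move=> C CF; have /hasP[l lC gl] := allP gF _ CF.
  by apply/allPn; exists l => //; apply/negP => /ga /negP; apply.
move=> y _; rewrite negb_and.
have [gy|gy] := boolP (g y); [apply/orP; right|apply/orP; left]; apply: IH => l;
  rewrite inE => /orP[/eqP->|/ga //]; by rewrite /lit_true /= ?gy // (negbTE gy).
Qed.

(* The state of PPSZ in which the variables outside [U] are set as in [g]. *)
Definition extensions U g : {set {ffun 'I_n -> bool}} :=
  [set h | satisfies h F && [forall y, (y \notin U) ==> (h y == g y)]].

Definition frozen U g x := [forall h in extensions U g, h x == g x].

Lemma extensionsP U g h :
  reflect (satisfies h F /\ forall y, y \notin U -> h y = g y) (h \in extensions U g).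
Proof.
rewrite inE; apply: (iffP andP) => -[hF H]; split => //.
  by move=> y yU; apply/eqP; exact: (implyP (forallP H y)).
by apply/forallP => y; apply/implyP => /H ->.
Qed.

Lemma extensions_refl U g : satisfies g F -> g \in extensions U g.
Proof. by move=> gF; apply/extensionsP. Qed.

Lemma extensions_eq U g h : h \in extensions U g -> extensions U h = extensions U g.
Proof.
move=> /extensionsP[_ H]; apply/setP => k; rewrite !inE; congr (_ && _).
apply: eq_forallb => y; have [//|yU] := boolP (y \in U).
by rewrite /= H.
Qed.

Lemma extensionsD1 U g x h : x \in U ->
  (h \in extensions (U :\ x) g) = (h \in extensions U g) && (h x == g x).
Proof.
move=> xU; apply/extensionsP/andP.
  move=> [hF H]; split; last by rewrite H // !inE eqxx.
  by apply/extensionsP; split=> // y yU; apply: H; rewrite !inE (negbTE yU) andbF.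
move=> [/extensionsP[hF H] /eqP hx]; split=> // y; rewrite !inE negb_and negbK.
by case/orP => [/eqP->|/H].
Qed.

Lemma frozenP U g x :
  reflect (forall h, h \in extensions U g -> h x = g x) (frozen U g x).
Proof.
apply: (iffP forallP) => H h.
  by move=> hU; apply/eqP; apply: (implyP (H h)).
by apply/implyP => /H ->.
Qed.

Lemma frozen_eq U g h x : satisfies g F -> h \in extensions U g ->
  frozen U h x = frozen U g x.
Proof.
move=> gF hg; have E := extensions_eq hg.
apply/frozenP/frozenP => H k.
  by move=> kg; rewrite H ?E // -(H g) // E extensions_refl.
by rewrite E => /H ->; rewrite (H h).
Qed.

Lemma frozenD1 U g x y : y \in U -> frozen U g x -> frozen (U :\ y) g x.
Proof.
move=> yU /frozenP H; apply/frozenP => h; rewrite extensionsD1 // => /andP[/H-> //].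
Qed.

Definition false_lits U g : seq ('I_n * bool) := [seq (y, ~~ g y) | y <- enum (~: U)].

Lemma mem_false_lits U g y b :
  ((y, b) \in false_lits U g) = (y \notin U) && (b == ~~ g y).
Proof.
apply/mapP/andP => [[z]|[yU /eqP->]].
  by rewrite mem_enum inE => zU [-> ->].
by exists y => //; rewrite mem_enum inE.
Qed.

Lemma false_lits_eq U g h : h \in extensions U g -> false_lits U h = false_lits U g.
Proof.
move=> /extensionsP[_ H]; apply/eq_in_map => y; rewrite mem_enum inE => yU.
by rewrite H.
Qed.

Variable d : nat.

(** The list holds false literals, so [(x, g x)] assumes the wrong value of [x]; refuting it is what
    forces the value [g x]. *)
Definition guessed U g x := ~~ refuted d ((x, g x) :: false_lits U g).

Lemma guessed_mono U U' g x : U' \subset U -> guessed U' g x -> guessed U g x.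
Proof.
move=> /subsetP sub; apply: contra; apply: refuted_mono => -[y b].
rewrite !inE !mem_false_lits => /orP[->//|/andP[yU ->]].
by rewrite andbT (contra (sub y) yU) orbT.
Qed.

Lemma false_lits_false U g l : l \in false_lits U g -> ~~ lit_true g l.
Proof.
case: l => y b; rewrite mem_false_lits => /andP[_ /eqP->].
by rewrite /lit_true /= ; case: (g y).
Qed.

Lemma not_refuted_true U g x : satisfies g F ->
  ~~ refuted d ((x, ~~ g x) :: false_lits U g).
Proof.
move=> gF; apply: (refuted_sound _ gF) => l; rewrite inE => /orP[/eqP->|].
  by rewrite /lit_true /=; case: (g x).
exact: false_lits_false.
Qed.

(** A second solution with the other value of [x] satisfies all that is assumed, and a sound search
    refutes nothing that has a solution. *)
Lemma liquid_guessed U g x : ~~ frozen U g x -> guessed U g x.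
Proof.
move=> /forallPn[h]; rewrite negb_imply => /andP[hU hx].
have /extensionsP[hF _] := hU.
rewrite /guessed -(false_lits_eq hU).
have -> : g x = ~~ h x by move: hx; case: (g x); case: (h x).
exact: not_refuted_true.
Qed.

Lemma guessed_eq U g h x : satisfies g F -> h \in extensions U g ->
  guessed U h x = guessed U g x.
Proof.
move=> gF hU; have [fr|/negP lq] := boolP (frozen U g x).
  by rewrite /guessed (false_lits_eq hU) (frozenP _ _ _ fr).
by rewrite !liquid_guessed // ?(frozen_eq x gF hU) //; apply/negP.
Qed.

Local Open Scope ring_scope.

(** * Random orders of the variables and the law of a random solution *)

Variable R : realFieldType.

(* The probability that [x] is guessed when the variables of [U] are set as in [g] in
   uniformly random order. *)
Fixpoint frozen_cost_rec m U g x : R :=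
  if m is m'.+1 then
    (m'.+1%:R)^-1 * ((guessed U g x)%:R + \sum_(y in U :\ x) frozen_cost_rec m' (U :\ y) g x)
  else 0.

Definition frozen_cost U g x : R := frozen_cost_rec #|U| U g x.

Lemma frozen_costE U g x : x \in U ->
  #|U|%:R * frozen_cost U g x = (guessed U g x)%:R + \sum_(y in U :\ x) frozen_cost (U :\ y) g x.
Proof.
move=> xU; rewrite /frozen_cost; case E : #|U| => [|m] /=.
  by move: xU; rewrite (cards0_eq E) inE.
rewrite mulrA divff ?pnatr_eq0 // mul1r; congr (_ + _); apply: eq_bigr => y.
rewrite !inE => /andP[_ yU]; move: E; rewrite (cardsD1 y) yU add1n => -[<-].
by [].
Qed.

Lemma cardsD1_lt U x : x \in U -> (#|U :\ x| < #|U|)%N.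
Proof. by move=> xU; rewrite (cardsD1 x U) xU. Qed.

Lemma cardsD1_R U x : x \in U -> #|U|%:R = 1 + #|U :\ x|%:R :> R.
Proof. by move=> xU; rewrite (cardsD1 x U) xU natrD. Qed.

(** Both costs obey [frozen_costE]. Adding [frozen_cost (U :\ y) g x] to both sides of the recursion
    for [U :\ y] gives it the factor [#|U|] as well; the remaining sums run over the same variables
    and are compared termwise by induction. *)
Lemma frozen_costD1_le U g x y : x \in U -> y \in U -> y != x ->
  frozen_cost (U :\ y) g x <= frozen_cost U g x.
Proof.
move: {2}_.+1 (ltnSn #|U|) => m; elim: m U y => // m IH U y; rewrite ltnS => Um xU yU yx.
have xUy : x \in U :\ y by rewrite !inE eq_sym yx.
have := frozen_costE g xU; have := frozen_costE g xUy.
have yUx : y \in U :\ x by rewrite !inE yx yU.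
rewrite (cardsD1_R yU) (big_setD1 y yUx) /=.
have -> : U :\ y :\ x = U :\ x :\ y by rewrite setDDl setUC -setDDl.
have lt : \sum_(z in U :\ x :\ y) frozen_cost (U :\ y :\ z) g x
   <= \sum_(z in U :\ x :\ y) frozen_cost (U :\ z) g x.
  apply: ler_sum => z; rewrite !inE => /and3P[zy zx zU].
  have -> : U :\ y :\ z = U :\ z :\ y by rewrite setDDl setUC -setDDl.
  apply: IH; rewrite ?inE // ?xU ?yU ?(eq_sym x) ?(eq_sym y) ?zx ?zy //.
  exact: leq_trans (cardsD1_lt zU) Um.
have gle : (guessed (U :\ y) g x)%:R <= (guessed U g x)%:R :> R.
  rewrite ler_nat; have := @guessed_mono U (U :\ y) g x (subD1set _ _).
  by case: guessed => // ->.
have : 0 < 1 + #|U :\ y|%:R :> R by rewrite -(cardsD1_R yU) ltr0n (cardD1 y) yU.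
set c := #|U :\ y|%:R; set s1 := \sum_(z in _) _ in lt *;
  set s2 := \sum_(z in _) _ in lt * => c1 e1 e2.
rewrite -(ler_pM2l c1); move: e1 e2; rewrite !mulrDl !mul1r; lra.
Qed.

Lemma frozen_cost_ge0 U g x : 0 <= frozen_cost U g x.
Proof.
rewrite /frozen_cost; move: #|U| => m; elim: m U => //= m IH U.
by rewrite mulr_ge0 ?invr_ge0 // addr_ge0 // sumr_ge0.
Qed.

Definition nviable U g x : nat := if frozen U g x then 1 else 2.
Definition nlits U g : R := \sum_(x in U) (nviable U g x)%:R.

(* The probability of ending in [g] when one repeatedly sets a uniformly random literal
   that is true in some remaining solution; a variable that is not frozen has two of them. *)
Fixpoint likelihood_rec m U g : R :=
  if m is m'.+1 then
    (nlits U g)^-1 * \sum_(x in U) likelihood_rec m' (U :\ x) g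
  else 1.

Definition likelihood U g : R := likelihood_rec #|U| U g.

Lemma nlits_ge U g : #|U|%:R <= nlits U g.
Proof.
rewrite -sum1_card natr_sum; apply: ler_sum => x _; rewrite ler_nat /nviable.
by case: ifP.
Qed.

Lemma likelihood_ge0 U g : 0 <= likelihood U g.
Proof.
rewrite /likelihood; move: #|U| => m; elim: m U => //= m IH U; apply: mulr_ge0.
  by rewrite invr_ge0 (le_trans _ (nlits_ge _ _)).
by apply: sumr_ge0.
Qed.

Lemma nlits_gt0 U g : (0 < #|U|)%N -> 0 < nlits U g.
Proof. by move=> U0; apply: lt_le_trans (nlits_ge _ _); rewrite ltr0n. Qed.

Lemma likelihoodE U g : (0 < #|U|)%N ->
  nlits U g * likelihood U g = \sum_(x in U) likelihood (U :\ x) g.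
Proof.
move=> U0; have N0 := nlits_gt0 g U0; move: U0; rewrite /likelihood.
case E : #|U| => [|m] // _ /=.
rewrite mulrA divff ?lt0r_neq0 // mul1r; apply: eq_bigr => y yU.
by move: E; rewrite (cardsD1 y) yU add1n => -[<-].
Qed.

Lemma nviableD1 U g x y : y \in U -> (nviable (U :\ y) g x <= nviable U g x)%N.
Proof.
move=> yU; rewrite /nviable; case: ifP => [_|/negbT fr]; first by case: ifP.
by case: ifP => // /(frozenD1 yU) H; rewrite H in fr.
Qed.

Lemma nlitsD1 U g y : y \in U -> nlits (U :\ y) g + 1 <= nlits U g.
Proof.
move=> yU; rewrite /nlits (big_setD1 y yU) /= [leRHS]addrC; apply: lerD.
  by apply: ler_sum => x _; rewrite ler_nat nviableD1.
by rewrite ler1n /nviable; case: ifP.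
Qed.

(** By induction the summands of [likelihoodE] other than that of [y] do not decrease when [y] is
    set too, so [nlits U g] times the left side is at most [1 + nlits (U :\ y) g] times the right
    side; setting [y] removes at least one viable literal. *)
Lemma likelihoodD1 U g y : y \in U -> likelihood U g <= likelihood (U :\ y) g.
Proof.
move: {2}_.+1 (ltnSn #|U|) => m; elim: m U y => // m IH U y; rewrite ltnS => Um yU.
have U0 : (0 < #|U|)%N by rewrite (cardD1 y) yU.
have := likelihoodE g U0; rewrite (big_setD1 y yU) /= => e1.
have le2 : \sum_(x in U :\ y) likelihood (U :\ x) g <= nlits (U :\ y) g * likelihood (U :\ y) g.
  have [Uy0|Uy0] := leqP #|U :\ y| 0.
    move: Uy0; rewrite leqn0 cards_eq0 => /eqP ->; rewrite /nlits !big_set0 mul0r //.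
  rewrite likelihoodE //; apply: ler_sum => x; rewrite !inE => /andP[xy xU].
  have -> : U :\ y :\ x = U :\ x :\ y by rewrite setDDl setUC -setDDl.
  apply: IH; last by rewrite !inE eq_sym xy.
  exact: leq_trans (cardsD1_lt xU) Um.
rewrite -(ler_pM2l (nlits_gt0 g U0)) e1.
apply: (@le_trans _ _ ((1 + nlits (U :\ y) g) * likelihood (U :\ y) g)).
  by rewrite mulrDl mul1r lerD2l.
by apply: ler_wpM2r; rewrite ?likelihood_ge0 // addrC nlitsD1.
Qed.

Definition flipped U g x : {ffun 'I_n -> bool} :=
  odflt g [pick h in extensions U g | h x != g x].

Lemma flippedP U g x : ~~ frozen U g x ->
  flipped U g x \in extensions U g /\ flipped U g x x = ~~ g x.
Proof.
move=> /forallPn[h]; rewrite negb_imply => /andP[hU hx]; rewrite /flipped.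
case: pickP => [k /andP[kU kx]|/(_ h)]; last by rewrite hU hx.
by split=> //=; move: kx; case: (g x); case: (k x).
Qed.

Lemma sum_extensionsD1 U g x (phi : {ffun 'I_n -> bool} -> R) : x \in U ->
  \sum_(h in extensions U g) phi h =
  \sum_(h in extensions (U :\ x) g) phi h +
  (if frozen U g x then 0 else \sum_(h in extensions (U :\ x) (flipped U g x)) phi h).
Proof.
move=> xU; rewrite (bigID (fun h : {ffun 'I_n -> bool} => h x == g x)) /=; congr (_ + _).
  by apply: eq_bigl => h; rewrite extensionsD1.
case: ifP => [/frozenP fr|/negbT lq].
  by apply: big_pred0 => h; apply/negbTE/negP => /andP[/fr->]; rewrite eqxx.
have [fU fx] := flippedP lq.
apply: eq_bigl => h; rewrite extensionsD1 // (extensions_eq fU) fx.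
by case: (g x); case: (h x).
Qed.

Lemma sum_likelihood U g : satisfies g F -> \sum_(h in extensions U g) likelihood U h = 1.
Proof.
move: {2}_.+1 (ltnSn #|U|) => m; elim: m U g => // m IH U g; rewrite ltnS => Um gF.
have [U0|U0] := leqP #|U| 0.
  move: U0; rewrite leqn0 cards_eq0 => /eqP ->.
  rewrite (big_pred1 g) /likelihood ?cards0 //= => h /=; apply/extensionsP/eqP => [[_ H]|->].
    by apply/ffunP => y; rewrite H // inE.
  by [].
have N0 := nlits_gt0 g U0.
apply: (mulfI (lt0r_neq0 N0)); rewrite mulr1 mulr_sumr.
transitivity (\sum_(h in extensions U g) \sum_(x in U) likelihood (U :\ x) h).
  apply: eq_bigr => h hg; rewrite -likelihoodE //; congr (_ * _).
  by apply: eq_bigr => x _; rewrite /nviable (frozen_eq x gF hg).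
rewrite exchange_big /=; apply: eq_bigr => x xU; rewrite (sum_extensionsD1 _ _ xU) /nviable.
have Um' := leq_trans (cardsD1_lt xU) Um.
rewrite IH //; case: ifP => [_|/negbT lq]; rewrite ?addr0 // IH -?natrD //.
by have [/extensionsP[]] := flippedP lq.
Qed.

Lemma sum_likelihoodD1 U g x (phi : {ffun 'I_n -> bool} -> R) : satisfies g F -> x \in U ->
  (forall h k, satisfies k F -> h \in extensions (U :\ x) k -> phi h = phi k) ->
  \sum_(h in extensions U g) likelihood (U :\ x) h * phi h =
  phi g + (if frozen U g x then 0 else phi (flipped U g x)).
Proof.
move=> gF xU phiE; rewrite (sum_extensionsD1 _ _ xU).
have S k : satisfies k F ->
    \sum_(h in extensions (U :\ x) k) likelihood (U :\ x) h * phi h = phi k.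
  move=> kF; rewrite -[RHS]mul1r -(sum_likelihood (U :\ x) kF) mulr_suml.
  by apply: eq_bigr => h hk; rewrite (phiE h k).
rewrite S //; case: ifP => [//|/negbT lq]; rewrite S //.
by have [/extensionsP[]] := flippedP lq.
Qed.

Lemma sum_likelihoodD1_nviable U g x : satisfies g F -> x \in U ->
  \sum_(h in extensions U g) likelihood (U :\ x) h = (nviable U g x)%:R.
Proof.
move=> gF xU; have := @sum_likelihoodD1 U g x (fun=> 1) gF xU (fun _ _ _ _ => erefl).
rewrite (eq_bigr (fun h => likelihood (U :\ x) h)); last by move=> h _; rewrite mulr1.
by move->; rewrite /nviable; case: ifP; rewrite ?addr0 // -natrD.
Qed.

Variable S : R.
Hypothesis S_ge : 1 / 2 <= S.
Hypothesis frozen_cost_le : forall U g x, satisfies g F -> x \in U ->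
  frozen U g x -> frozen_cost U g x <= S.

Definition var_cost U g x : R :=
  if x \in U then if frozen U g x then frozen_cost U g x else S else 0.

Lemma cost_le U g x : satisfies g F -> var_cost U g x <= S.
Proof.
move=> gF; rewrite /var_cost; have S0 : 0 <= S by move: S_ge; lra.
by case: ifP => // xU; case: ifP => // fr; apply: frozen_cost_le.
Qed.

Definition avg_cost1 U g x : R := \sum_(h in extensions U g) likelihood U h * var_cost U h x.
Definition avg_cost U g : R := \sum_x avg_cost1 U g x.

(* Setting a literal of [g] does not decrease the likelihood of [g] and does not increase
   the var_cost.  Hence, although the literals of [g] are not equally likely given [g], a frozen
   variable loses at least what it loses when they are. *)
Lemma avg_cost1_step U g x : satisfies g F -> x \in U ->
  \sum_(y in U) \sum_(h in extensions U g) likelihood (U :\ y) h * var_cost (U :\ y) h x <=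
  nlits U g * avg_cost1 U g x - (if frozen U g x then (guessed U g x)%:R else 2 * S).
Proof.
move=> gF xU; have U0 : (0 < #|U|)%N by rewrite (cardD1 x) xU.
have N0 := nlits_gt0 g U0.
have Neq h : h \in extensions U g -> nlits U h = nlits U g.
  by move=> hg; apply: eq_bigr => y _; rewrite /nviable (frozen_eq y gF hg).
have [fr|lq] := boolP (frozen U g x).
  rewrite exchange_big /= /avg_cost1 mulr_sumr.
  set w := _%:R; rewrite -[X in _ <= _ - X]mul1r -(sum_likelihood U gF) mulr_suml -sumrB.
  apply: ler_sum => h hg; have [hF _] := extensionsP _ _ _ hg.
  have frh : frozen U h x by rewrite (frozen_eq x gF hg).
  rewrite mulrA -(Neq h hg) likelihoodE // mulr_suml.
  (* By [frozen_costE], [w] is the total drop of the cost of [x] over all choices of the next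
     variable. *)
  have -> : w = \sum_(y in U) (var_cost U h x - var_cost (U :\ y) h x).
    rewrite /w -(guessed_eq x gF hg) sumrB sumr_const (big_setD1 x xU) /=.
    rewrite /var_cost xU frh !inE eqxx add0r.
    rewrite -[frozen_cost U h x *+ _]mulr_natl frozen_costE //.
    rewrite (eq_bigr (fun y => frozen_cost (U :\ y) h x)) ?addrK // => y.
    by rewrite !inE eq_sym => /andP[-> yU]; rewrite xU frozenD1.
  rewrite mulr_sumr -sumrB; apply: ler_sum => y yU.
  have le1 := likelihoodD1 h yU.
  have le2 : var_cost (U :\ y) h x <= var_cost U h x.
    rewrite /var_cost xU frh !inE; case: eqP => [_|/eqP yx] /=; first exact: frozen_cost_ge0.
    by rewrite xU frozenD1 // frozen_costD1_le // eq_sym.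
  nra.
(* A variable that is not frozen costs [S] now, nothing once it is set, and at most [S] otherwise;
   its two literals account for the loss [2 * S]. *)
have costS : avg_cost1 U g x = S.
  rewrite /avg_cost1 -[RHS]mul1r -(sum_likelihood U gF) mulr_suml.
  apply: eq_bigr => h hg; by rewrite /var_cost xU (frozen_eq x gF hg) (negbTE lq).
rewrite costS (big_setD1 x xU) /= big1 ?add0r; last first.
  by move=> h _; rewrite /var_cost !inE eqxx mulr0.
have -> : nlits U g * S - 2 * S = (\sum_(y in U :\ x) (nviable U g y)%:R) * S.
  by rewrite /nlits (big_setD1 x xU) /= {1}/nviable (negbTE lq); ring.
rewrite mulr_suml; apply: ler_sum => y; rewrite !inE => /andP[_ yU].
rewrite -(sum_likelihoodD1_nviable gF yU) mulr_suml; apply: ler_sum => h hg.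
apply: ler_wpM2l; first exact: likelihood_ge0.
by apply: cost_le; have [] := extensionsP _ _ _ hg.
Qed.

Lemma avg_cost_setT g : satisfies g F -> avg_cost setT g <= n%:R * S.
Proof.
move=> gF; rewrite /avg_cost -[X in X%:R]card_ord -sum1_card natr_sum mulr_suml.
apply: ler_sum => x _; rewrite mul1r /avg_cost1 -[leRHS]mul1r -(sum_likelihood setT gF).
rewrite mulr_suml; apply: ler_sum => h hg; apply: ler_wpM2l; first exact: likelihood_ge0.
by apply: cost_le; have [] := extensionsP _ _ _ hg.
Qed.

Lemma avg_cost_step U g : satisfies g F ->
  \sum_(y in U) (avg_cost (U :\ y) g +
     if frozen U g y then 0 else avg_cost (U :\ y) (flipped U g y)) <=
  nlits U g * avg_cost U g -
    \sum_(x in U) (if frozen U g x then (guessed U g x)%:R else 2 * S).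
Proof.
move=> gF.
have out (V : {set 'I_n}) h x : x \notin V -> avg_cost1 V h x = 0.
  by move=> xV; apply: big1 => k _; rewrite /var_cost (negbTE xV) mulr0.
have avgE (V : {set 'I_n}) h (W : {set 'I_n}) : V \subset W ->
    avg_cost V h = \sum_(x in W) avg_cost1 V h x.
  move=> /subsetP VW; rewrite /avg_cost (bigID (mem W)) /= [X in _ + X]big1 ?addr0 //.
  by move=> x xW; apply: out; apply: contra xW; apply: VW.
rewrite (avgE U g U) // mulr_sumr -sumrB.
have -> : \sum_(y in U) (avg_cost (U :\ y) g +
     (if frozen U g y then 0 else avg_cost (U :\ y) (flipped U g y))) =
  \sum_(x in U) \sum_(y in U) \sum_(h in extensions U g)
    likelihood (U :\ y) h * var_cost (U :\ y) h x.
  rewrite exchange_big /=; apply: eq_bigr => y yU.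
  rewrite exchange_big /= (sum_extensionsD1 _ _ yU).
  have H k : avg_cost (U :\ y) k =
    \sum_(h in extensions (U :\ y) k) \sum_(x in U) likelihood (U :\ y) h * var_cost (U :\ y) h x.
    by rewrite exchange_big /= (avgE _ _ U) // subD1set.
  by rewrite !H.
by apply: ler_sum => x xU; apply: avg_cost1_step.
Qed.

(* [e c] stands for [2 ^ - c]; [l] stands for [ln 2]. *)
Variables (e : R -> R) (l : R).
Hypothesis e_half : forall s : R, e (s + 1) = e s / 2.
Hypothesis e_convex : forall s t : R, e t * (1 - l * (s - t)) <= e s.
Hypothesis e_ge0 : forall s : R, 0 <= e s.
Hypothesis l_ge0 : 0 <= l.
Hypothesis l_le1 : l <= 1.

Definition step_bound U g x : R :=
  if frozen U g x then (if guessed U g x then 1 / 2 else 1) * e (avg_cost (U :\ x) g)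
  else 1 / 2 * e (avg_cost (U :\ x) g) + 1 / 2 * e (avg_cost (U :\ x) (flipped U g x)).

Lemma step_bound_sum U g : satisfies g F ->
  #|U|%:R * e (avg_cost U g) <= \sum_(x in U) step_bound U g x.
Proof.
move=> gF; set c := avg_cost U g.
(* [T] linearizes [step_bound] at [c]: by [e_half] a coin toss shifts the argument by 1, and the
   tangent at [c] lies below [e]. *)
pose T x : R := if frozen U g x then
    1 - l * (avg_cost (U :\ x) g + (guessed U g x)%:R - c)
  else 2 - l * (avg_cost (U :\ x) g + avg_cost (U :\ x) (flipped U g x) + 2 - 2 * c).
have le1 : \sum_(x in U) e c * T x <= \sum_(x in U) step_bound U g x.
  apply: ler_sum => x xU; rewrite /step_bound /T.
  have half c' : e c' * (1 / 2) = e (c' + 1) by rewrite e_half; ring.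
  case: ifP => fr.
    case: guessed; [have := e_convex (avg_cost (U :\ x) g + 1) c; rewrite e_half
                   |have := e_convex (avg_cost (U :\ x) g) c]; rewrite /= ?addr0; lra.
  have := e_convex (avg_cost (U :\ x) g + 1) c.
  have := e_convex (avg_cost (U :\ x) (flipped U g x) + 1) c.
  rewrite !e_half; lra.
apply: le_trans le1; rewrite -mulr_sumr mulrC; apply: ler_wpM2l; first exact: e_ge0.
have sumT : \sum_(x in U) T x = nlits U g - l * (
   \sum_(y in U) (avg_cost (U :\ y) g +
     (if frozen U g y then 0 else avg_cost (U :\ y) (flipped U g y))) - nlits U g * c
   + \sum_(x in U) (if frozen U g x then (guessed U g x)%:R else 2)).
  rewrite /nlits mulr_suml -sumrB -big_split /= mulr_sumr -sumrB.
  by apply: eq_bigr => x xU; rewrite /T /nviable; case: ifP => _; ring.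
rewrite sumT.
have step := avg_cost_step U gF.
set s1 := \sum_(y in U) (avg_cost _ _ + _) in step *.
set s2 := \sum_(x in U) (if _ then _ else 2 * S) in step *.
set s3 := \sum_(x in U) _; rewrite -/c in step.
(* Here [1 / 2 <= S] enters: a variable that is not frozen leaves [2 - 2 * S <= 1], the surplus of
   its two literals over one. In [sumT] this surplus is multiplied by [l <= 1], so the same surplus
   in [nlits U g] outweighs it. *)
have s32 : s3 - s2 <= nlits U g - #|U|%:R.
  rewrite /s3 /s2 /nlits -sumrB -sum1_card natr_sum -sumrB; apply: ler_sum => x _.
  by rewrite /nviable; case: ifP => _; move: S_ge; lra.
have N := nlits_ge U g.
have h1 : l * (s1 - nlits U g * c + s3) <= l * (nlits U g - #|U|%:R).
  by apply: ler_wpM2l => //; lra.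
have h2 : l * (nlits U g - #|U|%:R) <= 1 * (nlits U g - #|U|%:R).
  by apply: ler_wpM2r => //; lra.
lra.
Qed.

End Formula.

Local Open Scope ring_scope.

(** * Critical clause trees *)

Section Expectation.
Variables (R : realFieldType) (T : finType).
Implicit Types (r : R) (A B : {set T}) (f : {set T} -> R) (vs : seq T).

(** This stands in for the product measure of density [r] on the subsets of [vs]; the recursion on
    the list allows differentiation in [r] step by step. *)
Fixpoint expect r vs f A : R :=
  if vs is y :: vs' then r * expect r vs' f (y |: A) + (1 - r) * expect r vs' f A
  else f A.

Lemma expect_ext r vs f f' A : f =1 f' -> expect r vs f A = expect r vs f' A.
Proof. by move=> ff'; elim: vs A => //= y vs IH A; rewrite !IH. Qed.

Lemma expect_shift r vs f y A :
  expect r vs f (y |: A) = expect r vs (fun B => f (y |: B)) A.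
Proof. by elim: vs A => //= z vs IH A; rewrite setUCA !IH. Qed.

Lemma expect_cst r vs c A : expect r vs (fun=> c) A = c.
Proof. by elim: vs A => //= z vs IH A; rewrite !IH; ring. Qed.

Lemma expect_rem r vs f y A : y \in vs ->
  expect r vs f A =
  r * expect r (rem y vs) f (y |: A) + (1 - r) * expect r (rem y vs) f A.
Proof.
elim: vs A => //= z vs IH A; rewrite inE eq_sym; case: eqP => [->//|_ /= yvs].
by rewrite !(IH _ yvs) setUCA; ring.
Qed.

Lemma expect_perm r vs ws f A : perm_eq vs ws -> expect r vs f A = expect r ws f A.
Proof.
elim: vs ws A => [|y vs IH] ws A pvw.
  by move: pvw; rewrite perm_sym => /perm_nilP->.
have yws : y \in ws by rewrite -(perm_mem pvw) mem_head.
rewrite (expect_rem _ _ _ yws) /=.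
have pvw' : perm_eq vs (rem y ws).
  by rewrite -(perm_cons y); apply: perm_trans pvw _; apply: perm_to_rem.
by rewrite !(IH _ _ pvw').
Qed.

Lemma expectB r vs f f' A :
  expect r vs (fun B => f B - f' B) A = expect r vs f A - expect r vs f' A.
Proof. by elim: vs A => //= y vs IH A; rewrite !IH; ring. Qed.

Lemma expect0 vs f A : expect 0 vs f A = f A.
Proof. by elim: vs A => //= y vs IH A; rewrite !IH; ring. Qed.

Definition expect_one r vs f A : R := \sum_(y <- vs) expect r (rem y vs) f (y |: A).

Lemma expect_one_cons r y vs f A : uniq (y :: vs) ->
  expect_one r (y :: vs) f A =
  expect r vs f (y |: A) + r * expect_one r vs f (y |: A) + (1 - r) * expect_one r vs f A.
Proof.
move=> /= /andP[yvs _]; rewrite /expect_one big_cons /= eqxx -addrA; congr (_ + _).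
rewrite !mulr_sumr -big_split; apply: eq_big_seq => z zvs /=.
by case: eqP => [E|_]; [rewrite E zvs in yvs|rewrite /= setUCA].
Qed.

Variable r : R.
Hypothesis r01 : 0 <= r <= 1.

Lemma expect_le vs f f' A : (forall B, f B <= f' B) -> expect r vs f A <= expect r vs f' A.
Proof.
move=> ff'; elim: vs A => //= y vs IH A; case/andP: r01 => r0 r1.
by apply: lerD; apply: ler_wpM2l; rewrite ?subr_ge0.
Qed.

Definition increasing f := forall A B, A \subset B -> f A <= f B.

Lemma expect_increasing vs f : increasing f -> increasing (expect r vs f).
Proof.
move=> incf; elim: vs => //= y vs IH A B AB; case/andP: r01 => r0 r1.
by apply: lerD; apply: ler_wpM2l; rewrite ?subr_ge0 //; apply: IH => //; apply: setUS.
Qed.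

(** Conditioning on [y] reduces the claim to two values, where it is Chebyshev's inequality: the
    gain is [r * (1 - r)] times a product of two nonnegative increments. *)
Lemma harris vs f f' A : increasing f -> increasing f' ->
  expect r vs f A * expect r vs f' A <= expect r vs (fun B => f B * f' B) A.
Proof.
move=> incf incf'; elim: vs A => //= y vs IH A; case/andP: r01 => r0 r1.
have := IH A; have := IH (y |: A).
have := expect_increasing vs incf (subsetUr [set y] A).
have := expect_increasing vs incf' (subsetUr [set y] A).
set a := expect r vs f' A; set b := expect r vs f' _.
set c := expect r vs f A; set d := expect r vs f _ => ab cd h1 h2.
have h3 : 0 <= (r * (1 - r)) * ((b - a) * (d - c)).
  by rewrite !mulr_ge0 ?subr_ge0.
have h4 : r * (d * b) <= r * expect r vs (fun B => f B * f' B) (y |: A) by apply: ler_wpM2l.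
have h5 : (1 - r) * (c * a) <= (1 - r) * expect r vs (fun B => f B * f' B) A.
  by apply: ler_wpM2l; rewrite ?subr_ge0.
lra.
Qed.

Lemma harris_prod (I : Type) (s : seq I) vs (f : I -> {set T} -> R) A :
  (forall i B, 0 <= f i B) -> (forall i, increasing (f i)) ->
  \prod_(i <- s) expect r vs (f i) A <= expect r vs (fun B => \prod_(i <- s) f i B) A.
Proof.
move=> f0 incf; elim: s => [|i s IH].
  rewrite big_nil (expect_ext _ _ (f' := fun=> 1)) ?expect_cst // => B.
  by rewrite big_nil.
have -> : expect r vs (fun B => \prod_(j <- i :: s) f j B) A =
    expect r vs (fun B => f i B * \prod_(j <- s) f j B) A.
  by apply: expect_ext => B; rewrite big_cons.
rewrite big_cons.
have le0 : 0 <= expect r vs (f i) A by rewrite -(expect_cst r vs 0 A) expect_le.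
apply: (le_trans (ler_wpM2l le0 IH)); apply: harris => // B C BC /=.
elim: s {IH} => [|j s IH]; first by rewrite !big_nil.
by rewrite !big_cons ler_pM ?prodr_ge0 // incf.
Qed.

End Expectation.

(* The probability that a ternary tree of height [d] all of whose edges are
   independently cut with probability [r] has no uncut branch from the root. *)
Fixpoint cut_prob (R : realFieldType) d (r : R) : R :=
  if d is d'.+1 then (r + (1 - r) * cut_prob d' r) ^+ 3 else 0.

Lemma cut_prob01 (R : realFieldType) d (r : R) : 0 <= r <= 1 -> 0 <= cut_prob d r <= 1.
Proof.
move=> /andP[r0 r1]; elim: d => [|d /andP[IH0 IH1]] /=; first by rewrite lexx ler01.
have h0 : 0 <= (1 - r) * cut_prob d r by rewrite mulr_ge0 ?subr_ge0.
have h1 : (1 - r) * cut_prob d r <= (1 - r) * 1 by rewrite ler_wpM2l ?subr_ge0.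
by apply/andP; split; [apply: exprn_ge0|apply: exprn_ile1]; lra.
Qed.

Section Cut.
Variables (n : nat) (F : cnf n) (U : {set 'I_n}) (g : {ffun 'I_n -> bool}).
Implicit Types (A B : {set 'I_n}) (y : 'I_n).
Hypothesis gF : satisfies g F.
Hypothesis F4 : all (fun C : seq ('I_n * bool) => size C <= 4)%N F.

(* The critical clause tree of PPSZ: [B] is the set of labels on the path to the
   current node, and the clause chosen there is one falsified by flipping [g] on
   [B].  [cut d B A] says that the variables in [A] separate the node from the
   nodes [d] levels below. *)
Definition literal_cut (p : {set 'I_n} -> bool) B A (l : 'I_n * bool) : bool :=
  if l.1 \in B then g l.1 == l.2
  else (g l.1 != l.2) && [|| l.1 \notin U, l.1 \in A | p (l.1 |: B)].

Fixpoint cut d B A : bool :=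
  if d is d'.+1 then
    has (all (literal_cut (fun B' => cut d' B' A) B A)) (F : seq (seq ('I_n * bool)))
  else false.

Lemma cutS d B A : cut d.+1 B A =
  has (all (literal_cut (fun B' => cut d B' A) B A)) (F : seq (seq ('I_n * bool))).
Proof. by []. Qed.

Lemma cut_mono d B A A' : A \subset A' -> cut d B A -> cut d B A'.
Proof.
move=> /subsetP AA'; elim: d B => // d IH B.
rewrite !cutS; apply: sub_has => C; apply: sub_all => l.
rewrite /literal_cut; case: ifP => // _ /andP[-> /=] /or3P[->//|/AA'->|/IH->]; by rewrite ?orbT.
Qed.

Lemma cut_setU1 d B A y : y \in B -> cut d B (y |: A) = cut d B A.
Proof.
elim: d B => // d IH B yB; rewrite !cutS; apply: eq_has => C; apply: eq_all => l.
rewrite /literal_cut; case: ifP => // lB; rewrite IH ?inE ?yB ?orbT //.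
congr [&& _ & [|| _, _ | _]].
by case: eqP => // E; rewrite E yB in lB.
Qed.

(** The search branches on the at most four literals of the chosen clause in turn. Where [y] keeps
    its value in [g] it goes on along the clause until all its literals are false; where [y] is
    flipped, [y] joins [B] and the induction hypothesis applies. *)
Lemma cut_refuted (x : 'I_n) d B A (a : seq ('I_n * bool)) :
  (forall y, y \in B -> (y, g y) \in a) ->
  (forall y, y \notin B -> (y \notin U) || (y \in A) -> (y, ~~ g y) \in a) ->
  cut d B A -> refuted F (4 * d) a.
Proof.
elim: d B a => // d IH B a aB aA; rewrite cutS => /hasP[C CF Call].
have sC : (size C <= 4)%N by apply: (allP F4).
apply: (@refuted_leq _ _ (size C + 4 * d)) => //; first by rewrite mulnS leq_add2r.
(* Vacuous here; it becomes the invariant of the next induction once the second [C] is generalized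
   to the suffix [C'] still to be treated. *)
have: forall l, l \in C -> l \notin C -> l \in a by move=> l ->.
move: {-2}C Call aB aA => C'; elim: C' a => [|[y b] C' IHC] a.
  move=> _ aB aA Ca; apply: (@refuted_leq _ _ 0) => //=; apply/hasP; exists C => //.
  by apply/allP => l lC; apply: Ca.
rewrite [all _ _]/= => /andP[]; rewrite {1}/literal_cut [(y, b).1]/= [(y, b).2]/=; case: ifP => yB.
  move=> /eqP gy C'all aB aA Ca; rewrite [size _]/= addSn.
  apply: (@refuted_leq _ _ (size C' + 4 * d)) => //; apply: IHC => // l lC lC'.
  case: (l =P (y, b)) => [->|/eqP ly]; first by rewrite -gy aB.
  by apply: Ca => //; rewrite inE negb_or ly.
move=> /andP[gy cuty] C'all aB aA Ca.
have Eb : b = ~~ g y by move: gy; case: (g y); case: (b).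
have rec a' : (y, b) \in a' -> {subset a <= a'} -> refuted F (size C' + 4 * d) a'.
  move=> ya' aa'; apply: IHC => //.
  - by move=> z zB; apply/aa'/aB.
  - by move=> z zB zA; apply/aa'/aA.
  move=> l lC lC'; case: (l =P (y, b)) => [->//|/eqP ly].
  by apply/aa'/Ca => //; rewrite inE negb_or ly.
have [yA|] := boolP ((y \notin U) || (y \in A)).
  rewrite [size _]/= addSn; apply: (@refuted_leq _ _ (size C' + 4 * d)) => //; apply: rec => //.
  by rewrite Eb; apply: aA => //; rewrite yB.
rewrite negb_or => /andP[yU yA]; move: cuty; rewrite (negbTE yU) (negbTE yA) /= => cuty.
have r1 : refuted F (size C' + 4 * d) ((y, ~~ g y) :: a).
  by apply: rec => [|l la]; rewrite inE ?Eb ?eqxx // la orbT.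
have r2 : refuted F (size C' + 4 * d) ((y, g y) :: a).
  apply: (@refuted_leq _ _ (4 * d)); rewrite ?leq_addl //; apply: IH cuty => z; rewrite !inE.
    by case: eqP => [->|_ /aB ->]; rewrite ?eqxx ?orbT.
  by rewrite negb_or => /andP[zy zB] /(aA _ zB) ->; rewrite orbT.
apply/hasP; exists y; first by rewrite mem_enum.
by move: r1 r2; case: (g y) => /= -> ->.
Qed.

Variables (R : realFieldType) (r : R).
Hypothesis r01 : 0 <= r <= 1.

Lemma expect_cut x d B : frozen F U g x -> x \in B -> B \subset U ->
  cut_prob d r <= expect r (enum (U :\ x)) (fun A => (cut d B A)%:R) set0.
Proof.
move=> fr; set vs := enum _.
have incn (p : {set 'I_n} -> bool) : (forall A A', A \subset A' -> p A -> p A') ->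
    increasing (fun A => (p A)%:R : R).
  by move=> pinc A A' AA'; rewrite ler_nat; have := pinc _ _ AA'; case: (p A) => // ->.
elim: d B => [|d IH] B xB BU; first by rewrite [cut_prob 0 r]/= -(expect_cst r vs 0 set0) expect_le.
pose g' := [ffun y => if y \in B then ~~ g y else g y].
have [C CF Cg'] : exists2 C : seq ('I_n * bool), C \in F & ~~ has (lit_true g') C.
  suff: ~~ satisfies g' F by move=> /allPn[C]; exists C.
  apply/negP => g'F; have g'U : g' \in extensions F U g.
    apply/extensionsP; split=> // y yU; rewrite ffunE ifN //.
    by apply: contra yU; apply: (subsetP BU).
  by have := frozenP _ _ _ _ fr _ g'U; rewrite ffunE xB; case: (g x).
pose c (l : 'I_n * bool) A := literal_cut (fun B' => cut d B' A) B A l.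
apply: (@le_trans _ _ (expect r vs (fun A => \prod_(l <- C) (c l A)%:R) set0)); last first.
  apply: expect_le => // A; have [cA|] := boolP (all (c^~ A) C).
    have -> : cut d.+1 B A by rewrite cutS; apply/hasP; exists C.
    by rewrite big_seq big1 // => l lC; rewrite (allP cA).
  move=> /allPn[l lC /negbTE lA]; rewrite (big_rem _ lC) /= lA mul0r //.
apply: le_trans (harris_prod r01 C vs set0 _ _); last 2 first.
- by move=> l A; rewrite ler0n.
- move=> l; apply: incn => A A' AA'; rewrite /c /literal_cut; case: ifP => // _ /andP[-> /=].
  by case/or3P => [->//|/(subsetP AA')->|/(cut_mono AA')->]; rewrite ?orbT.
set u := r + (1 - r) * cut_prob d r.
have [q0 q1] := andP (cut_prob01 d r01); have [r0 r1] := andP r01.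
have p0 : 0 <= (1 - r) * cut_prob d r by rewrite mulr_ge0 ?subr_ge0.
have p1 : (1 - r) * cut_prob d r <= (1 - r) * 1 by rewrite ler_wpM2l ?subr_ge0.
have u0 : 0 <= u by rewrite /u; lra.
have u1 : u <= 1 by rewrite /u; lra.
apply: (@le_trans _ _ (\prod_(l <- C) if l.1 \in B then 1 else u)).
  have -> : \prod_(l <- C) (if l.1 \in B then 1 else u) = u ^+ count (fun l => l.1 \notin B) C.
    elim: C {CF Cg'} => [|l C IHC]; first by rewrite big_nil.
    by rewrite big_cons IHC /=; case: ifP; rewrite ?mul1r // exprS.
  apply: ler_wiXn2l => //; have /hasP[l lC gl] := allP gF _ CF.
  have lB : l.1 \in B.
    move: gl (hasPn Cg' _ lC); rewrite /lit_true ffunE.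
    by case: ifP => // _ ->.
  have := allP F4 _ CF; rewrite -(count_predC (fun l => l.1 \in B)) /=.
  move=> sC; rewrite -ltnS; apply: leq_trans sC; rewrite -add1n leq_add2r -has_count.
  by apply/hasP; exists l.
rewrite big_seq [leRHS]big_seq; apply: ler_prod => l lC; apply/andP; split; first by case: ifP.
have := hasPn Cg' _ lC; rewrite /lit_true ffunE /c /literal_cut; case: ifP => lB gl.
  have -> : g l.1 == l.2 by move: gl; case: (g _); case: (l.2).
  by rewrite expect_cst.
rewrite gl /=; have [lU|lU] := boolP (l.1 \in U); last by rewrite expect_cst.
have lvs : l.1 \in vs.
  by rewrite mem_enum !inE lU andbT; apply: contraFN lB => /eqP ->.
have := IH (l.1 |: B); rewrite inE xB orbT subUset sub1set lU BU => /(_ isT isT).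
set p := expect _ _ _ _.
(* [cut d (l.1 |: B)] ignores whether [l.1] is in [A], so this event can be separated from the
   membership of [l.1] in [A], which contributes the summand [r] of [u]. *)
have -> : p = expect r (rem l.1 vs) (fun A => (cut d (l.1 |: B) A)%:R) set0.
  rewrite /p (expect_rem _ _ _ lvs) expect_shift.
  rewrite (expect_ext _ _ (f' := fun A => (cut d (l.1 |: B) A)%:R)); first by ring.
  by move=> A; rewrite cut_setU1 // !inE eqxx.
move=> hp; rewrite (expect_rem _ _ _ lvs) expect_shift; apply: lerD.
  rewrite -[leLHS]mulr1; apply: ler_wpM2l => //.
  rewrite -[leLHS](expect_cst r (rem l.1 vs) 1 set0); apply: expect_le => // A.
  by rewrite /= !inE eqxx.
apply: ler_wpM2l; first by rewrite subr_ge0.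
apply: (le_trans hp); apply: expect_le => // A; rewrite ler_nat /=.
by case: (l.1 \in A) => //; apply: leq_b1.
Qed.

Lemma expect_guessed d x : frozen F U g x -> x \in U ->
  expect r (enum (U :\ x)) (fun A => (guessed F (4 * d) (U :\: A) g x)%:R) set0
    <= 1 - cut_prob d r.
Proof.
move=> fr xU; have xsU : [set x] \subset U by rewrite sub1set.
apply: le_trans (lerB (lexx 1) (expect_cut d fr (set11 x) xsU)).
rewrite -[X in X - _](expect_cst r (enum (U :\ x)) 1 set0).
rewrite -expectB; apply: expect_le => // A; rewrite /guessed.
have [cA|_] := boolP (cut d [set x] A); last by rewrite subr0 lern1 leq_b1.
rewrite subrr (_ : refuted _ _ _ = true) //; apply: (cut_refuted x _ _ cA).
  by move=> y /set1P ->; rewrite inE eqxx.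
move=> y yx yUA; rewrite inE mem_false_lits eqxx andbT !inE; move: yUA.
by case: (y \in U); case: (y \in A); rewrite ?orbT.
Qed.

End Cut.

(** * The cost of a frozen variable *)

Bind Scope ring_scope with R.
Local Notation dlim := derivable_pt_lim.

Lemma dlim_eq (f : R -> R) x a b : dlim f x a -> a = b -> dlim f x b.
Proof. by move=> h <-. Qed.

Lemma dlim_ext (f g : R -> R) x a : f =1 g -> dlim f x a -> dlim g x a.
Proof. by move=> /functional_extensionality ->. Qed.

Lemma dlim_cst (c x : R) : dlim (fun=> c) x 0.
Proof. exact: derivable_pt_lim_const. Qed.

Lemma dlim_id (x : R) : dlim (fun t => t) x 1.
Proof. exact: derivable_pt_lim_id. Qed.

Lemma dlimD (f g : R -> R) x a b :
  dlim f x a -> dlim g x b -> dlim (fun t => f t + g t) x (a + b).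
Proof. exact: derivable_pt_lim_plus. Qed.

Lemma dlimN (f : R -> R) x a : dlim f x a -> dlim (fun t => - f t) x (- a).
Proof. exact: derivable_pt_lim_opp. Qed.

Lemma dlimM (f g : R -> R) x a b :
  dlim f x a -> dlim g x b -> dlim (fun t => f t * g t) x (a * g x + f x * b).
Proof. exact: derivable_pt_lim_mult. Qed.

Lemma dlimX (f : R -> R) x a k :
  dlim f x a -> dlim (fun t => f t ^+ k) x (a *+ k * f x ^+ k.-1).
Proof.
move=> fa; elim: k => [|k IH]; first by rewrite mulr0n mul0r; apply: dlim_cst.
apply: dlim_ext (fun t => esym (exprS (f t) k)) _.
apply: (dlim_eq (dlimM fa IH)); rewrite mulrS mulrDl; congr (_ + _).
case: k {IH} => [|k]; first by rewrite !mulr0n !mul0r mulr0.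
by rewrite /= exprS mulrCA.
Qed.

Lemma dlimV (f : R -> R) x a : f x != 0 -> dlim f x a ->
  dlim (fun t => (f t)^-1) x (- a / f x ^+ 2).
Proof.
move=> /eqP f0 fa; have := derivable_pt_lim_div _ _ _ _ _ (dlim_cst 1 x) fa f0.
rewrite /div_fct => h; apply: dlim_ext (dlim_eq h _) => [t|]; first by rewrite RdivE div1r.
by rewrite RdivE RminusE /Rsqr !RmultE expr2 mulr1 mul0r sub0r.
Qed.

Lemma dlim_sum (I : Type) (s : seq I) (P : pred I) (f : I -> R -> R) x a :
  (forall i, P i -> dlim (f i) x (a i)) ->
  dlim (fun t => \sum_(i <- s | P i) f i t) x (\sum_(i <- s | P i) a i).
Proof.
move=> fa; elim: s => [|i s IH].
  rewrite big_nil; apply: dlim_ext (dlim_cst 0 x) => t; by rewrite big_nil.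
rewrite big_cons; case: ifP => Pi; last first.
  by apply: dlim_ext IH => t; rewrite big_cons Pi.
by apply: dlim_ext (dlimD (fa i Pi) IH) => t; rewrite big_cons Pi.
Qed.

Lemma nonincreasing_of_dlim (f f' : R -> R) (a b : R) : a <= b ->
  (forall c, a <= c <= b -> dlim f c (f' c)) ->
  (forall c, a <= c <= b -> f' c <= 0) -> f b <= f a.
Proof.
rewrite le_eqVlt => /orP[/eqP->//|ab] fd f'0.
have [|c [e [/RltP ac /RltP cb]]] := @MVT_cor2 f f' a b (elimT RltP ab).
  by move=> c [/RleP ac /RleP cb]; apply: fd; rewrite ac cb.
have h : f' c <= 0 by apply: f'0; rewrite !ltW.
rewrite -subr_le0; change (Rminus (f b) (f a) <= 0); rewrite e RmultE RminusE.
by rewrite mulr_le0_ge0 // subr_ge0 ltW.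
Qed.

Section FrozenCost.
Variables (n : nat) (F : cnf n) (d : nat) (g : {ffun 'I_n -> bool}) (x : 'I_n).
Implicit Types (U : {set 'I_n}).

(** Each [y] contributes the expectation with [y] minus the one without; times [1 - r] this is the
    expectation with [y] minus the unconditional one. The multiplied form also holds at [r = 1]. *)
Lemma dlim_expect (T : finType) (f : {set T} -> R) vs A r : uniq vs ->
  exists2 D, dlim (fun t => expect t vs f A) r D &
    (1 - r) * D = expect_one r vs f A - (size vs)%:R * expect r vs f A.
Proof.
elim: vs A => [|y vs IH] A.
  by move=> _; exists 0; [apply: dlim_cst|rewrite /expect_one big_nil /=; ring].
move=> yvs; have /andP[_ uvs] : uniq (y :: vs) := yvs.
have [D1 h1 e1] := IH (y |: A) uvs; have [D0 h0 e0] := IH A uvs.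
exists ((1 * expect r vs f (y |: A) + r * D1) +
        ((0 - 1) * expect r vs f A + (1 - r) * D0)).
  apply: dlimD; apply: dlimM => //; first exact: dlim_id.
  by apply: dlimD; [apply: dlim_cst|apply: dlimN; apply: dlim_id].
rewrite (expect_one_cons _ _ _ yvs) /=.
have e1' := congr1 (fun t => r * t) e1; have e0' := congr1 (fun t => (1 - r) * t) e0.
rewrite -natr1; move: e1' e0' => /=; lra.
Qed.

(* The probability that [x] is guessed when it arrives at time [r] and every
   other variable at an independent uniform time. *)
Definition guess_prob U (r : R) : R :=
  expect r (enum (U :\ x)) (fun A => (guessed F d (U :\: A) g x)%:R) set0.

(* [frozen_cost] is the integral of [guess_prob] over the arrival time of [x]; this is
   the antiderivative, from the identity
   [(1 - r) P_U' = \sum_y P_(U :\ y) - #|U :\ x| * P_U]. *)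
Fixpoint guess_int m U (r : R) : R :=
  if m is m'.+1 then
    m'.+1%:R^-1 * (\sum_(y in U :\ x) guess_int m' (U :\ y) r - (1 - r) * guess_prob U r)
  else 0.

Lemma guess_int_dlim U r : x \in U -> dlim (guess_int #|U| U) r (guess_prob U r).
Proof.
move: {2 3}#|U| (erefl #|U|) => m; elim: m U => [|m IH] U Um xU.
  by move: xU; rewrite (cards0_eq Um) inE.
have [D hD eD] := @dlim_expect _ (fun A => (guessed F d (U :\: A) g x)%:R) _ set0 r
  (enum_uniq (U :\ x)).
have Um' : #|U :\ x| = m by move: Um; rewrite (cardsD1 x) xU => -[].
rewrite -cardE Um' in eD.
have eone : expect_one r (enum (U :\ x)) (fun A => (guessed F d (U :\: A) g x)%:R) set0 =
    \sum_(y in U :\ x) guess_prob (U :\ y) r.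
  rewrite /expect_one big_enum; apply: eq_bigr => y yUx.
  rewrite expect_shift /guess_prob.
  rewrite (@expect_ext _ _ _ _ _ (fun A => (guessed F d ((U :\ y) :\: A) g x)%:R)); last first.
    by move=> A; rewrite setDDl.
  apply: expect_perm; apply: uniq_perm; rewrite ?rem_uniq ?enum_uniq // => z.
  by rewrite mem_rem_uniq ?enum_uniq // inE !mem_enum !inE andbCA.
apply: dlim_eq.
  apply: dlimM; first exact: dlim_cst.
  apply: dlimD; last first.
    apply: dlimN; apply: dlimM; last exact: hD.
    by apply: dlimD; [apply: dlim_cst|apply: dlimN; apply: dlim_id].
  apply: dlim_sum => y; rewrite !inE => /andP[yx yU]; apply: IH.
    by move: Um; rewrite (cardsD1 y) yU => -[].
  by rewrite !inE eq_sym yx.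
rewrite -eone; have m0 : m.+1%:R != 0 :> R by rewrite pnatr_eq0.
apply: (mulfI m0); rewrite mul0r add0r mulrA divff // mul1r -natr1.
move: eD; rewrite -/(guess_prob U r); rewrite ?RminusE ?RplusE ?RoppE ?R1E; lra.
Qed.

(** The term [(1 - r) * guess_prob U r] vanishes at [1], and at [0] nothing precedes [x], so it is
    the indicator of [guessed]. The difference thus obeys the recursion of [frozen_cost]. *)
Lemma guess_int_frozen_cost U : x \in U ->
  guess_int #|U| U 1 - guess_int #|U| U 0 = frozen_cost F d R U g x.
Proof.
rewrite /frozen_cost; have [m Um] : exists m, #|U| = m by exists #|U|.
rewrite Um; elim: m U Um => [|m IH] U Um xU.
  by rewrite subrr.
rewrite /= -mulrBr; congr (_ * _).
have -> : guess_prob U 0 = (guessed F d U g x)%:R by rewrite /guess_prob expect0 setD0.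
suff <- : \sum_(y in U :\ x) (guess_int m (U :\ y) 1 - guess_int m (U :\ y) 0) =
  \sum_(y in U :\ x) frozen_cost_rec F d R m (U :\ y) g x by rewrite sumrB; ring.
apply: eq_bigr => y; rewrite !inE => /andP[yx yU]; apply: IH.
  by move: Um; rewrite (cardsD1 y) yU => -[].
by rewrite !inE eq_sym yx.
Qed.

End FrozenCost.

(* [cut_prob] converges to [u ^ 3], where [u] is the least root of
   [u = r + (1 - r) u ^ 3]; [r = rho u] on the branch [u < 1]. *)
Definition rho (u : R) : R := u * (1 + u) / (1 + u + u ^+ 2).

Lemma rho_den (u : R) : 0 <= u -> 0 < 1 + u + u ^+ 2.
Proof. by move=> u0; rewrite ltr_pwDl ?exprn_ge0 // ltr_pwDl. Qed.

(** One step of [v := r + (1 - r) * v ^+ 3] adds [(1 - v) * (r * (1 + v + v ^+ 2) - v * (1 + v))].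
    While [v <= u] both factors are at least [de], because [rho] increases and [r] exceeds [rho u]
    by [de]; once above [u] the sequence stays there. So [K] steps suffice, and a final cube makes
    it [K.+1]. *)
Lemma rho_cut (K : nat) (de u r : R) : 0 < de -> 1 <= K%:R * de ^+ 2 ->
  0 <= u <= 1 - de -> rho u + de <= r <= 1 -> u ^+ 3 <= cut_prob K.+1 r.
Proof.
move=> de0 Kde /andP[u0 u1] /andP[rr r1]; have qu := rho_den u0.
have r0 : 0 <= r.
  apply: le_trans rr; rewrite addr_ge0 ?(ltW de0) //.
  by rewrite /rho divr_ge0 ?(ltW qu) // mulr_ge0 // addr_ge0.
have r01 : 0 <= r <= 1 by rewrite r0.
have rq (v : R) : 0 <= v <= u -> de <= r * (1 + v + v ^+ 2) - v * (1 + v).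
  move=> /andP[v0 vu]; have qv := rho_den v0.
  have rv : rho v <= rho u.
    rewrite /rho ler_pdivrMr // mulrAC ler_pdivlMr //.
    have : 0 <= (u - v) * (1 + u + v) by rewrite mulr_ge0 ?subr_ge0 // !addr_ge0.
    lra.
  have e : v * (1 + v) = rho v * (1 + v + v ^+ 2) by rewrite /rho mulfVK ?lt0r_neq0.
  have h1 : de * 1 <= (r - rho v) * (1 + v + v ^+ 2).
    apply: ler_pM => //; first exact: ltW; first by lra.
    by rewrite -addrA lerDl addr_ge0 ?exprn_ge0.
  rewrite e; lra.
pose V k := r + (1 - r) * cut_prob k r.
have VS k : V k.+1 = r + (1 - r) * V k ^+ 3 by [].
suff H k : u <= V k \/ k%:R * de ^+ 2 <= V k.
  rewrite [leRHS]/= -/(V K); apply: lerXn2r; rewrite ?nnegrE //.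
    by rewrite addr_ge0 // mulr_ge0 ?subr_ge0 //; have /andP[] := cut_prob01 K r01.
  case: (H K) => // h; apply: le_trans (le_trans Kde h); apply: (le_trans u1).
  by rewrite lerBlDr lerDl ltW.
have V0 j : 0 <= V j.
  by rewrite addr_ge0 // mulr_ge0 ?subr_ge0 //; have /andP[] := cut_prob01 j r01.
elim: k => [|k IH]; first by right; rewrite mul0r.
have stable : u <= V k -> u <= V k.+1.
  move=> uV; rewrite VS.
  have h : (1 - r) * u ^+ 3 <= (1 - r) * V k ^+ 3.
    by rewrite ler_wpM2l ?subr_ge0 // lerXn2r ?nnegrE.
  have h2 : 0 <= (1 - u) * (r * (1 + u + u ^+ 2) - u * (1 + u)).
    rewrite mulr_ge0 //; first by lra.
    by apply: (le_trans (ltW de0)); apply: rq; rewrite u0 lexx.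
  lra.
case: (leP u (V k)) => [/stable|Vu]; first by left.
right; case: IH => [uV|IH]; first by lra.
rewrite VS -natr1.
have h : de * de <= (1 - V k) * (r * (1 + V k + V k ^+ 2) - V k * (1 + V k)).
  apply: ler_pM; rewrite ?(ltW de0) //; first by lra.
  by apply: rq; rewrite V0 ltW.
lra.
Qed.

(* [1 / (1 + u + u^2) <= (1 + u^6 (1 - u)^6 / 27) / (1 + u + u^2)], and the right-hand
   side is a polynomial because [u (1 - u)] is a sixth root of [-27] when [u] is a
   primitive cube root of unity.  [rho_int] integrates [3 u^2 rho u] with this bound. *)
Definition rho_int (u : R) : R :=
  3 / 4 * u ^+ 4 - 1 / 2 * u ^+ 6 + 3 / 7 * u ^+ 7 - 1 / 3 * u ^+ 9 + 14 / 45 * u ^+ 10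
  - 2 / 33 * u ^+ 11 - 13 / 108 * u ^+ 12 + 14 / 117 * u ^+ 13 - 1 / 21 * u ^+ 14
  + 1 / 135 * u ^+ 15.

Definition rho_int' (u : R) : R :=
  (27 * u ^+ 3 - 27 * u ^+ 5 + 27 * u ^+ 6 - 27 * u ^+ 8 + 28 * u ^+ 9 - 6 * u ^+ 10
   - 13 * u ^+ 11 + 14 * u ^+ 12 - 6 * u ^+ 13 + u ^+ 14) / 9.

Ltac dlim_auto := repeat first
  [ apply: dlimD | apply: dlimN | apply: dlimM | apply: dlimX
  | apply: dlim_cst | apply: dlim_id ].

Lemma dlim_rho_int u : dlim rho_int u (rho_int' u).
Proof.
apply: dlim_eq; first by rewrite /rho_int; dlim_auto.
by rewrite /rho_int' /=; field.
Qed.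

Lemma dlim_rho u : 0 <= u -> dlim rho u ((1 + 2 * u) / (1 + u + u ^+ 2) ^+ 2).
Proof.
move=> u0; have q0 := lt0r_neq0 (rho_den u0).
apply: dlim_eq.
  rewrite /rho; apply: dlimM; first by dlim_auto.
  by apply: (@dlimV (fun t => 1 + t + t ^+ 2) _ _ q0); dlim_auto.
by rewrite /=; field.
Qed.

Lemma rho_int'_ge u : 0 <= u -> 3 * u ^+ 2 * rho u <= rho_int' u.
Proof.
move=> u0; have q0 := rho_den u0.
have -> : rho_int' u = 3 * u ^+ 2 * rho u
    + u ^+ 9 * (1 - u) ^+ 6 * (1 + u) / (9 * (1 + u + u ^+ 2)).
  by rewrite /rho_int' /rho; field; rewrite lt0r_neq0.
rewrite lerDl divr_ge0 //; last by rewrite mulr_ge0 // ltW.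
by rewrite mulr_ge0 ?addr_ge0 // mulr_ge0 ?(exprn_ge0 9) ?exprn_even_ge0.
Qed.

(** The two sides differ by about 2.4 millionths; this gap determines the search depth in
    [frozen_cost_bound]. *)
Lemma rho_int1 : rho_int 1 < 420 / 757.
Proof. rewrite /rho_int !expr1n; lra. Qed.

(** * Averaging over the arrival time *)

Section Average.
Variables (Psi psi : R -> R) (d : nat) (de : R).
Hypothesis Psi_lim : forall r, dlim Psi r (psi r).
Hypothesis psi_le1 : forall r, 0 <= r <= 1 -> psi r <= 1.
Hypothesis psi_cut : forall u r, 0 <= u <= 1 - de -> rho u + de <= r <= 1 ->
  psi r <= 1 - u ^+ 3.
Hypothesis de_gt0 : 0 < de.
Hypothesis de_lt : 3 * de <= 1.

Lemma rho01 u : 0 <= u <= 1 -> 0 <= rho u <= 2 / 3.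
Proof.
move=> /andP[u0 u1]; have q0 := rho_den u0; apply/andP; split.
  by rewrite /rho divr_ge0 ?(ltW q0) // mulr_ge0 // addr_ge0.
rewrite /rho ler_pdivrMr //.
have : u ^+ 2 <= 1 by rewrite exprn_ile1.
lra.
Qed.

Lemma increment_le (a b c : R) : a <= b -> (forall r, a <= r <= b -> psi r <= c) ->
  Psi b - Psi a <= c * (b - a).
Proof.
move=> ab hc.
have : Psi b - c * b <= Psi a - c * a.
  apply: (@nonincreasing_of_dlim (fun r => Psi r - c * r) (fun r => psi r - c)) => // r hr.
    apply: dlim_eq; first by apply: dlimD; [exact: Psi_lim|dlim_auto].
    by rewrite /=; ring.
  by rewrite subr_le0 hc.
lra.
Qed.

(* Substituting [r = rho u + de] in the integral of [psi]. *)
Lemma average_le : Psi 1 - Psi 0 <= rho_int 1 + 7 * de.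
Proof.
set v := 1 - de; have v01 : 0 <= v <= 1.
  by apply/andP; split; rewrite /v; move: de_lt de_gt0; lra.
have [v0 v1] := andP v01; have [rv0 rv1] := andP (rho01 v01).
(* Integration by parts: differentiating [(1 - u ^+ 3) * rho u] leaves [3 * u ^+ 2 * rho u], which
   [rho_int'] dominates. *)
have main : Psi (rho v + de) - (1 - v ^+ 3) * rho v - rho_int v <=
            Psi (rho 0 + de) - (1 - 0 ^+ 3) * rho 0 - rho_int 0.
  pose rho' u : R := (1 + 2 * u) / (1 + u + u ^+ 2) ^+ 2.
  apply: (@nonincreasing_of_dlim
    (fun u => Psi (rho u + de) - (1 - u ^+ 3) * rho u - rho_int u)
    (fun u => psi (rho u + de) * rho' u - (1 - u ^+ 3) * rho' u
              + 3 * u ^+ 2 * rho u - rho_int' u)) => // u /andP[u0 uv].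
    have hrho := dlim_rho u0.
    have hcomp : dlim (fun t => Psi (rho t + de)) u (psi (rho u + de) * (rho' u + 0)).
      apply: (derivable_pt_lim_comp (fun t => rho t + de) Psi); last exact: Psi_lim.
      by apply: dlimD; [exact: hrho|apply: dlim_cst].
    apply: dlim_eq.
      apply: dlimD; last by apply: dlimN; apply: dlim_rho_int.
      apply: dlimD; first exact: hcomp.
      by apply: dlimN; apply: dlimM; [dlim_auto|exact: hrho].
    by rewrite /rho' /=; ring.
  have u01 : 0 <= u <= 1 by rewrite u0 (le_trans uv).
  have [ru0 ru1] := andP (rho01 u01).
  have h1 : psi (rho u + de) <= 1 - u ^+ 3.
    by apply: (psi_cut (u := u)); rewrite ?u0 ?uv // lexx /=; move: de_lt; lra.
  have h2 : psi (rho u + de) * rho' u <= (1 - u ^+ 3) * rho' u.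
    apply: ler_wpM2r => //; rewrite /rho' divr_ge0 ?exprn_ge0 ?(ltW (rho_den u0)) //.
    by rewrite addr_ge0 // mulr_ge0.
  have := rho_int'_ge u0; lra.
have rho0 : rho 0 = 0 by rewrite /rho !mul0r.
have int0 : rho_int 0 = 0 by rewrite /rho_int !expr0n /= !mulr0; ring.
rewrite rho0 int0 mulr0 add0r !subr0 in main.
have intv : rho_int v <= rho_int 1.
  rewrite -[leLHS]opprK -[leRHS]opprK lerN2.
  apply: (@nonincreasing_of_dlim (fun u => - rho_int u) (fun u => - rho_int' u)) => //
    u /andP[u0 _].
    by apply: dlimN; apply: dlim_rho_int.
  have u0' := le_trans v0 u0.
  rewrite oppr_le0; apply: le_trans (rho_int'_ge u0').
  rewrite /rho !mulr_ge0 ?exprn_ge0 ?addr_ge0 // invr_ge0 ltW ?rho_den //.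
have v3 : 1 - v ^+ 3 <= 3 * de.
  have : 0 <= de ^+ 2 * (3 - de) by rewrite mulr_ge0 ?exprn_ge0 ?ltW //; move: de_lt de_gt0; lra.
  by rewrite /v; lra.
have v3' : (1 - v ^+ 3) * rho v <= 3 * de * 1.
  by apply: ler_pM; rewrite ?subr_ge0 ?exprn_ile1 //; lra.
(* The errors are [de] on [[0, de]], [3 * de] on [[rho v + de, 1]] and [3 * de] from the boundary
   term [v3'], together [7 * de]. *)
have i1 : Psi de - Psi 0 <= 1 * (de - 0).
  apply: increment_le; first exact: ltW.
  by move=> r /andP[r0 r1]; apply: psi_le1; rewrite r0 /=; move: de_lt de_gt0; lra.
have i2 : Psi 1 - Psi (rho v + de) <= (1 - v ^+ 3) * (1 - (rho v + de)).
  apply: increment_le; first by move: de_lt; lra.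
  by move=> r hr; apply: (psi_cut (u := v)); rewrite ?v0 ?lexx.
have i3 : (1 - v ^+ 3) * (1 - (rho v + de)) <= 3 * de * 1.
  by apply: ler_pM; rewrite ?subr_ge0 ?exprn_ile1 //; move: de_lt de_gt0; lra.
lra.
Qed.

End Average.

(* [4 * d] is the depth of the search for refutations, cf. [cut_refuted]. *)
Lemma frozen_cost_bound : exists d, forall n (F : cnf n) (U : {set 'I_n}) g x,
  all (fun C : seq ('I_n * bool) => size C <= 4)%N F -> satisfies g F -> x \in U ->
  frozen F U g x -> frozen_cost F (4 * d) R U g x <= 420 / 757.
Proof.
(* The [7] is the error factor of [average_le]; [1 / 3] keeps [rho u + de <= 1], as
   [rho u <= 2 / 3]. *)
pose de := Num.min ((420 / 757 - rho_int 1) / 7) (1 / 3).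
have de0 : 0 < de by rewrite lt_min divr_gt0 ?subr_gt0 ?rho_int1 //=; lra.
have de1 : 7 * de <= 420 / 757 - rho_int 1.
  have : de <= (420 / 757 - rho_int 1) / 7 by rewrite ge_min lexx.
  lra.
have de2 : 3 * de <= 1.
  have : de <= 1 / 3 by rewrite ge_min lexx orbT.
  lra.
have [K Kde] : exists K : nat, 1 <= K%:R * de ^+ 2.
  have [K hK] := INR_unbounded (de ^+ 2)^-1.
  exists K; rewrite -ler_pdivrMr ?exprn_gt0 // div1r ltW //.
  by move/RltP: hK; rewrite INRE.
exists K.+1 => n F U g x F4 gF xU fr.
rewrite -guess_int_frozen_cost //; apply: (@le_trans _ _ (rho_int 1 + 7 * de)); last by lra.
apply: (@average_le _ (guess_prob F (4 * K.+1) g x U)) => //.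
- by move=> r; apply: guess_int_dlim.
- move=> r r01; rewrite -[leRHS](expect_cst r (enum (U :\ x)) 1 set0).
  by apply: expect_le => // A; rewrite lern1 leq_b1.
move=> u r u01 hr; have r01 : 0 <= r <= 1.
  have /andP[h ->] := hr; rewrite andbT; apply: le_trans h.
  have /andP[h _] : 0 <= rho u <= 2 / 3.
    by apply: rho01; move: u01 de0 => /andP[-> /=] h1 h2; lra.
  by rewrite addr_ge0 // ltW.
apply: le_trans (expect_guessed gF F4 r01 K.+1 fr xU) _; rewrite lerD2l lerN2.
exact: rho_cut Kde u01 hr.
Qed.

Local Close Scope ring_scope.

(** * The success probability of a trial *)

Section Coins.
Local Open Scope ring_scope.
Variable R : realFieldType.

Fixpoint prob (h : nat) (f : bitseq -> R) : R :=
  if h is h'.+1 then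
    (prob h' (fun w => f (true :: w)) + prob h' (fun w => f (false :: w))) / 2
  else f [::].

Lemma prob_ext h (f f' : bitseq -> R) :
  (forall w, size w = h -> f w = f' w) -> prob h f = prob h f'.
Proof.
elim: h f f' => [|h IH] f f' ff' /=; first exact: ff'.
by congr ((_ + _) / 2); apply: IH => w sw; apply: ff'; rewrite /= sw.
Qed.

Lemma prob_cat h k f : prob (h + k) f = prob h (fun w => prob k (fun v => f (w ++ v))).
Proof. by elim: h f => //= h IH f; rewrite !IH. Qed.

Lemma prob_cst h c : prob h (fun=> c) = c.
Proof. by elim: h => //= h ->; lra. Qed.

Lemma prob_ge0 h f : (forall w, 0 <= f w) -> 0 <= prob h f.
Proof. by elim: h f => //= h IH f f0; rewrite divr_ge0 // addr_ge0 ?IH. Qed.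

Definition bits_num (w : bitseq) : nat := foldl (fun u (b : bool) => u.*2 + b)%N 0%N w.

Lemma bits_num_foldl u w :
  foldl (fun u (b : bool) => u.*2 + b)%N u w = (u * 2 ^ size w + bits_num w)%N.
Proof.
rewrite /bits_num; elim: w u => [|b w IH] u /=; first by rewrite muln1 addn0.
by rewrite IH [in RHS]IH expnS; lia.
Qed.

Lemma prob_bits_num h f :
  prob h (fun w => f (bits_num w)) = (\sum_(0 <= j < 2 ^ h) f j) / 2 ^+ h.
Proof.
elim: h f => [|h IH] f /=; first by rewrite expn0 big_nat1 divr1.
have num_cons b w : size w = h -> bits_num (b :: w) = (b * 2 ^ h + bits_num w)%N.
  by move=> sw; rewrite {1}/bits_num /= bits_num_foldl sw; case: b.
rewrite (prob_ext (f' := fun w => f (2 ^ h + bits_num w)%N)); last first.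
  by move=> w sw; rewrite num_cons // mul1n.
rewrite [X in (_ + X) / 2](prob_ext (f' := fun w => f (bits_num w))); last first.
  by move=> w sw; rewrite num_cons.
rewrite (IH (fun j => f (2 ^ h + j)%N)) IH.
rewrite (@big_cat_nat _ _ _ (2 ^ h)%N 0%N (2 ^ h.+1)) ?leq_exp2l //=.
have -> : \sum_(2 ^ h <= j < 2 ^ h.+1) f j = \sum_(0 <= j < 2 ^ h) f (2 ^ h + j)%N.
  rewrite -[X in \sum_(X <= _ < _) _ = _]add0n big_addn expnS mul2n -addnn addnK.
  by apply: eq_bigr => j _; rewrite addnC.
by rewrite exprS; field; rewrite expf_neq0 // pnatr_eq0.
Qed.

Lemma sum_modn m q f :
  \sum_(0 <= j < q * m) f (j %% m)%N = q%:R * \sum_(0 <= i < m) f i :> R.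
Proof.
elim: q => [|q IH]; first by rewrite big_geq // mul0r.
rewrite mulSn addnC (@big_cat_nat _ _ _ (q * m)%N) ?leq_addr //= IH -natr1 mulrDl mul1r.
congr (_ + _); rewrite -[X in \sum_(X <= _ < _) _ = _]add0n big_addn addKn.
rewrite !big_nat; apply: eq_bigr => i /andP[_ im].
by rewrite addnC modnMDl modn_small.
Qed.

(** Each residue is hit at least [2 ^ h %/ m] times, hence at least [2 ^ h / m - 1] times, and
    [1 <= de * 2 ^ h / m]. *)
Lemma prob_bits_num_modn h m f de : (0 < m)%N -> (forall i, 0 <= f i) ->
  m%:R <= de * 2 ^+ h ->
  (1 - de) / m%:R * \sum_(0 <= i < m) f i <= prob h (fun w => f (bits_num w %% m)%N).
Proof.
move=> m0 f0 mde; rewrite (prob_bits_num h (fun j => f (j %% m)%N)).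
set q := (2 ^ h %/ m)%N.
have qm : (q * m <= 2 ^ h)%N by apply: leq_trunc_div.
have S0 : 0 <= \sum_(0 <= i < m) f i by apply: sumr_ge0.
rewrite (@big_cat_nat _ _ _ (q * m)%N 0%N (2 ^ h)%N) //= sum_modn.
have h0 : 0 < 2 ^+ h :> R by rewrite exprn_gt0.
have mR : 0 < m%:R :> R by rewrite ltr0n.
rewrite ler_pdivlMr // mulrAC -[leLHS]addr0; apply: lerD; last by apply: sumr_ge0.
apply: ler_wpM2r => //; rewrite mulrAC ler_pdivrMr //.
have : (2 ^ h)%:R <= q%:R * m%:R + m%:R :> R.
  rewrite -natrM -natrD ler_nat /q -mulSnr ltnW // ltn_ceil //.
rewrite natrX; lra.
Qed.

End Coins.

Section Trial.
Variables (n : nat) (F : cnf n) (d h : nat).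
Implicit Types (rem : seq 'I_n) (a : seq ('I_n * bool)) (x : 'I_n).

(** The result joins the false literals, so a refutation of [(x, true)] yields [(x, false)]. *)
Definition next_false_lit a x (b : bool) : 'I_n * bool :=
  if refuted F d ((x, true) :: a) then (x, false)
  else if refuted F d ((x, false) :: a) then (x, true)
  else (x, b).

Definition position m (w : bitseq) : nat :=
  foldl (fun u (b : bool) => (u.*2 + b) %% m) 0 w.

Lemma position_modn m w : position m w = bits_num w %% m.
Proof.
rewrite /position /bits_num -{1}(mod0n m).
elim: w 0 => [|b w IH] u //=; rewrite -IH; congr foldl.
by rewrite -!muln2 -modnDml modnMml modnDml.
Qed.

(* A step takes [h] bits from the tape for the choice of a variable and one for a guess.
   The remaining variables are kept in no particular order. *)
Fixpoint ppsz k rem a (tape : bitseq) : seq ('I_n * bool) :=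
  if k is k'.+1 then
    let u := position (size rem) (take h tape) in
    if drop u rem is x :: rest then
      ppsz k' (catrev (take u rem) rest)
        (next_false_lit a x (head false (drop h tape)) :: a) (drop h.+1 tape)
    else a
  else a.

Definition trial (tape : bitseq) : bool := ~~ refuted F 0 (ppsz n (enum 'I_n) [::] tape).

Local Open Scope ring_scope.
Variables (R : realFieldType) (S : R) (e : R -> R) (l de : R).
Hypothesis S_ge : 1 / 2 <= S.
Hypothesis frozen_cost_le : forall (U : {set 'I_n}) g x, satisfies g F -> x \in U ->
  frozen F U g x -> frozen_cost F d R U g x <= S.
Hypothesis e_half : forall s : R, e (s + 1) = e s / 2.
Hypothesis e_convex : forall s t : R, e t * (1 - l * (s - t)) <= e s.
Hypothesis e_ge0 : forall s : R, 0 <= e s.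
Hypothesis e0 : e 0 <= 1.
Hypothesis l_ge0 : 0 <= l.
Hypothesis l_le1 : l <= 1.
Hypothesis de_le1 : de <= 1.
Hypothesis n_le : n%:R <= de * 2 ^+ h.

Definition success k rem a : R :=
  prob (k * h.+1) (fun t => (~~ refuted F 0 (ppsz k rem a t))%:R).

Lemma success_ge0 k rem a : 0 <= success k rem a.
Proof. by apply: prob_ge0 => w. Qed.

Definition success_at k rem a u : R :=
  if drop u rem is x :: rest then
    (success k (catrev (take u rem) rest) (next_false_lit a x true :: a) +
     success k (catrev (take u rem) rest) (next_false_lit a x false :: a)) / 2
  else (~~ refuted F 0 a)%:R.

Lemma successS k rem a :
  success k.+1 rem a = prob h (fun w => success_at k rem a (bits_num w %% size rem)%N).
Proof.
rewrite /success mulSn addSnnS prob_cat; apply: prob_ext => w sw.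
have ppszS b t : ppsz k.+1 rem a (w ++ b :: t) =
    if drop (position (size rem) w) rem is x :: rest then
      ppsz k (catrev (take (position (size rem) w) rem) rest)
        (next_false_lit a x b :: a) t
    else a.
  rewrite /= take_size_cat // drop_size_cat // -cat_rcons drop_size_cat //.
  by rewrite size_rcons sw.
pose v b := prob (k * h.+1) (fun t => (~~ refuted F 0 (ppsz k.+1 rem a (w ++ b :: t)))%:R) : R.
have vE b : v b = prob (k * h.+1) (fun t => (~~ refuted F 0
    (if drop (position (size rem) w) rem is x :: rest then
      ppsz k (catrev (take (position (size rem) w) rem) rest)
        (next_false_lit a x b :: a) t
    else a))%:R) by apply: prob_ext => t _; rewrite ppszS.
change ((v true + v false) / 2 = success_at k rem a (bits_num w %% size rem)%N).
rewrite !vE /success_at -position_modn; case: drop => [|x rest] //.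
by rewrite !prob_cst; lra.
Qed.

(** If [x] is not frozen, both values are tossed with probability one half and both lead to
    solutions. If it is frozen and guessed, only the half with the right value is counted. If the
    search finds the value, nothing is lost. The right value is never refuted. *)
Lemma success_at_ge k rem a u x g (U : {set 'I_n}) b : drop u rem = x :: b ->
  satisfies g F -> a =i false_lits U g ->
  (forall g', g' \in extensions F U g ->
     (1 - de) ^+ k * e (avg_cost F d S (U :\ x) g') <=
     success k (catrev (take u rem) b) ((x, ~~ g' x) :: a)) ->
  (1 - de) ^+ k * step_bound F d S e U g x <= success_at k rem a u.
Proof.
move=> dr gF aU IH; rewrite /success_at dr /step_bound.
set T := catrev _ _ in IH *.
have refE l' : refuted F d (l' :: a) = refuted F d (l' :: false_lits U g).
  by apply/idP/idP; apply: refuted_mono => z; rewrite !inE aU.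
have IHg := IH g (extensions_refl U gF).
have s0 y := success_ge0 k T (next_false_lit a x y :: a).
have [fr|lq] := boolP (frozen F U g x); last first.
  have [fU fx] := flippedP lq.
  have IHf := IH _ fU; rewrite fx negbK in IHf.
  have nr y : next_false_lit a x y = (x, y).
    rewrite /next_false_lit !refE.
    have r1 := liquid_guessed d lq.
    have r2 := not_refuted_true d U x gF.
    by move: r1 r2; rewrite /guessed; case: (g x) => /= /negbTE-> /negbTE->.
  by move: IHg IHf; rewrite !nr; case: (g x) => /=; lra.
have [gd|] := boolP (guessed F d U g x).
  have nr y : next_false_lit a x y = (x, y).
    rewrite /next_false_lit !refE.
    have r2 := not_refuted_true d U x gF.
    by move: gd r2; rewrite /guessed; case: (g x) => /= /negbTE-> /negbTE->.
  have := s0 true; have := s0 false; move: IHg; rewrite !nr; case: (g x) => /=; lra.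
rewrite /guessed negbK => rf.
have nr y : next_false_lit a x y = (x, ~~ g x).
  rewrite /next_false_lit !refE.
  have r2 := not_refuted_true d U x gF.
  by move: rf r2; case: (g x) => /= -> // /negbTE->.
by rewrite !nr; lra.
Qed.

(** [success_at_ge] treats the chosen variable and [step_bound_sum] the average over the choice; its
    bias costs one factor [1 - de] per step. *)
Lemma success_ge k rem a g (U : {set 'I_n}) : uniq rem -> size rem = k -> rem =i U ->
  satisfies g F -> a =i false_lits U g ->
  (1 - de) ^+ k * e (avg_cost F d S U g) <= success k rem a.
Proof.
elim: k rem a g U => [|k IH] rem a g U uniq_rem sz remU gF aU.
  rewrite expr0 mul1r; have -> : success 0 rem a = (~~ refuted F 0 a)%:R by [].
  have -> : refuted F 0 a = false.
    apply/negbTE/(refuted_sound 0 gF) => z; rewrite aU; exact: false_lits_false.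
  have U0 : U =i set0 by move=> x; rewrite -remU (size0nil sz) inE.
  rewrite (_ : avg_cost _ _ _ _ _ = 0) //; apply: big1 => x _; apply: big1 => f _.
  by rewrite /var_cost U0 inE mulr0.
have [x0 _] : exists x0 : 'I_n, True by case: rem sz {uniq_rem remU} => // x *; exists x.
have cU : #|U| = k.+1 by rewrite -sz -(card_uniqP uniq_rem); apply: eq_card => x; rewrite remU.
have m0 : 0 < k.+1%:R :> R by rewrite ltr0n.
rewrite successS sz; apply: le_trans (prob_bits_num_modn _ _ _); last 3 first.
- by [].
- move=> u; rewrite /success_at; case: drop => // x rest.
  by rewrite divr_ge0 // addr_ge0 ?success_ge0.
- by apply: le_trans n_le; rewrite ler_nat -cU -[leqRHS](card_ord n) max_card.
have de0 : 0 <= 1 - de by rewrite subr_ge0.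
suff main : k.+1%:R * ((1 - de) ^+ k * e (avg_cost F d S U g)) <=
    \sum_(0 <= i < k.+1) success_at k rem a i.
  have -> : (1 - de) ^+ k.+1 * e (avg_cost F d S U g) =
      (1 - de) / k.+1%:R * (k.+1%:R * ((1 - de) ^+ k * e (avg_cost F d S U g))).
    by rewrite exprS [RHS]mulrA divfK ?lt0r_neq0 // -mulrA.
  by apply: ler_wpM2l => //; rewrite divr_ge0.
have sb := step_bound_sum S_ge frozen_cost_le e_half e_convex e_ge0 l_ge0 l_le1 U gF.
rewrite cU in sb; have {sb} := ler_wpM2l (exprn_ge0 k de0) sb; rewrite mulrCA => /le_trans; apply.
have -> : \sum_(x in U) step_bound F d S e U g x =
    \sum_(0 <= i < k.+1) step_bound F d S e U g (nth x0 rem i).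
  rewrite -sz -(big_nth x0 predT) big_uniq //=; apply: eq_bigl => x; by rewrite remU.
rewrite mulr_sumr !big_nat; apply: ler_sum => i ik; have {ik} ik : (i < size rem)%N by rewrite sz.
have dr := drop_nth x0 ik; set x := nth x0 rem i in dr *.
apply: (success_at_ge dr) => // g' g'U.
set rem' := catrev _ _.
have prem : perm_eq (x :: rem') rem.
  apply/permP => p; rewrite /rem' catrevE -{3}(cat_take_drop i rem) dr /= !count_cat count_rev /=.
  exact: addnCA.
have := uniq_rem; rewrite -(perm_uniq prem) /= => /andP[xrem' urem'].
have g'F : satisfies g' F by have [] := extensionsP _ _ _ _ g'U.
apply: IH => //.
- by have := perm_size prem; rewrite sz /= => -[].
- move=> y; rewrite !inE -remU -(perm_mem prem) inE.
  by case: eqP => //= ->; rewrite (negbTE xrem').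
move=> [y b]; rewrite inE aU -(false_lits_eq g'U) !mem_false_lits !inE.
have xU : x \in U by rewrite -remU mem_nth.
rewrite xpair_eqE; case: eqP => [->|_] //=; by rewrite xU orbF.
Qed.

Lemma prob_trial : satisfiable F ->
  (1 - de) ^+ n * e (n%:R * S) <= prob (n * h.+1) (fun t => (trial t)%:R).
Proof.
move=> /existsP[g gF].
have enT : enum 'I_n =i [set: 'I_n] by move=> x; rewrite mem_enum in_setT.
have nilT : [::] =i false_lits setT g by move=> [x b]; rewrite mem_false_lits in_setT.
apply: le_trans (success_ge (enum_uniq _) (size_enum_ord n) enT gF nilT).
have de0 : 0 <= 1 - de by rewrite subr_ge0.
apply: ler_wpM2l; first exact: exprn_ge0.
(* Monotonicity of [e] comes from its tangent at [n%:R * S] and [0 <= l]. *)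
apply: le_trans (e_convex (avg_cost F d S setT g) (n%:R * S)).
rewrite -[leLHS]mulr1; apply: ler_wpM2l => //.
rewrite lerDl -mulrN opprB mulr_ge0 // subr_ge0.
exact: (avg_cost_setT S_ge frozen_cost_le gF).
Qed.

End Trial.

(** * Deterministic programs *)

Inductive prim : Type :=
| PLeaf of nat | PCopy of nat & nat | PNode of nat & nat & nat
| PHd of nat & nat | PTl of nat & nat.

Definition prim_cmd (p : prim) : cmd :=
  match p with
  | PLeaf x => SetLeaf x
  | PCopy x y => Copy x y
  | PNode x y z => SetNode x y z
  | PHd x y => SetHd x y
  | PTl x y => SetTl x y
  end.

Definition target (p : prim) : nat :=
  match p with PLeaf x | PCopy x _ | PNode x _ _ | PHd x _ | PTl x _ => x end.

Definition prim_value (p : prim) (s : store) : tree :=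
  match p with
  | PLeaf _ => Leaf
  | PCopy _ y => s y
  | PNode _ y z => Node (s y) (s z)
  | PHd _ y => hd (s y)
  | PTl _ y => tl (s y)
  end.

Definition prim_store (s : store) (p : prim) : store := update s (target p) (prim_value p s).

(* Deterministic commands in which every loop carries a bound on the number of its
   iterations; the bounds give the running time and are erased in the program. *)
Inductive acmd : Type :=
| Block of seq prim
| ASeq of acmd & acmd
| AIf of nat & acmd & acmd
| ALoop of nat & nat & acmd.

Fixpoint erase (c : acmd) : cmd :=
  match c with
  | Block ps => foldr (fun p d => Seq (prim_cmd p) d) (Copy 0 0) ps
  | ASeq c d => Seq (erase c) (erase d)
  | AIf x c d => If x (erase c) (erase d)
  | ALoop _ x c => While x (erase c)
  end.

Fixpoint cost (c : acmd) : nat :=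
  match c with
  | Block ps => (size ps).*2.+1
  | ASeq c d => (cost c + cost d).+1
  | AIf _ c d => (cost c + cost d).+1
  | ALoop b _ c => (b * (cost c).+1).+1
  end.

Fixpoint writes (c : acmd) : seq nat :=
  match c with
  | Block ps => map target ps
  | ASeq c d | AIf _ c d => writes c ++ writes d
  | ALoop _ _ c => writes c
  end.

Definition exec (c : cmd) (s s' : store) (m : nat) : Prop :=
  forall k w, size w = m -> foldl step (c :: k, s) w = (k, s').

Lemma exec_cat c d s s1 s2 m1 m2 w k k' : exec c s s1 m1 -> exec d s1 s2 m2 ->
  size w = m1 + m2 -> k = d :: k' -> foldl step (c :: k, s) w = (k', s2).
Proof.
move=> ec ed sw ->; rewrite -(cat_take_drop m1 w) foldl_cat ec ?ed //.
  by rewrite size_drop sw addKn.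
by rewrite size_takel // sw leq_addr.
Qed.

Lemma exec_step c s m d s1 s2 : (forall k b, step (c :: k, s) b = (d :: k, s1)) ->
  exec d s1 s2 m -> exec c s s2 m.+1.
Proof.
move=> cd ed k [|b w] // [sw].
by rewrite -[LHS]/(foldl step (step (c :: k, s) b) w) cd ed.
Qed.

Lemma exec_seq c d s s1 s2 m1 m2 : exec c s s1 m1 -> exec d s1 s2 m2 ->
  exec (Seq c d) s s2 (m1 + m2).+1.
Proof. by move=> ec ed k [|b w] //= [sw]; rewrite (exec_cat ec ed sw erefl). Qed.

Lemma exec_prim p s : exec (prim_cmd p) s (prim_store s p) 1.
Proof. by case: p => [x|x y|x y z|x y|x y] k [|b []]. Qed.

Lemma update_id s x : update s x (s x) = s.
Proof. by apply: functional_extensionality => y; rewrite /update; case: eqP => [->|]. Qed.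

(* Total correctness with the running time bound [cost c] and the frame condition. *)
Definition wp (s : store) (c : acmd) (Q : store -> Prop) : Prop :=
  exists s' m, [/\ m <= cost c, exec (erase c) s s' m, Q s' &
    forall x, x \notin writes c -> s' x = s x].

Lemma wp_conseq s c (P Q : store -> Prop) : wp s c P ->
  (forall s', P s' -> (forall x, x \notin writes c -> s' x = s x) -> Q s') -> wp s c Q.
Proof. by move=> [s' [m [mt ex Ps fr]]] PQ; exists s', m; split=> //; apply: PQ. Qed.

Lemma wp_block s ps (Q : store -> Prop) : Q (foldl prim_store s ps) -> wp s (Block ps) Q.
Proof.
elim: ps s => [|p ps IH] s /= HQ.
  exists s, 1; split=> // k [|b []] // _ /=; by rewrite update_id.
have [s' [m [mt ex Qs fr]]] := IH _ HQ.
exists s', (1 + m).+1; split=> //=.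
  exact: exec_seq (exec_prim p s) ex.
move=> x; rewrite inE negb_or => /andP[xp xps]; rewrite fr // /prim_store /update.
by rewrite (negbTE xp).
Qed.

Lemma wp_seq s c d (Q : store -> Prop) :
  wp s c (fun s1 => wp s1 d Q) -> wp s (ASeq c d) Q.
Proof.
move=> [s1 [m1 [mt1 ex1 [s2 [m2 [mt2 ex2 Q2 fr2]]] fr1]]].
exists s2, (m1 + m2).+1; split=> //=; first by rewrite ltnS leq_add.
  exact: exec_seq ex1 ex2.
by move=> x; rewrite mem_cat negb_or => /andP[xc xd]; rewrite fr2 ?fr1.
Qed.

Lemma wp_if s x c d (Q : store -> Prop) :
  (~~ is_leaf (s x) -> wp s c Q) -> (is_leaf (s x) -> wp s d Q) -> wp s (AIf x c d) Q.
Proof.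
move=> Hc Hd; have [lf|nl] := boolP (is_leaf (s x)).
  have [s' [m [mt ex Q' fr]]] := Hd lf; exists s', m.+1; split=> //=.
  - by rewrite ltnS (leq_trans mt) ?leq_addl.
  - by apply: exec_step ex => k b /=; rewrite lf.
  by move=> y; rewrite mem_cat negb_or => /andP[_ yd]; rewrite fr.
have [s' [m [mt ex Q' fr]]] := Hc nl; exists s', m.+1; split=> //=.
- by rewrite ltnS (leq_trans mt) ?leq_addr.
- by apply: exec_step ex => k b /=; rewrite (negbTE nl).
by move=> y; rewrite mem_cat negb_or => /andP[yc _]; rewrite fr.
Qed.

(** The first argument of [I] bounds the iterations still to come. The body must show it positive,
    so at [0] the loop variable is a leaf. *)
Lemma wp_loop (I : nat -> store -> Prop) b x c s : I b s ->
  (forall j s', I j s' -> (forall y, y \notin writes c -> s' y = s y) ->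
     ~~ is_leaf (s' x) -> 0 < j /\ wp s' c (I j.-1)) ->
  wp s (ALoop b x c) (fun s' => is_leaf (s' x) /\ exists j, I j s').
Proof.
move=> Ib Hbody.
suff H j s1 : I j s1 -> (forall y, y \notin writes c -> s1 y = s y) ->
  exists s' m, [/\ m <= (j * (cost c).+1).+1, exec (While x (erase c)) s1 s' m,
    is_leaf (s' x) /\ (exists i, I i s') & forall y, y \notin writes c -> s' y = s y].
  by have [s' [m [mt ex Q' fr]]] := H b s Ib (fun _ _ => erefl); exists s', m.
elim: j s1 => [|j IH] s1 Ij fr1.
  have [lf|nl] := boolP (is_leaf (s1 x)); last by have [] := Hbody _ _ Ij fr1 nl.
  exists s1, 1; split=> //; [|by split; [|exists 0]].
  by move=> k [|b0 []] //= _; rewrite lf.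
have [lf|nl] := boolP (is_leaf (s1 x)).
  exists s1, 1; split=> //; [|by split; [|exists j.+1]].
  by move=> k [|b0 []] //= _; rewrite lf.
have [_ [s2 [m2 [mt2 ex2 I2 fr2]]]] := Hbody _ _ Ij fr1 nl.
have fr2' y : y \notin writes c -> s2 y = s y by move=> yc; rewrite fr2 ?fr1.
have [s' [m [mt ex Q' fr']]] := IH s2 I2 fr2'.
exists s', (m2 + m).+1; split=> //; first by rewrite mulSn; lia.
move=> k [|b0 w] //= [sw]; rewrite (negbTE nl).
exact: exec_cat ex2 ex sw erefl.
Qed.

Lemma is_leaf_enc_nat j : is_leaf (enc_nat j) = (j == 0).
Proof. by case: j. Qed.

Lemma is_leaf_enc_bool b : is_leaf (enc_bool b) = ~~ b.
Proof. by case: b. Qed.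

Lemma tl_enc_nat j : tl (enc_nat j) = enc_nat j.-1.
Proof. by case: j. Qed.

Lemma is_leaf_enc_seq (T : Type) (enc : T -> tree) r : is_leaf (enc_seq enc r) = nilp r.
Proof. by case: r. Qed.

Lemma tl_enc_seq (T : Type) (enc : T -> tree) r : tl (enc_seq enc r) = enc_seq enc (behead r).
Proof. by case: r. Qed.

Local Infix ";;" := ASeq (at level 60, right associativity).

(* [vA] lists the literals known to be false, [vRES] is the result of the latest search.
   A flag [x] is set by [PNode x x x], which is not a leaf whatever [x] was. *)
Local Notation vANS := 0.
Local Notation vN := 1.
Local Notation vF := 2.
Local Notation vVARS := 3.
Local Notation vCNT := 4.
Local Notation vTAPE := 5.
Local Notation vH := 6.
Local Notation vREM := 7.
Local Notation vA := 8.
Local Notation vRES := 9.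
Local Notation vSTEP := 10.
Local Notation vI := 11.
Local Notation vQ := 12.
Local Notation vU := 13.
Local Notation vV := 14.
Local Notation vB := 15.
Local Notation vX := 16.
Local Notation vA0 := 17.
Local Notation vP := 18.
Local Notation vT := 19.
Local Notation vLP := 20.
Local Notation vLN := 21.
Local Notation vCL := 22.
Local Notation vC := 23.
Local Notation vG := 24.
Local Notation vL := 25.
Local Notation vK := 26.
Local Notation vE := 27.
Local Notation vM := 28.
Local Notation vEP := 29.
Local Notation vEQ := 30.
Local Notation vEB := 31.
Local Notation vNEW := 32.
Local Notation vTL := 33.

(* Work variables of the search for refutations at depth [d]: 0 is the list that remains to
   be tried, 1 the current variable, 2 the saved partial assignment and 3 the result. *)
Local Notation level d i := (40 + (4 * d + i)).

Ltac run := rewrite /= /prim_store /update /=.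

(** * Commands for the bounded search for refutations *)

Section Programs.
Variables (bn bm bk bh : nat).

Definition skip := Block [::].

(** Signs are compared as booleans, unary indices by removing cells in parallel; an index that
    outlasts the other clears [vEB]. *)
Definition eq_lit : acmd :=
  Block [:: PHd vEP vL; PHd vEQ vE] ;;
  AIf vEP (AIf vEQ (Block [:: PNode vEB vEB vEB]) (Block [:: PLeaf vEB]))
          (AIf vEQ (Block [:: PLeaf vEB]) (Block [:: PNode vEB vEB vEB])) ;;
  Block [:: PTl vEP vL; PTl vEQ vE] ;;
  ALoop bn vEP
    (Block [:: PTl vEP vEP] ;;
     AIf vEQ (Block [:: PTl vEQ vEQ]) (Block [:: PLeaf vEB])) ;;
  AIf vEQ (Block [:: PLeaf vEB]) skip.

Definition mem_lit : acmd :=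
  Block [:: PLeaf vM; PCopy vK vA] ;;
  ALoop bk vK
    (Block [:: PHd vE vK; PTl vK vK] ;; eq_lit ;;
     AIf vEB (Block [:: PNode vM vM vM]) skip).

Definition falsified : acmd :=
  Block [:: PLeaf vRES; PCopy vCL vF] ;;
  ALoop bm vCL
    (Block [:: PHd vC vCL; PTl vCL vCL; PNode vG vG vG] ;;
     ALoop 4 vC
       (Block [:: PHd vL vC; PTl vC vC] ;; mem_lit ;;
        AIf vM skip (Block [:: PLeaf vG])) ;;
     AIf vG (Block [:: PNode vRES vRES vRES]) skip).

Definition search d (c : acmd) : acmd :=
  Block [:: PCopy (level d 0) vVARS; PCopy (level d 2) vA; PLeaf (level d 3)] ;;
  ALoop bn (level d 0)
    (Block [:: PHd (level d 1) (level d 0); PTl (level d 0) (level d 0);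
       PLeaf vT; PNode vT vT vT; PNode vT vT (level d 1); PNode vA vT (level d 2)] ;;
     c ;;
     AIf vRES
       (Block [:: PLeaf vT; PNode vT vT (level d 1); PNode vA vT (level d 2)] ;;
        c ;;
        AIf vRES (Block [:: PNode (level d 3) vRES vRES]) skip) skip) ;;
  Block [:: PCopy vRES (level d 3); PCopy vA (level d 2)].

Fixpoint refute d : acmd := if d is d'.+1 then search d' (refute d') else falsified.

Definition refute_globals : seq nat :=
  [:: vA; vT; vRES; vCL; vC; vG; vL; vK; vE; vM; vEP; vEQ; vEB].

Lemma writes_search d c y : y \in writes (search d c) ->
  [|| y \in writes c, y \in refute_globals | 40 + 4 * d <= y < 40 + 4 * d.+1].
Proof.
rewrite /= !(mem_cat, inE); case: (y \in writes c) => //=.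
by repeat case/orP; move=> // /eqP->; (apply/orP; left; done) || (apply/orP; right; lia).
Qed.

Lemma writes_refute d y : y \in writes (refute d) ->
  (y \in refute_globals) || (40 <= y < 40 + 4 * d).
Proof.
elim: d => [|d IH] yw.
  have /allP H : all (mem refute_globals) (writes (refute 0)) by [].
  by rewrite [_ \in refute_globals](H _ yw).
have /or3P[/IH/orP[->//|h]|->//|h] := writes_search yw; apply/orP; right; lia.
Qed.

Lemma neq_level y x : y < 40 -> (y == 40 + x) = false.
Proof. by lia. Qed.

Lemma level_neq y x : y < 40 -> (40 + x == y) = false.
Proof. by lia. Qed.

Variables (n : nat) (F : cnf n).
Implicit Types (s : store) (l : literal n) (a : seq (literal n)).
Hypothesis n_bn : n <= bn.
Hypothesis F_bm : size F <= bm.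
Hypothesis F4 : all (fun C : seq ('I_n * bool) => size C <= 4) F.

Notation enc_lits := (enc_seq (@enc_literal n)).

Lemma wp_eq_lit s l l' : s vL = enc_literal l -> s vE = enc_literal l' ->
  wp s eq_lit (fun s' => ~~ is_leaf (s' vEB) = (l == l')).
Proof.
case: l l' => [i b] [i' b'] sL sE.
apply: wp_seq; apply: wp_block; run.
apply: wp_seq; apply: (@wp_conseq _ _ (fun s' => ~~ is_leaf (s' vEB) = (b == b') )).
  by apply: wp_if; run; rewrite sL is_leaf_enc_bool => hb; apply: wp_if; run;
    rewrite sE is_leaf_enc_bool => hb'; apply: wp_block; run; move: hb hb'; case: (b); case: (b').
move=> s1 e1 fr1.
apply: wp_seq; apply: wp_block; run; rewrite !fr1 //= sL sE /=.
pose I j (s' : store) := exists p q, [/\ p <= j, s' vEP = enc_nat p, s' vEQ = enc_nat q &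
  (~~ is_leaf (s' vEB)) && (p == q) = ((i, b) == (i', b'))].
apply: wp_seq; apply: (@wp_conseq _ _ (fun s' => is_leaf (s' vEP) /\ exists j, I j s')).
  apply: wp_loop.
    exists i, i'; split=> //=; first exact: leq_trans (ltnW (ltn_ord i)) n_bn.
    by rewrite e1 xpair_eqE andbC.
  move=> j s' [p [q [pj sp sq eb]]] _; rewrite sp is_leaf_enc_nat -lt0n => p0.
  split; first by lia.
  apply: wp_seq; apply: wp_block; run.
  apply: wp_if; run; rewrite sq is_leaf_enc_nat => q0; apply: wp_block; run; rewrite sp tl_enc_nat.
    exists p.-1, q.-1; split=> //; rewrite ?sq ?tl_enc_nat //; first by lia.
    by rewrite -eb; case: p p0 {sp eb pj} => // p _; case: q q0 {sq}.
  exists p.-1, q; split=> //; first by lia.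
  by rewrite -eb (eqP q0) /=; case: p p0 {sp eb pj} => //= p _; rewrite andbF.
move=> s' [lfp [j [p [q [pj sp sq eb]]]]] _.
move: lfp; rewrite sp is_leaf_enc_nat => /eqP p0.
apply: wp_if; rewrite sq is_leaf_enc_nat => q0; apply: wp_block; run; rewrite -eb p0.
  by rewrite eq_sym (negbTE q0) andbF.
by rewrite (eqP q0) andbT.
Qed.

Lemma wp_mem_lit s (l : 'I_n * bool) (a : seq ('I_n * bool)) :
  s vL = enc_literal l -> s vA = enc_lits a -> size a <= bk ->
  wp s mem_lit (fun s' => ~~ is_leaf (s' vM) = (l \in a)).
Proof.
move=> sL sA abk; apply: wp_seq; apply: wp_block; run.
pose I j (s' : store) := exists r : seq ('I_n * bool), [/\ size r <= j, s' vK = enc_lits r &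
  (~~ is_leaf (s' vM)) || (l \in r) = (l \in a)].
apply: (@wp_conseq _ _ (fun s' => is_leaf (s' vK) /\ exists j, I j s')).
  apply: wp_loop; first by exists a; rewrite /= sA.
  move=> j s' [[|e r] [rj sr er]] fr; rewrite sr is_leaf_enc_seq //= => _.
  split; first by apply: leq_trans rj.
  apply: wp_seq; apply: wp_block; run; apply: wp_seq.
  apply: wp_conseq; first by apply: (@wp_eq_lit _ l e); rewrite /= ?sr ?fr.
  move=> s1 e1 fr1; apply: wp_if => h; apply: wp_block; run; exists r.
    split; rewrite /=; [by case: (j) rj|by rewrite fr1 //= sr|].
    by rewrite -er inE; move: e1; rewrite h => <-; rewrite orbT.
  split; rewrite /=; [by case: (j) rj|by rewrite fr1 //= sr|].
  by rewrite -er inE -e1 h fr1.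
move=> s' [lf [j [r [rj sr er]]]] _; move: lf; rewrite sr is_leaf_enc_seq => /nilP r0.
by rewrite -er r0 in_nil orbF.
Qed.

Lemma wp_falsified s (a : seq ('I_n * bool)) :
  s vF = enc_seq enc_lits F -> s vA = enc_lits a -> size a <= bk ->
  wp s falsified (fun s' => ~~ is_leaf (s' vRES) = refuted F 0 a).
Proof.
move=> sF sA abk; apply: wp_seq; apply: wp_block; run.
pose I j (s' : store) := exists G : seq (seq ('I_n * bool)),
  [/\ size G <= j, s' vCL = enc_seq enc_lits G, {subset G <= (F : seq (seq ('I_n * bool)))} &
  (~~ is_leaf (s' vRES)) || has (all (mem a)) G = refuted F 0 a].
apply: (@wp_conseq _ _ (fun s' => is_leaf (s' vCL) /\ exists j, I j s')).
  apply: wp_loop; first by exists F; split; rewrite //= sF.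
  move=> j s' [[|C G] [Gj sG GF eG]] fr; rewrite sG is_leaf_enc_seq //= => _.
  split; first by apply: leq_trans Gj.
  apply: wp_seq; apply: wp_block; run; rewrite sG /=.
  pose J j (s' : store) := exists C' : seq ('I_n * bool), [/\ size C' <= j,
    s' vC = enc_lits C' & (~~ is_leaf (s' vG)) && all (mem a) C' = all (mem a) C].
  apply: wp_seq; apply: (@wp_conseq _ _ (fun s' => is_leaf (s' vC) /\ exists j, J j s')).
    apply: wp_loop; first by exists C; split=> //; apply: (allP F4); apply: GF; rewrite mem_head.
    move=> j1 s1 [[|l C'] [Cj sC eC]] fr1; rewrite sC is_leaf_enc_seq //= => _.
    split; first by apply: leq_trans Cj.
    apply: wp_seq; apply: wp_block; run; apply: wp_seq.
    apply: wp_conseq; first by apply: (@wp_mem_lit _ l a); rewrite /= ?sC ?fr1 //= fr.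
    move=> s2 e2 fr2; apply: wp_if => h; apply: wp_block; run; exists C'.
      split; rewrite /=; [by case: (j1) Cj|by rewrite fr2 //= sC|].
      by rewrite -eC fr2 //=; move: e2; rewrite h => <-.
    split; rewrite /=; [by case: (j1) Cj|by rewrite fr2 //= sC|].
    by rewrite -eC /=; move: e2; rewrite h /= => <-; rewrite andbF.
  move=> s1 [lf [j1 [C' [Cj sC eC]]]] fr1; move: lf; rewrite sC is_leaf_enc_seq => /nilP C0.
  have GF' : {subset G <= (F : seq (seq ('I_n * bool)))}.
    by move=> D DG; apply: GF; rewrite inE DG orbT.
  rewrite C0 andbT in eC.
  apply: wp_if => h; apply: wp_block; run; exists G.
    split=> //; [by case: (j) Gj|by rewrite /= fr1|].
    by rewrite -eG /= -eC h orbT.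
  split=> //; [by case: (j) Gj|by rewrite /= fr1|].
  by rewrite -eG /= -eC h fr1.
move=> s' [lf [j [G [Gj sG GF eG]]]] _; move: lf; rewrite sG is_leaf_enc_seq => /nilP G0.
by move: eG; rewrite G0 orbF.
Qed.

Ltac lookup := rewrite ?eqn_add2l ?neq_level ?level_neq //=.

Notation enc_vars := (enc_seq (fun x : 'I_n => enc_nat x)).

(** The inner search enters only through the predicate [rf] and its write set, as the induction in
    [wp_refute] requires. It writes globals and lower levels only, so the registers of level [d]
    survive it. *)
Lemma wp_search d c (rf : seq ('I_n * bool) -> bool) k :
  (forall y, y \in writes c -> (y \in refute_globals) || (40 <= y < 40 + 4 * d)) ->
  (forall s a, s vF = enc_seq enc_lits F -> s vVARS = enc_vars (enum 'I_n) ->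
     s vA = enc_lits a -> size a <= k ->
     wp s c (fun s' => ~~ is_leaf (s' vRES) = rf a /\ s' vA = enc_lits a)) ->
  forall s a, s vF = enc_seq enc_lits F -> s vVARS = enc_vars (enum 'I_n) ->
  s vA = enc_lits a -> size a < k ->
  wp s (search d c) (fun s' => ~~ is_leaf (s' vRES) =
     has (fun y => rf ((y, true) :: a) && rf ((y, false) :: a)) (enum 'I_n) /\
     s' vA = enc_lits a).
Proof.
move=> wc spec s a sF sV sA ak.
have gw y : y < 40 -> y \notin refute_globals -> y \notin writes c.
  by move=> y40; apply: contra => /wc /orP[//|]; rewrite leqNgt y40.
have lw i : level d i \notin writes c.
  apply/negP => /wc /orP[|]; last by lia.
  have /allP H : all (fun y => y < 40) refute_globals by [].
  by move=> /H; lia.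
apply: wp_seq; apply: wp_block; run; lookup.
pose r y := rf ((y, true) :: a) && rf ((y, false) :: a).
pose I j (s' : store) := exists ys : seq 'I_n, [/\ size ys <= j,
  s' (level d 0) = enc_vars ys, s' (level d 2) = enc_lits a &
  (~~ is_leaf (s' (level d 3))) || has r ys = has r (enum 'I_n)].
apply: wp_seq; apply: (@wp_conseq _ _ (fun s' => is_leaf (s' (level d 0)) /\ exists j, I j s')).
  apply: wp_loop; first by exists (enum 'I_n); split=> /=; lookup; rewrite size_enum_ord.
  move=> j s' [[|y ys] [yj sy s3 er]] fr; rewrite sy is_leaf_enc_seq //= => _.
  split; first by apply: leq_trans yj.
  apply: wp_seq; apply: wp_block; run; lookup; rewrite sy s3 /=.
  have fw x : x < 40 -> x \notin refute_globals -> s' x = s x.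
    move=> x40 xg; rewrite fr; first by lookup.
    have := gw _ x40 xg; move: xg; rewrite /= !(mem_cat, inE) !neq_level //.
    case: (x == vA) => //; case: (x == vT) => //; case: (x == vRES) => //.
    by case: (x \in writes c).
  apply: wp_seq; apply: wp_conseq.
    by apply: (spec _ ((y, true) :: a)); rewrite //= fw.
  move=> s1 [e1 A1] fr1; apply: wp_if => h.
    apply: wp_seq; apply: wp_block; run; lookup.
    rewrite !fr1 //; lookup.
    apply: wp_seq; apply: wp_conseq.
      apply: (spec _ ((y, false) :: a)) => //=; last by rewrite s3.
        by rewrite fr1 ?gw //=; lookup; rewrite fw.
      by rewrite fr1 ?gw //=; lookup; rewrite fw.
    move=> s2 [e2 A2] fr2; apply: wp_if => h2; apply: wp_block; run; exists ys.
      split; rewrite /=; lookup; first by case: (j) yj.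
      - by rewrite fr2 //=; lookup; rewrite fr1 //=; lookup.
      - by rewrite fr2 //=; lookup; rewrite fr1 //=; lookup.
      by rewrite -er /= /r -e1 -e2 h h2 /= orbT.
    split; rewrite /=; first by case: (j) yj.
    - by rewrite fr2 //=; lookup; rewrite fr1 //=; lookup.
    - by rewrite fr2 //=; lookup; rewrite fr1 //=; lookup.
    by rewrite -er /= /r -e2 h2 /= andbF /= !(fr1, fr2) //; lookup.
  apply: wp_block; run; exists ys; split; rewrite /=; first by case: (j) yj.
  - by rewrite fr1 //=; lookup.
  - by rewrite fr1 //=; lookup.
  by rewrite -er /= /r -e1 h /= !fr1 //; lookup.
move=> s' [lf [j [ys [yj sy s3 er]]]] _; apply: wp_block; run; lookup.
move: lf; rewrite sy is_leaf_enc_seq => /nilP y0; rewrite s3; split=> //.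
by move: er; rewrite y0 orbF.
Qed.

Lemma wp_refute d s a :
  s vF = enc_seq enc_lits F -> s vVARS = enc_vars (enum 'I_n) -> s vA = enc_lits a ->
  size a + d <= bk ->
  wp s (refute d) (fun s' => ~~ is_leaf (s' vRES) = refuted F d a /\ s' vA = enc_lits a).
Proof.
elim: d s a => [|d IH] s a sF sV sA ak.
  apply: wp_conseq; first by apply: (@wp_falsified _ a) => //; rewrite addn0 in ak.
  by move=> s' -> fr; rewrite fr.
have ak' : size a < bk - d by lia.
apply: (wp_search (rf := refuted F d) (@writes_refute d) _ sF sV sA ak').
move=> s' a' sF' sV' sA' a'k; apply: IH => //; lia.
Qed.

End Programs.

(** * The command for one trial *)

Section TrialProgram.
Variables (bn bm bk bh d : nat).

(** [vU] is a position in unary and [vQ] the part of [vREM] from there on; when [vQ] runs out, the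
    position wraps around. This replaces arithmetic modulo the length. *)
Definition inc : acmd :=
  Block [:: PLeaf vT; PNode vU vT vU; PTl vQ vQ] ;;
  AIf vQ skip (Block [:: PCopy vQ vREM; PLeaf vU]).

(** Horner's scheme as in [position]: [vU] is doubled by incrementing it [vU] times, and a set bit
    increments it once more. *)
Definition locate : acmd :=
  ALoop bh vI
    (Block [:: PTl vI vI; PCopy vV vU] ;;
     ALoop bn vV (Block [:: PTl vV vV] ;; inc) ;;
     Block [:: PHd vB vTAPE; PTl vTAPE vTAPE] ;;
     AIf vB inc skip).

(** Moving the prefix cell by cell onto the suffix reverses it, whence [catrev] in [ppsz]. *)
Definition remove : acmd :=
  Block [:: PHd vX vQ; PCopy vP vREM; PTl vREM vQ] ;;
  ALoop bn vU (Block [:: PTl vU vU; PHd vT vP; PNode vREM vT vREM; PTl vP vP]).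

Definition choose : acmd :=
  Block [:: PHd vB vTAPE; PTl vTAPE vTAPE; PCopy vA0 vA; PLeaf vT; PNode vLN vT vX;
    PNode vT vT vT; PNode vLP vT vX; PNode vA vLP vA0] ;;
  refute bn bm bk d ;;
  AIf vRES (Block [:: PCopy vNEW vLN])
    (Block [:: PNode vA vLN vA0] ;;
     refute bn bm bk d ;;
     AIf vRES (Block [:: PCopy vNEW vLP]) (Block [:: PNode vNEW vB vX])) ;;
  Block [:: PNode vA vNEW vA0].

Definition trial_step : acmd :=
  Block [:: PTl vSTEP vSTEP; PCopy vQ vREM; PLeaf vU; PCopy vI vH] ;;
  locate ;; remove ;; choose.

Definition trial_prog : acmd :=
  Block [:: PLeaf vA; PCopy vREM vVARS; PCopy vSTEP vN] ;;
  ALoop bn vSTEP trial_step ;;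
  falsified bn bm bk.

Lemma glob_notin_refute y : y < 40 -> y \notin refute_globals ->
  y \notin writes (refute bn bm bk d).
Proof.
move=> y40; apply: contra => yw; case/orP: (writes_refute yw) => //.
by rewrite leqNgt y40.
Qed.

Lemma notin_choose y : y < 40 ->
  y \notin [:: vB; vTAPE; vA0; vLN; vLP; vNEW] ++ refute_globals -> y \notin writes choose.
Proof.
move=> y40; rewrite mem_cat negb_or => /andP[y1 y2].
have := glob_notin_refute y40 y2; move: y1 y2; rewrite /= !(mem_cat, inE).
case: (y \in writes _) => //.
by do 18! [case: (y == _) => //].
Qed.

Definition trial_globals : seq nat :=
  [:: vSTEP; vI; vQ; vU; vV; vT; vX; vP; vREM; vB; vTAPE; vA0; vLN; vLP; vNEW] ++ refute_globals.

Lemma notin_trial_step y : y < 40 -> y \notin trial_globals -> y \notin writes trial_step.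
Proof.
move=> y40 yt.
have -> : writes trial_step =
    ([:: vSTEP; vQ; vU; vI] ++ writes locate ++ writes remove) ++ writes choose.
  by rewrite -!catA.
rewrite mem_cat negb_or; apply/andP; split.
  have /allP H : all [in trial_globals]
    ([:: vSTEP; vQ; vU; vI] ++ writes locate ++ writes remove) by [].
  by apply: contra yt => /H.
apply: notin_choose => //.
have /allP H : all [in trial_globals]
  ([:: vB; vTAPE; vA0; vLN; vLP; vNEW] ++ refute_globals) by [].
by apply: contra yt => /H.
Qed.

Variables (n : nat) (F : cnf n) (h : nat).
Hypothesis n_bn : n <= bn.
Hypothesis F_bm : size F <= bm.
Hypothesis F4 : all (fun C : seq ('I_n * bool) => size C <= 4) F.
Hypothesis h_bh : h <= bh.
Hypothesis n_bk : n + d <= bk.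
Implicit Types (s : store) (rem : seq 'I_n).

Notation enc_lits := (enc_seq (@enc_literal n)).
Notation enc_vars := (enc_seq (fun x : 'I_n => enc_nat x)).
Notation enc_bits := (enc_seq enc_bool).

Definition at_position s rem u :=
  s vU = enc_nat u /\ s vQ = enc_vars (drop u rem).

Lemma wp_inc s rem u : at_position s rem u -> s vREM = enc_vars rem -> u < size rem ->
  wp s inc (fun s' => at_position s' rem (u.+1 %% size rem)).
Proof.
move=> [sU sQ] sR ur; apply: wp_seq; apply: wp_block; run.
rewrite sU sQ tl_enc_seq -drop1 drop_drop add1n.
apply: wp_if; run; rewrite is_leaf_enc_seq => lf; apply: wp_block; run.
  rewrite /at_position /= modn_small //.
  by move: lf; rewrite /nilp size_drop; lia.
have -> : u.+1 = size rem by move: lf; rewrite /nilp size_drop; lia.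
by rewrite modnn /at_position /= sR drop0.
Qed.

Lemma wp_locate s rem (tape : bitseq) :
  s vI = enc_nat h -> at_position s rem 0 -> s vREM = enc_vars rem ->
  0 < size rem <= bn -> s vTAPE = enc_bits tape -> h <= size tape ->
  wp s locate (fun s' => at_position s' rem (position (size rem) (take h tape)) /\
    s' vTAPE = enc_bits (drop h tape)).
Proof.
move=> sI pos sR /andP[r0 rb] sT ht; set m := size rem in r0 rb *.
pose f u (b : bool) := (u.*2 + b) %% m.
pose I j (s' : store) := exists u i t, [/\ i <= j /\ i <= size t, s' vI = enc_nat i,
  at_position s' rem u /\ u < m, s' vTAPE = enc_bits t &
  foldl f u (take i t) = position m (take h tape) /\ drop i t = drop h tape].
apply: (@wp_conseq _ _ (fun s' => is_leaf (s' vI) /\ exists j, I j s')); last first.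
  move=> s' [lf [j [u [i [t [_ si [pos' _] st [e1 e2]]]]]]] _.
  move: lf; rewrite si is_leaf_enc_nat => /eqP i0; move: e1 e2; rewrite i0 take0 drop0 /=.
  by move=> <- <-.
apply: wp_loop; first by exists 0, h, tape.
move=> j s' [u [i [t [[ij it] si [pos' um] st [e1 e2]]]]] fr.
rewrite si is_leaf_enc_nat -lt0n => i0; split; first by lia.
have sR' : s' vREM = enc_vars rem by rewrite fr.
apply: wp_seq; apply: wp_block; run; rewrite si tl_enc_nat.
have [sU sQ] := pos'; rewrite sU.
pose J j (s2 : store) := exists v w, [/\ v <= j, s2 vV = enc_nat v, at_position s2 rem w,
  w < m & (w + v) %% m = u.*2 %% m].
apply: wp_seq; apply: (@wp_conseq _ _ (fun s2 => is_leaf (s2 vV) /\ exists j, J j s2)).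
  apply: wp_loop.
    exists u, u; split=> //; last by rewrite addnn.
    by apply: leq_trans (ltnW um) _; apply: leq_trans rb.
  move=> j2 s2 [v [w [vj sv pos2 wm e]]] fr2; rewrite sv is_leaf_enc_nat -lt0n => v0.
  split; first by lia.
  apply: wp_seq; apply: wp_block; run; rewrite sv tl_enc_nat.
  apply: wp_conseq; first by apply: (@wp_inc _ rem w); rewrite //= fr2 //= sR'.
  move=> s3 pos3 fr3; exists v.-1, (w.+1 %% m); split=> //.
  - by lia.
  - by rewrite fr3.
  - by rewrite ltn_mod.
  by rewrite modnDml -e; congr (_ %% _); lia.
move=> s2 [lf [j2 [v [w [_ sv pos2 wm e]]]]] fr2.
move: lf; rewrite sv is_leaf_enc_nat => /eqP v0; move: e; rewrite v0 addn0 => e.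
apply: wp_seq; apply: wp_block; run; rewrite fr2 //= st.
case: t it st e1 e2 => [|b t] it st e1 e2; first by move: it i0; rewrite leqn0 => /eqP->.
have ei : i = i.-1.+1 by rewrite prednK.
have we : w = u.*2 %% m by rewrite -e modn_small.
have fold_eq w' : w' = f u b -> foldl f w' (take i.-1 t) = position m (take h tape).
  by move=> ->; rewrite -e1 {2}ei.
have drop_eq : drop i.-1 t = drop h tape by rewrite -e2 {2}ei.
have it' : i.-1 <= j.-1 /\ i.-1 <= size t by move: it => /=; lia.
apply: wp_if; run; rewrite is_leaf_enc_bool => bb.
  apply: wp_conseq; first by apply: (@wp_inc _ rem w); rewrite //= fr2 //= sR'.
  move=> s3 pos3 fr3; exists (w.+1 %% m), i.-1, t; split=> //; rewrite ?fr3 //=.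
  - by rewrite fr2.
  - by split=> //; rewrite ltn_mod.
  split=> //; apply: fold_eq; rewrite /f we -addn1 modnDml.
  by move: bb; case: (b).
apply: wp_block; run; exists w, i.-1, t; split=> //=; first by rewrite fr2.
by split=> //; apply: fold_eq; rewrite /f we; move: bb; case: (b); rewrite //= addn0.
Qed.

Lemma wp_remove s rem u x rest : at_position s rem u -> s vREM = enc_vars rem ->
  size rem <= bn -> drop u rem = x :: rest ->
  wp s remove (fun s' => s' vX = enc_nat x /\
    s' vREM = enc_vars (catrev (take u rem) rest)).
Proof.
move=> [sU sQ] sR rb dr; have ur : u < size rem.
  by rewrite ltnNge; apply/negP => le; move: dr; rewrite drop_oversize.
apply: wp_seq; apply: wp_block; run; rewrite sQ dr /=.
pose I j (s' : store) := exists i p q, [/\ i <= j /\ i <= size p, s' vU = enc_nat i,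
  s' vP = enc_vars p, s' vREM = enc_vars q & catrev (take i p) q = catrev (take u rem) rest].
apply: (@wp_conseq _ _ (fun s' => is_leaf (s' vU) /\ exists j, I j s')).
  apply: wp_loop; first by exists u, rem, rest; rewrite /= sR; split=> //; lia.
  move=> j s' [i [p [q [[ij ip] si sp sq e]]]] fr; rewrite si is_leaf_enc_nat -lt0n => i0.
  split; first by lia.
  case: p ip sp e => [|y p] /= ip sp e; first by lia.
  apply: wp_block; run; rewrite si sp sq tl_enc_nat /=; exists i.-1, p, (y :: q); split=> //.
    by lia.
  by rewrite -e -{2}(prednK i0).
move=> s' [lf [j [i [p [q [_ si sp sq e]]]]]] fr.
move: lf; rewrite si is_leaf_enc_nat => /eqP i0; move: e; rewrite i0 take0 /= => <-.
by split=> //; rewrite fr.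
Qed.

Ltac frame fr := rewrite fr ?glob_notin_refute //=.

Lemma wp_choose s (x : 'I_n) (t : bitseq) (a : seq ('I_n * bool)) :
  s vF = enc_seq enc_lits F -> s vVARS = enc_vars (enum 'I_n) ->
  s vX = enc_nat x -> s vTAPE = enc_bits t -> s vA = enc_lits a ->
  (size a).+1 + d <= bk ->
  wp s choose (fun s' =>
    s' vA = enc_lits (next_false_lit F d a x (head false t) :: a) /\
    s' vTAPE = enc_bits (behead t)).
Proof.
move=> sF sV sX sT sA ak.
have wr s0 a0 := @wp_refute bn bm bk n F n_bn F_bm F4 d s0 a0.
apply: wp_seq; apply: wp_block; run.
have hdT : hd (s vTAPE) = enc_bool (head false t) by rewrite sT; case: (t).
rewrite sX sA hdT sT tl_enc_seq.
apply: wp_seq; apply: wp_conseq; first by apply: (wr _ ((x, true) :: a)).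
move=> s1 [e1 A1] fr1; rewrite /next_false_lit -e1.
apply: wp_seq; apply: wp_if => [h1|/[dup] h1 ->].
  apply: wp_block; run; apply: wp_block; run.
  rewrite h1; split; last by frame fr1.
  by rewrite !fr1 ?glob_notin_refute //=.
apply: wp_seq; apply: wp_block; run.
apply: wp_seq; apply: wp_conseq.
  apply: (wr _ ((x, false) :: a)) => //=; [by frame fr1|by frame fr1|].
  by rewrite !fr1 ?glob_notin_refute //=.
move=> s2 [e2 A2] fr2; rewrite -e2.
apply: wp_if => [h2|/[dup] h2 ->]; apply: wp_block; run; apply: wp_block; run.
  rewrite h2; split; last by frame fr2; frame fr1.
  by rewrite !fr2 ?glob_notin_refute //= !fr1 ?glob_notin_refute.
split; last by frame fr2; frame fr1.
by rewrite !fr2 ?glob_notin_refute //= !fr1 ?glob_notin_refute //= sX.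
Qed.

Lemma wp_trial_prog s (tape : bitseq) :
  s vF = enc_seq enc_lits F -> s vVARS = enc_vars (enum 'I_n) -> s vN = enc_nat n ->
  s vH = enc_nat h -> s vTAPE = enc_bits tape -> size tape = n * h.+1 ->
  wp s trial_prog (fun s' => ~~ is_leaf (s' vRES) = ~~ trial F d h tape).
Proof.
move=> sF sV sN sH sT szT.
apply: wp_seq; apply: wp_block; run; rewrite sV sN.
(* Finishing the trial from the current state gives the same list of literals as the whole trial. *)
pose I j (s' : store) := exists i rem (a : seq ('I_n * bool)) t,
  [/\ [/\ i <= j, size rem = i, size a + i <= n & size t = i * h.+1],
   s' vSTEP = enc_nat i, s' vREM = enc_vars rem, s' vA = enc_lits a & s' vTAPE = enc_bits t /\
   ppsz F d h i rem a t = ppsz F d h n (enum 'I_n) [::] tape].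
apply: wp_seq; apply: (@wp_conseq _ _ (fun s' => is_leaf (s' vSTEP) /\ exists j, I j s')).
  apply: wp_loop.
    by exists n, (enum 'I_n), [::], tape; split=> //; split=> //; rewrite size_enum_ord.
  move=> j s' [i [rem [a [t [[ij sr ai szt] si srem sa [st e]]]]]] fr.
  rewrite si is_leaf_enc_nat -lt0n => i0; split; first by lia.
  have fw y : y < 40 -> y \notin trial_globals ->
      s' y = (if y == vSTEP then enc_nat n
              else if y == vREM then enc_vars (enum 'I_n) else if y == vA then Leaf else s y).
    by move=> y40 yt; rewrite fr ?notin_trial_step.
  have [x [rest dr]] : exists x rest, drop (position (size rem) (take h t)) rem = x :: rest.
    case E : (drop _ rem) => [|x rest]; last by exists x, rest.
    have := size_drop (position (size rem) (take h t)) rem; rewrite E position_modn sr /=.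
    by have := ltn_pmod (bits_num (take h t)) i0; lia.
  apply: wp_seq; apply: wp_block; run; rewrite si srem tl_enc_nat.
  apply: wp_seq; apply: wp_conseq.
    apply: (@wp_locate _ rem t) => //=.
    - by rewrite fw.
    - by rewrite /at_position /= drop0.
    - by lia.
    - by rewrite szt; apply: leq_trans (leqnSn h) _; rewrite leq_pmull.
  move=> s1 [pos1 T1] fr1; apply: wp_seq; apply: wp_conseq.
    apply: (wp_remove pos1 _ _ dr); first by rewrite fr1.
    by lia.
  move=> s2 [X2 R2] fr2; apply: wp_conseq.
    apply: (@wp_choose _ x (drop h t) a) => //.
    - by rewrite fr2 // fr1 //= fw.
    - by rewrite fr2 // fr1 //= fw.
    - by rewrite fr2.
    - by rewrite fr2 // fr1.
    by lia.
  move=> s3 [A3 T3] fr3.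
  exists i.-1, (catrev (take (position (size rem) (take h t)) rem) rest),
    (next_false_lit F d a x (head false (drop h t)) :: a), (behead (drop h t)).
  split=> //.
  - split; [lia| |by rewrite /=; lia|].
      have := f_equal size dr; rewrite size_drop catrevE size_cat size_rev size_take_min /=; lia.
    by rewrite size_behead size_drop szt -subnS -{1}(prednK i0) mulSn addKn.
  - by rewrite fr3 ?notin_choose // fr2 // fr1.
  - by rewrite fr3 ?notin_choose // fr2 // fr1.
  split=> //; rewrite -e -{2}(prednK i0) /= dr -drop1 drop_drop add1n.
  by [].
move=> s' [lf [j [i [rem [a [t [[_ _ ai _] si srem sa [st e]]]]]]]] fr.
move: lf; rewrite si is_leaf_enc_nat => /eqP i0.
rewrite i0 /= in e; apply: wp_conseq.
  apply: (wp_falsified n_bn F_bm F4 (a := a)) => //; last by lia.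
  by rewrite fr ?notin_trial_step.
by move=> s2 -> _; rewrite /trial negbK -e.
Qed.

End TrialProgram.

(** * Randomized programs *)

Lemma foldl_push (k x y : nat) (s : store) z : x != y ->
  foldl prim_store s (nseq k (PNode x y x)) z =
  if z == x then iter k (Node (s y)) (s x) else s z.
Proof.
move=> xy; elim: k s => [|k IH] s /=; first by case: eqP => [->|].
rewrite IH /prim_store /update /= eqxx (eq_sym y x) (negbTE xy) -iterSr /=.
by case: eqP.
Qed.

Lemma foldl_tl (k x : nat) (s : store) z :
  foldl prim_store s (nseq k (PTl x x)) z = if z == x then iter k tl (s x) else s z.
Proof.
elim: k s => [|k IH] s /=; first by case: eqP => [->|].
by rewrite IH /prim_store /update /= eqxx -iterSr /=; case: eqP.
Qed.

Lemma iter_enc_nat k i : iter k (Node Leaf) (enc_nat i) = enc_nat (k + i).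
Proof. by rewrite /enc_nat iterD. Qed.

Lemma iter_tl_enc_nat k i : iter k tl (enc_nat i) = enc_nat (i - k).
Proof. by elim: k => [|k IH]; rewrite ?subn0 // iterS IH tl_enc_nat subnS. Qed.

(* Iterating [c := p * ceil (c / q)], which multiplies [c] by [p / q] up to rounding. *)
Fixpoint growth_bound (p q k : nat) : nat :=
  if k is k'.+1 then p * growth_bound p q k' %/ q + p else 1.

Ltac notin := rewrite ?(inE, mem_cat, map_nseq, mem_nseq) /= ?andbF.

(** * Preparation: list of variables, number of coins, number of trials *)

Section Init.
Variables (bn bh bc L0 p q : nat).

Definition init_vars : acmd :=
  Block [:: PHd vN vANS; PTl vF vANS; PLeaf vANS; PLeaf vVARS; PCopy vSTEP vN] ;;
  ALoop bn vSTEP (Block [:: PTl vSTEP vSTEP; PNode vVARS vSTEP vVARS]).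

(** [vH] becomes [n + L0]: as [n <= 2 ^ n], the number of remaining variables is at most [2 ^ - L0]
    times the range of a number of [vH] bits. Every variable takes [vH] coins for the choice and one
    for a guess. *)
Definition init_tape : acmd :=
  Block [:: PLeaf vT; PCopy vH vN] ;;
  Block (nseq L0 (PNode vH vT vH)) ;;
  Block [:: PLeaf vTL; PCopy vSTEP vN] ;;
  ALoop bn vSTEP
    (Block [:: PTl vSTEP vSTEP; PCopy vI vH; PNode vTL vT vTL] ;;
     ALoop bh vI (Block [:: PTl vI vI; PNode vTL vT vTL])).

(** A round of the inner loop takes [q] from [vV] and adds [p] to [vU]. The tail of a leaf is a
    leaf, so an incomplete last round counts in full and the result is rounded up. *)
Definition init_count : acmd :=
  Block [:: PLeaf vT; PNode vCNT vT vT; PCopy vSTEP vN] ;;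
  ALoop bn vSTEP
    (Block [:: PTl vSTEP vSTEP; PLeaf vU; PCopy vV vCNT] ;;
     ALoop bc vV (Block (nseq q (PTl vV vV)) ;; Block (nseq p (PNode vU vT vU))) ;;
     Block [:: PCopy vCNT vU]).

Definition init_prog : acmd := init_vars ;; init_tape ;; init_count.

Variables (n : nat) (F : cnf n).
Hypothesis n_bn : n <= bn.
Implicit Types (s : store).

Notation enc_lits := (enc_seq (@enc_literal n)).
Notation enc_vars := (enc_seq (fun x : 'I_n => enc_nat x)).

Lemma wp_init_vars s : s vANS = enc_cnf F ->
  wp s init_vars (fun s' => [/\ s' vN = enc_nat n, s' vF = enc_seq enc_lits F,
    s' vANS = Leaf & s' vVARS = enc_vars (enum 'I_n)]).
Proof.
move=> sA; apply: wp_seq; apply: wp_block; run; rewrite sA /=.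
pose I j (s' : store) := exists i, [/\ i <= j /\ i <= n, s' vSTEP = enc_nat i &
  s' vVARS = enc_seq enc_nat (iota i (n - i))].
apply: (@wp_conseq _ _ (fun s' => is_leaf (s' vSTEP) /\ exists j, I j s')).
  apply: wp_loop; first by exists n; rewrite subnn.
  move=> j s' [i [[ij ni] si sv]] fr; rewrite si is_leaf_enc_nat -lt0n => i0.
  split; first by lia.
  apply: wp_block; run; rewrite si sv tl_enc_nat; exists i.-1; split=> //; first by lia.
  have -> : n - i.-1 = (n - i).+1 by lia.
  by rewrite /= (prednK i0).
move=> s' [lf [j [i [_ si sv]]]] fr; move: lf; rewrite si is_leaf_enc_nat => /eqP i0.
split; [by rewrite fr|by rewrite fr|by rewrite fr|rewrite sv i0 subn0 -val_enum_ord].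
by elim: (enum _) => //= x r ->.
Qed.

Hypothesis n_bh : n + L0 <= bh.

Lemma wp_init_tape s : s vN = enc_nat n ->
  wp s init_tape (fun s' => s' vH = enc_nat (n + L0) /\ s' vTL = enc_nat (n * (n + L0).+1)).
Proof.
move=> sN; apply: wp_seq; apply: wp_block; run.
apply: wp_seq; apply: wp_block.
set s0 := foldl _ _ _.
have s0E z : s0 z = if z == vH then enc_nat (n + L0) else if z == vT then Leaf else s z.
  rewrite /s0 foldl_push //; case: eqP => [_|/eqP/negbTE zH].
    by rewrite /= sN iter_enc_nat addnC.
  by rewrite /= ?zH.
apply: wp_seq; apply: wp_block; run; rewrite !s0E /=.
pose I j (s' : store) := exists i, [/\ i <= j /\ i <= n, s' vSTEP = enc_nat i &
  s' vTL = enc_nat ((n - i) * (n + L0).+1)].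
apply: (@wp_conseq _ _ (fun s' => is_leaf (s' vSTEP) /\ exists j, I j s')).
  apply: wp_loop; first by exists n; rewrite subnn.
  move=> j s' [i [[ij ni] si sv]] fr; rewrite si is_leaf_enc_nat -lt0n => i0.
  split; first by lia.
  have sT : s' vT = Leaf by rewrite fr //= s0E.
  have sH : s' vH = enc_nat (n + L0) by rewrite fr //= s0E.
  apply: wp_seq; apply: wp_block; run; rewrite sT sv si sH tl_enc_nat.
  pose J j (s2 : store) := exists i', [/\ i' <= j /\ i' <= n + L0, s2 vI = enc_nat i' &
    s2 vTL = enc_nat ((n - i) * (n + L0).+1 + (n + L0 - i').+1)].
  apply: (@wp_conseq _ _ (fun s' => is_leaf (s' vI) /\ exists j, J j s')).
    apply: wp_loop; first by exists (n + L0); rewrite /= subnn addn1.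
    move=> j2 s2 [i' [[ij2 ni2] si2 sv2]] fr2; rewrite si2 is_leaf_enc_nat -lt0n => i0'.
    split; first by lia.
    have sT2 : s2 vT = Leaf by rewrite fr2 //= sT.
    apply: wp_block; run; rewrite si2 sv2 sT2 tl_enc_nat; exists i'.-1; split=> //; first by lia.
    by rewrite -[Node Leaf _]/(enc_nat _.+1); congr enc_nat; lia.
  move=> s2 [lf [j2 [i' [_ si2 sv2]]]] fr2.
  move: lf; rewrite si2 is_leaf_enc_nat => /eqP i0'.
  exists i.-1; split; [by lia|by rewrite fr2|].
  rewrite sv2 i0' subn0; congr enc_nat.
  have -> : n - i.-1 = (n - i).+1 by lia.
  by rewrite mulSn addnC.
move=> s' [lf [j [i [_ si sv]]]] fr; move: lf; rewrite si is_leaf_enc_nat => /eqP i0.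
by rewrite fr //= s0E sv i0 subn0.
Qed.

End Init.

Section InitCount.
Variables (bn bc p q n : nat).
Hypothesis n_bn : n <= bn.
Hypothesis p_gt0 : 0 < p.
Hypothesis q_gt0 : 0 < q.
Hypothesis bc_ge : forall k, k <= n -> growth_bound p q k <= bc.

Lemma wp_init_count s : s vN = enc_nat n ->
  wp s (init_count bn bc p q) (fun s' => exists c, [/\ s' vCNT = enc_nat c, p ^ n <= q ^ n * c &
    c <= growth_bound p q n]).
Proof.
move=> sN; apply: wp_seq; apply: wp_block; run; rewrite sN.
pose I j (s' : store) := exists i c, [/\ i <= j /\ i <= n, s' vSTEP = enc_nat i,
  s' vCNT = enc_nat c, p ^ (n - i) <= q ^ (n - i) * c & c <= growth_bound p q (n - i)].
apply: (@wp_conseq _ _ (fun s' => is_leaf (s' vSTEP) /\ exists j, I j s')); last first.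
  move=> s' [lf [j [i [c [_ si sc]]]]] h1 h2 _; move: lf; rewrite si is_leaf_enc_nat => /eqP i0.
  by exists c; move: h1 h2; rewrite i0 subn0.
apply: wp_loop; first by exists n, 1; rewrite subnn.
move=> j s' [i [c [[ij ni] si sc c1 c2]]] fr; rewrite si is_leaf_enc_nat -lt0n => i0.
split; first by lia.
have sT : s' vT = Leaf by rewrite fr //=; notin.
apply: wp_seq; apply: wp_block; run; rewrite si sc tl_enc_nat.
(* While [v] is positive no round has been incomplete; the last one overshoots by at most
   [p * q]. *)
pose J j (s2 : store) := exists v u, [/\ v <= j, s2 vV = enc_nat v, s2 vU = enc_nat u,
  p * c <= q * u + p * v & if 0 < v then q * u + p * v <= p * c else q * u <= p * c + p * q].
apply: wp_seq; apply: (@wp_conseq _ _ (fun s2 => is_leaf (s2 vV) /\ exists j, J j s2)).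
  apply: wp_loop.
    exists c, 0; split=> //; last by case: ifP => _; rewrite muln0 ?add0n.
      by apply: leq_trans c2 _; apply: bc_ge; rewrite leq_subr.
    by rewrite muln0 add0n.
  move=> j2 s2 [v [u [vj sv su u1 u2]]] fr2; rewrite sv is_leaf_enc_nat -lt0n => v0.
  split; first by lia.
  have sT2 : s2 vT = Leaf by rewrite fr2 //=; notin.
  rewrite v0 in u2; apply: wp_seq; apply: wp_block; apply: wp_block.
  exists (v - q), (p + u); rewrite !foldl_push // !foldl_tl /=.
  rewrite sv su sT2 iter_enc_nat iter_tl_enc_nat.
  split=> //; first by lia.
    by have [vq|qv] := leqP v q; [|have := subnK (ltnW qv)]; nia.
  case: ifP; rewrite subn_gt0 => vq; last by rewrite mulnDr (mulnC q p); lia.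
  by have := subnK (ltnW vq); nia.
move=> s2 [lf [j2 [v [u [_ sv su u1 u2]]]]] fr2.
move: lf; rewrite sv is_leaf_enc_nat => /eqP v0; rewrite v0 muln0 addn0 /= in u1 u2.
have e : n - i.-1 = (n - i).+1 by lia.
apply: wp_block; run; exists i.-1, u; split=> //; first by lia.
- by rewrite /= fr2 //=; notin.
- rewrite e !expnS -mulnA; apply: leq_trans (leq_mul (leqnn p) c1) _.
  by rewrite mulnCA [leqRHS]mulnCA leq_mul2l u1 orbT.
rewrite e /= -divnDMl // leq_divRL // mulnC; apply: leq_trans u2 _.
by rewrite leq_add2r leq_mul2l c2 orbT.
Qed.

End InitCount.

(** * Acceptance probability and repetition of trials *)

Section Acceptance.
Local Open Scope ring_scope.
Variable R : realFieldType.
Implicit Types (cf : config) (s : store) (k : seq cmd).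

Definition accepting cf : bool := halted cf && ~~ is_leaf (cf.2 0%N).

(* From [cf] every run halts within [t] steps, and it accepts with probability [q]. *)
Definition outcome cf (t : nat) (q : R) : Prop :=
  (forall w, size w = t -> halted (foldl step cf w)) /\
  prob t (fun w => (accepting (foldl step cf w))%:R) = q.

Lemma step_halted cf w : halted cf -> foldl step cf w = cf.
Proof. by case: cf => -[|c k] s // _; elim: w. Qed.

Lemma outcome_leq cf t t' q : (t <= t')%N -> outcome cf t q -> outcome cf t' q.
Proof.
move=> /subnK <-; rewrite addnC; move: (t' - t)%N => j [hlt <-].
have h w v : size w = t -> foldl step cf (w ++ v) = foldl step cf w.
  by move=> sw; rewrite foldl_cat step_halted ?hlt.
split=> [w sw|].
  have sw' : size (take t w) = t by rewrite size_takel // sw leq_addr.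
  by rewrite -(cat_take_drop t w) h // hlt.
rewrite prob_cat; apply: prob_ext => w sw; rewrite -[RHS](@prob_cst R j).
by apply: prob_ext => v _; rewrite h.
Qed.

Lemma outcome_exec c s s' m k t q : exec c s s' m -> outcome (k, s') t q ->
  outcome (c :: k, s) (m + t) q.
Proof.
move=> ex [hlt <-].
have h w v : size w = m -> foldl step (c :: k, s) (w ++ v) = foldl step (k, s') v.
  by move=> sw; rewrite foldl_cat ex.
split=> [w sw|].
  rewrite -(cat_take_drop m w) h; last by rewrite size_takel // sw leq_addr.
  by apply: hlt; rewrite size_drop sw addKn.
rewrite prob_cat -[RHS](@prob_cst R m); apply: prob_ext => w sw.
by apply: prob_ext => v _; rewrite h.
Qed.

Lemma outcome_flip cf t q1 q2 : outcome (step cf true) t q1 -> outcome (step cf false) t q2 ->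
  outcome cf t.+1 ((q1 + q2) / 2).
Proof.
move=> [h1 <-] [h2 <-]; split=> // -[|[] w] // [sw]; [exact: h1|exact: h2].
Qed.

Lemma outcome_step cf cf' t q : (forall b, step cf b = cf') -> outcome cf' t q ->
  outcome cf t.+1 q.
Proof.
move=> st o; have -> : q = (q + q) / 2 by lra.
by apply: outcome_flip; rewrite st.
Qed.

Lemma prob_mid h (f f' : bitseq -> R) :
  prob h (fun w => (f w + f' w) / 2) = (prob h f + prob h f') / 2.
Proof. by elim: h f f' => //= h IH f f'; rewrite !IH; lra. Qed.

Lemma prob_rcons h (f : bitseq -> R) :
  prob h.+1 f = (prob h (fun w => f (rcons w true)) + prob h (fun w => f (rcons w false))) / 2.
Proof.
rewrite -prob_mid -addn1 prob_cat; apply: prob_ext => w _ /=; by rewrite !cats1.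
Qed.

(** The tape is built by pushing, so its bits are read in the reverse of the order in which they are
    tossed. *)
Lemma prob_rev h (f : bitseq -> R) : prob h (fun w => f (rev w)) = prob h f.
Proof.
elim: h f => [|h IH] f; first by [].
rewrite [RHS]prob_rcons -(IH (fun w => f (rcons w true))) -(IH (fun w => f (rcons w false))) /=.
by congr ((_ + _) / 2); apply: prob_ext => w _; rewrite rev_cons.
Qed.

Lemma prob_affine h (f : bitseq -> R) (c c' : R) :
  prob h (fun w => c + c' * f w) = c + c' * prob h f.
Proof. by elim: h f => //= h IH f; rewrite !IH; lra. Qed.

End Acceptance.

Definition toss : cmd := Seq (SetTl vI vI) (Seq (Flip vB) (SetNode vTAPE vB vTAPE)).

(** With all coins tossed beforehand, the trial itself falls under the deterministic calculus
    [wp]. *)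
Definition toss_tape : cmd := Seq (SetLeaf vTAPE) (Seq (Copy vI vTL) (While vI toss)).

(** A leaf in [vRES] means that no clause is falsified; then the answer is set and the counter is
    cleared to leave the loop. *)
Definition attempt (c : cmd) : cmd :=
  Seq (SetTl vCNT vCNT) (Seq toss_tape (Seq c
    (If vRES (Copy 0 0) (Seq (SetNode vANS vANS vANS) (SetLeaf vCNT))))).

Definition main (init c : cmd) : cmd := Seq init (While vCNT (attempt c)).

Section Main.
Variables (L0 d : nat).
Variables (n : nat) (F : cnf n).

Notation enc_lits := (enc_seq (@enc_literal n)).
Notation enc_vars := (enc_seq (fun x : 'I_n => enc_nat x)).
Notation enc_bits := (enc_seq enc_bool).

Local Open Scope ring_scope.
Variable R : realFieldType.
Local Notation outcome := (@outcome R).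
Implicit Types (s : store) (k : seq cmd).

Lemma outcome_toss s k j (t : bitseq) T (f : bitseq -> R) :
  s vI = enc_nat j -> s vTAPE = enc_bits t ->
  (forall w s', size w = j -> s' vTAPE = enc_bits (catrev w t) ->
     (forall y, y \notin [:: vI; vB; vTAPE] -> s' y = s y) -> outcome (k, s') T (f w)) ->
  outcome (While vI toss :: k, s) (6 * j + 1 + T) (prob j f).
Proof.
elim: j t f s => [|j IH] t f s sI sT o.
  by apply: outcome_step => [b|]; [rewrite /step sI|apply: (o [::] s)].
have -> : (6 * j.+1 + 1 + T)%N = (6 * j + 1 + T).+4.+2 by lia.
do 4! (apply: outcome_step => [b|]; [rewrite /= ?sI /=; reflexivity|]).
have tail b : outcome (SetNode vTAPE vB vTAPE :: While vI toss :: k,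
    update (update s vI (enc_nat j)) vB (enc_bool b)) (6 * j + 1 + T).+1
    (prob j (fun w => f (b :: w))).
  apply: outcome_step => [b'|]; [rewrite /=; reflexivity|].
  apply: (IH (b :: t)); rewrite /update //= ?sT // => w s' sw sT' fr.
  apply: (o (b :: w)) => //=; first by rewrite sw.
  move=> y yn; rewrite fr //; move: yn; rewrite !inE !negb_or.
  by case/and3P => /negbTE-> /negbTE-> /negbTE->.
by apply: outcome_flip; [apply: tail true|apply: tail false].
Qed.

Definition prepared s : Prop :=
  [/\ s vF = enc_seq enc_lits F, s vVARS = enc_vars (enum 'I_n), s vN = enc_nat n,
      s vH = enc_nat (n + L0) & s vTL = enc_nat (n * (n + L0).+1)] /\ s vANS = Leaf.

Variable tp : acmd.
Hypothesis wp_tp : forall s tape, prepared s -> s vTAPE = enc_bits tape ->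
  size tape = (n * (n + L0).+1)%N ->
  wp s tp (fun s' => ~~ is_leaf (s' vRES) = ~~ trial F d (n + L0) tape).
Hypothesis writes_tp : forall y, y \in [:: vF; vVARS; vN; vH; vTL; vANS; vCNT] ->
  y \notin writes tp.

Definition attempt_time (M : nat) : nat := (20 + 6 * M + cost tp)%N.

Definition success_prob : R :=
  prob (n * (n + L0).+1) (fun w => (trial F d (n + L0) w)%:R).

(** A failed attempt leaves the store prepared, so the rest accepts with probability [q']; a
    successful one accepts. The value of a tape is thus affine in the indicator of success, and
    [prob_affine] averages it. *)
Lemma outcome_loop c s : prepared s -> s vCNT = enc_nat c ->
  outcome ([:: While vCNT (attempt (erase tp))], s) (c * attempt_time (n * (n + L0).+1) + 1)
    (1 - (1 - success_prob) ^+ c).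
Proof.
set M := (n * (n + L0).+1)%N; set TB := attempt_time M.
elim: c s => [|c IH] s ps sC.
  apply: outcome_step => [b|]; first by rewrite /= sC /=; reflexivity.
  split=> [[]//|]; rewrite /= /accepting /= expr0 subrr.
  by have [_ ->] := ps.
have [[sF sV sN sH sTL] sA] := ps.
pose q' : R := 1 - (1 - success_prob) ^+ c.
have -> : 1 - (1 - success_prob) ^+ c.+1 = q' + (1 - q') * success_prob.
  by rewrite /q' exprS; ring.
rewrite /success_prob -(prob_rev _ (fun w => (trial F d (n + L0) w)%:R)) -prob_affine.
apply: (@outcome_leq _ _
  (6 * M + 1 + (cost tp + (c * TB + 1).+4.+1).+1).+4.+4).
  by rewrite /TB /attempt_time; lia.
do 8! (apply: outcome_step => [b|]; [rewrite /= ?sC /=; reflexivity|]).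
apply: (@outcome_toss _ _ M [::]) => [|//|w s1 sw sT1 fr1]; first by rewrite /update /= sTL.
have fw y : y \notin [:: vI; vB; vTAPE; vCNT] -> s1 y = s y.
  rewrite !inE !negb_or => /and4P[y1 y2 y3 y4].
  rewrite fr1 ?inE ?negb_or ?y1 ?y2 ?y3 // /update.
  by rewrite (negbTE y1) (negbTE y3) (negbTE y4).
have C1 : s1 vCNT = enc_nat c by rewrite fr1.
apply: outcome_step => [b|]; [rewrite /=; reflexivity|].
have [s2 [m [mt ex e2 fr2]]] : wp s1 tp
    (fun s' => ~~ is_leaf (s' vRES) = ~~ trial F d (n + L0) (rev w)).
  apply: wp_tp => //; last by rewrite size_rev.
    by rewrite /prepared !fw.
apply: (@outcome_leq _ _ (m + (c * TB + 1).+4.+1)); first by rewrite leq_add2r.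
apply: (outcome_exec ex).
have fw2 y : y \in [:: vF; vVARS; vN; vH; vTL; vANS] -> s2 y = s y.
  move=> yin; rewrite fr2.
    by apply: fw; move: y yin; apply/allP.
  by apply: writes_tp; move: y yin; apply/allP.
have C2 : s2 vCNT = enc_nat c by rewrite fr2 ?writes_tp.
apply: outcome_step => [b|]; [rewrite /=; reflexivity|].
move: e2; case: (trial _ _ _ _) => /= [/negbFE|/negbTE] ->; last first.
  rewrite mulr0 addr0.
  apply: outcome_step => [b|]; [rewrite /=; reflexivity|].
  apply: (@outcome_leq _ _ (c * TB + 1)); first by lia.
  by apply: IH; rewrite ?update_id // /prepared !fw2.
rewrite mulr1 addrC subrK.
do 4! (apply: outcome_step => [b|]; [rewrite /= /update /=; reflexivity|]).
apply: (@outcome_leq _ _ 0) => //.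
by split=> [[]//|].
Qed.

End Main.

(** * A successful trial exhibits a satisfying assignment *)

Section Soundness.
Variables (n : nat) (F : cnf n) (d h : nat).
Implicit Types (a : seq ('I_n * bool)) (x : 'I_n).

Lemma ppsz_sub k rem a tape l : l \in a -> l \in ppsz F d h k rem a tape.
Proof.
elim: k rem a tape => //= k IH rem a tape la; case: drop => // x rest.
by apply: IH; rewrite inE la orbT.
Qed.

Lemma ppsz_total k rem a tape x : size rem = k -> x \in rem ->
  exists b, (x, b) \in ppsz F d h k rem a tape.
Proof.
elim: k rem a tape => [|k IH] rem a tape sr; first by rewrite (size0nil sr).
move=> xr; rewrite /=; case E : (drop _ rem) => [|y rest].
  have := size_drop (position (size rem) (take h tape)) rem; rewrite E position_modn sr /=.
  by have := ltn_pmod (bits_num (take h tape)) (ltn0Sn k); lia.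
have [<-|xy] := eqVneq y x.
  rewrite /next_false_lit; set l := (X in X :: a).
  exists l.2; apply: ppsz_sub; rewrite inE; apply/orP; left; apply/eqP.
  by rewrite /l; case: ifP => //; case: ifP.
apply: IH.
  have := f_equal size E; rewrite size_drop catrevE size_cat size_rev size_take_min /= sr.
  by move: (position _ _) (size rest) => u r; lia.
move: xr; rewrite -{1}(cat_take_drop (position (size rem) (take h tape)) rem) E catrevE.
by rewrite !mem_cat mem_rev inE eq_sym (negbTE xy).
Qed.

(** By [ppsz_total] every variable has a literal in the final list. A clause with a literal outside
    the list is satisfied there, because the opposite literal is listed. *)
Lemma trial_sound tape : trial F d h tape -> satisfiable F.
Proof.
rewrite /trial; set a := ppsz _ _ _ _ _ _ _ => nr.
apply/existsP; exists [ffun x => (x, false) \in a].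
apply/allP => C CF; have := hasPn nr C CF => /allPn[[x b] lC la].
apply/hasP; exists (x, b) => //; have {}la : (x, b) \notin a := la; rewrite /lit_true ffunE /=.
case: b lC la => _ la; last by rewrite (negbTE la).
have [b] := ppsz_total [::] tape (size_enum_ord n) (mem_enum 'I_n x).
by case: b => xa; [rewrite xa in la|rewrite /a xa].
Qed.

End Soundness.

Definition num_clauses (n : nat) : nat := \sum_(i < 5) (n * 2) ^ i.

Lemma size_kcnf n (F : cnf n) : is_kcnf 4 F -> size F <= num_clauses n.
Proof.
move=> /andP[uF /allP F4].
pose all_clauses := flatten [seq [seq (val t : seq ('I_n * bool)) |
  t : i.-tuple ('I_n * bool)] | i <- iota 0 5].
have -> : num_clauses n = size all_clauses.
  rewrite size_flatten /shape -map_comp sumnE big_map -[iota 0 5]/(index_iota 0 5) big_mkord.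
  by apply: eq_bigr => i _; rewrite /= size_image card_tuple card_prod card_ord card_bool.
apply: uniq_leq_size uF _ => C /F4 /andP[_ sC].
apply/flattenP; exists [seq (val t : seq ('I_n * bool)) | t : (size C).-tuple ('I_n * bool)].
  by apply/mapP; exists (size C) => //; rewrite mem_iota.
by apply/imageP; exists (in_tuple C).
Qed.

(** * Counting coin sequences and amplification *)

Section Assembly.
Local Open Scope ring_scope.
Variable R : realFieldType.

Lemma prob_sum t (f : bitseq -> R) :
  prob t f = (\sum_(w : t.-tuple bool) f w) / 2 ^+ t.
Proof.
elim: t f => [|t IH] f /=.
  by rewrite (big_pred1 [tuple]) ?divr1 // => w; apply/esym/eqP; exact: tuple0.
rewrite !IH (reindex (fun bw : bool * t.-tuple bool => cons_tuple bw.1 bw.2)) /=; last first.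
  exists (fun w => (thead w, behead_tuple w)) => [[b w] _|w _] /=.
    by rewrite theadE; congr pair; apply: val_inj.
  by rewrite [RHS]tuple_eta; apply: val_inj.
rewrite -(pair_bigA _ (fun b (w : t.-tuple bool) => f (b :: w))) /= big_bool /= exprS.
by field; rewrite expf_neq0 // pnatr_eq0.
Qed.

Lemma prob_card t (P : bitseq -> bool) :
  prob t (fun w => (P w)%:R) = #|[set w : t.-tuple bool | P w]|%:R / 2 ^+ t :> R.
Proof.
rewrite prob_sum -sum1_card natr_sum [in RHS]big_mkcond /=; congr (_ / _).
by apply: eq_bigr => w _; rewrite inE; case: P.
Qed.

Lemma prob_eq0 t (f : bitseq -> R) w : (forall v, 0 <= f v) -> size w = t ->
  prob t f = 0 -> f w = 0.
Proof.
elim: t f w => [|t IH] f [|b w] //= f0 [sw] e.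
have g0 c : 0 <= prob t (fun v => f (c :: v)) by apply: prob_ge0.
apply: (IH (fun v => f (b :: v))) => //.
by have := g0 true; have := g0 false; case: b; lra.
Qed.

(** Every tape of length [t] has positive weight, so none accepts. Halted runs stay put, so a
    shorter accepting tape could be extended to length [t], and a longer tape is decided by its
    first [t] bits. *)
Lemma outcome0 cf t w : outcome cf t (0 : R) -> ~~ accepting (foldl step cf w).
Proof.
move=> [hlt p0]; have acc v : size v = t -> ~~ accepting (foldl step cf v).
  move=> sv; have := prob_eq0 (fun v => ler0n R _) sv p0.
  by case: accepting => // /eqP; rewrite oner_eq0.
have [wt|/ltnW tw] := leqP (size w) t.
  apply: contraL (acc (w ++ nseq (t - size w) true) _); last by rewrite size_cat size_nseq subnKC.
  by rewrite foldl_cat => aw; rewrite step_halted ?aw //; case/andP: aw.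
have st : size (take t w) = t by rewrite size_takel.
by rewrite -(cat_take_drop t w) foldl_cat step_halted ?acc ?hlt.
Qed.

(** The product of [(1 - sp) ^+ c] and [(1 + sp) ^+ c] is at most 1, and the second factor is at
    least 2 by Bernoulli's inequality. *)
Lemma exp_half (sp : R) c : 0 <= sp <= 1 -> 1 <= c%:R * sp -> (1 - sp) ^+ c <= 1 / 2.
Proof.
move=> /andP[s0 s1] cs.
have bern : 1 + c%:R * sp <= (1 + sp) ^+ c.
  elim: c {cs} => [|c IH]; first by rewrite mul0r addr0.
  rewrite exprS -natr1; have : (1 + sp) * (1 + c%:R * sp) <= (1 + sp) * (1 + sp) ^+ c.
    by rewrite ler_wpM2l // addr_ge0.
  have : 0 <= c%:R * sp * sp by rewrite !mulr_ge0.
  lra.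
have le1 : (1 - sp) ^+ c * (1 + sp) ^+ c <= 1.
  rewrite -exprMn exprn_ile1 //.
    by rewrite mulr_ge0 ?subr_ge0 ?addr_ge0.
  have : 0 <= sp * sp by rewrite mulr_ge0.
  lra.
have x0 : 0 <= (1 - sp) ^+ c by rewrite exprn_ge0 ?subr_ge0.
have : (1 - sp) ^+ c * 2 <= (1 - sp) ^+ c * (1 + sp) ^+ c.
  by rewrite ler_wpM2l // (le_trans _ bern) //; lra.
lra.
Qed.

End Assembly.

(** * The complete program *)

Section Program.
Variables (L0 d p q : nat).

(** Erasure drops the loop bounds, so [0] may stand for all of them; [ppsz_cmdE] recovers the same
    program from bounds that depend on [n]. *)
Definition ppsz_cmd : cmd :=
  main (erase (init_prog 0 0 0 L0 p q)) (erase (trial_prog 0 0 0 0 d)).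

Lemma erase_refute bn bm bk : erase (refute bn bm bk d) = erase (refute 0 0 0 d).
Proof. by elim: d => //= d' ->. Qed.

Definition ppsz_init (n : nat) : acmd :=
  init_prog n (n + L0) (growth_bound p q n) L0 p q.

Definition ppsz_trial (n : nat) : acmd :=
  trial_prog n (num_clauses n) (n + d) (n + L0) d.

Lemma ppsz_cmdE n : ppsz_cmd = main (erase (ppsz_init n)) (erase (ppsz_trial n)).
Proof. by rewrite /ppsz_cmd /ppsz_trial /= !erase_refute. Qed.

Lemma writes_ppsz_trial n y : y \in [:: vF; vVARS; vN; vH; vTL; vANS; vCNT] ->
  y \notin writes (ppsz_trial n).
Proof.
move=> yin; have y40 : y < 40 by move: y yin; apply/allP.
have yt : y \notin trial_globals by move: y yin {y40}; apply/allP.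
have -> : writes (ppsz_trial n) = [:: vA; vREM; vSTEP] ++
    (writes (trial_step n (num_clauses n) (n + d) (n + L0) d) ++
     writes (falsified n (num_clauses n) (n + d))) by [].
rewrite mem_cat negb_or; apply/andP; split; first by move: y yin {y40 yt}; apply/allP.
rewrite mem_cat negb_or; apply/andP; split; first exact: notin_trial_step.
by move: y yin {y40 yt}; apply/allP.
Qed.

Definition ppsz_time (n : nat) : nat :=
  (cost (ppsz_init n) +
   (growth_bound p q n * attempt_time (ppsz_trial n) (n * (n + L0).+1) + 1)).+1.

Hypothesis p_gt0 : 0 < p.
Hypothesis q_gt0 : 0 < q.
Hypothesis q_le_p : q <= p.

Lemma growth_bound_mono k k' : k <= k' -> growth_bound p q k <= growth_bound p q k'.
Proof.
move=> /subnK <-; elim: (k' - k) => // j IH; apply: leq_trans IH _; rewrite addSn /=.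
rewrite -[X in X <= _](mulnK _ q_gt0); apply: leq_trans (leq_addr _ _).
by apply: leq_div2r; rewrite mulnC leq_mul2r q_le_p orbT.
Qed.

Variables (n : nat) (F : cnf n).
Hypothesis F4 : is_kcnf 4 F.

Lemma outcome_ppsz (R : realFieldType) : exists2 c, p ^ n <= q ^ n * c &
  outcome (init ppsz_cmd (enc_cnf F)) (ppsz_time n)
    (1 - (1 - success_prob L0 d F R) ^+ c)%R.
Proof.
have Fall : all (fun C : seq ('I_n * bool) => size C <= 4) F.
  by case/andP: F4 => _; apply: sub_all => C /andP[].
have F_bm := size_kcnf F4.
rewrite (ppsz_cmdE n) /init; set s0 := update _ _ _.
have : wp s0 (ppsz_init n) (fun s => prepared L0 F s /\ exists c,
    [/\ s vCNT = enc_nat c, p ^ n <= q ^ n * c & c <= growth_bound p q n]).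
  apply: wp_seq; apply: wp_conseq; first exact: (@wp_init_vars n n F (leqnn n) s0 erefl).
  move=> s1 [N1 F1 A1 V1] fr1.
  apply: wp_seq; apply: wp_conseq; first exact: (wp_init_tape (leqnn n) (leqnn _) N1).
  have w1 y : y \in [:: vN; vF; vANS; vVARS] -> y \notin writes (init_tape n (n + L0) L0).
    by rewrite !inE => /or4P[] /eqP->; rewrite /= !mem_cat; notin.
  move=> s2 [H2 TL2] fr2.
  apply: wp_conseq.
    apply: (wp_init_count (leqnn n) p_gt0 q_gt0 (@growth_bound_mono ^~ n)).
    by rewrite fr2 ?w1.
  move=> s3 C3 fr3; split=> //.
  have w2 y : y \in [:: vN; vF; vANS; vVARS] ++ [:: vH; vTL] ->
      y \notin writes (init_count n (growth_bound p q n) p q).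
    by rewrite !inE => /or4P[|||/or3P[]] /eqP->; rewrite /= !mem_cat; notin.
  by rewrite /prepared !fr3 ?w2 // H2 TL2 !fr2 ?w1 // F1 V1 N1 A1.
case=> s1 [m [mt ex [ps [c [C1 c1 c2]]] _]]; exists c => //.
apply: (@outcome_leq _ _ (m + (c * attempt_time (ppsz_trial n) (n * (n + L0).+1) + 1)).+1).
  by rewrite ltnS leq_add // leq_add2r leq_mul2r c2 orbT.
apply: (@outcome_step _ _
  ([:: erase (ppsz_init n); While vCNT (attempt (erase (ppsz_trial n)))], s0)) => //.
apply: (outcome_exec ex); apply: outcome_loop => //.
  move=> s tape [[sF sV sN sH sTL] sA] sT szT.
  exact: wp_trial_prog.
exact: writes_ppsz_trial.
Qed.

End Program.

Local Open Scope ring_scope.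

(** * Growth rates *)

Section Growth.

(* [f n = O(c ^ n)] for all [c > a]. *)
Definition subexp (a : R) (f : nat -> nat) : Prop :=
  forall c : R, a < c -> exists C : R, 0 <= C /\ forall n, (f n)%:R <= C * c ^+ n.

Lemma subexp_cst (m : nat) : subexp 1 (fun=> m).
Proof.
move=> c c1; exists m%:R; split=> // n.
by rewrite ler_peMr // exprn_ege1 // ltW.
Qed.

Lemma subexpD a f g : subexp a f -> subexp a g -> subexp a (fun n => f n + g n)%N.
Proof.
move=> hf hg c ac; have [C [C0 hC]] := hf c ac; have [D [D0 hD]] := hg c ac.
by exists (C + D); split=> [|n]; rewrite ?addr_ge0 // natrD mulrDl lerD.
Qed.

Lemma subexp_weaken a f : 1 <= a -> subexp 1 f -> subexp a f.
Proof. by move=> a1 hf c ac; apply: hf; apply: le_lt_trans ac. Qed.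

(** With [s] the square root of [c / a], the factorization [c = s * (a * s)] leaves room for both
    factors. *)
Lemma subexpM a f g : 1 <= a -> subexp 1 f -> subexp a g -> subexp a (fun n => f n * g n)%N.
Proof.
move=> a1 hf hg c ac.
have a0 : 0 < a by apply: lt_le_trans a1.
pose s := Num.sqrt (c / a).
have ca : 1 < c / a by rewrite ltr_pdivlMr // mul1r.
have ss : s * s = c / a by rewrite -expr2 sqr_sqrtr // ltW // (lt_trans _ ca).
have s0 : 0 <= s by apply: sqrtr_ge0.
have s1 : 1 < s.
  rewrite ltNge; apply/negP => sle; have : s * s <= 1 * 1 by apply: ler_pM.
  by rewrite ss mulr1 leNgt ca.
have [C [C0 hC]] := hf s s1.
have [D [D0 hD]] : exists D : R, 0 <= D /\ forall n, (g n)%:R <= D * (a * s) ^+ n.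
  by apply: hg; rewrite ltr_pMr.
exists (C * D); split=> [|n]; first exact: mulr_ge0.
rewrite natrM; apply: le_trans (ler_pM _ _ (hC n) (hD n)) _ => //.
have sas : s * (a * s) = c by rewrite mulrCA ss mulrC divfK ?lt0r_neq0.
by rewrite mulrACA -exprMn sas.
Qed.

Lemma subexp_id : subexp 1 (fun n => n).
Proof.
move=> c c1; have c1' : 0 < c - 1 by rewrite subr_gt0.
exists (c - 1)^-1; split=> [|n]; first by rewrite invr_ge0 ltW.
rewrite mulrC ler_pdivlMr //.
elim: n => [|n IH]; first by rewrite mul0r expr0.
rewrite exprS -natr1; have : 0 <= (c - 1) * (c ^+ n - 1).
  by rewrite mulr_ge0 ?subr_ge0 ?exprn_ege1 // ltW.
lra.
Qed.

Lemma subexpMr a f g : 1 <= a -> subexp a f -> subexp 1 g -> subexp a (fun n => f n * g n)%N.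
Proof.
move=> a1 hf hg; have := subexpM a1 hg hf.
by congr subexp; apply: functional_extensionality => n; rewrite mulnC.
Qed.

Lemma subexpS a f : 1 <= a -> subexp a f -> subexp a (fun n => (f n).+1).
Proof.
move=> a1 hf; have := subexpD hf (subexp_weaken a1 (subexp_cst 1)).
by congr subexp; apply: functional_extensionality => n; rewrite addn1.
Qed.

Lemma subexp_double f : subexp 1 f -> subexp 1 (fun n => (f n).*2).
Proof.
move=> hf; have := subexpD hf hf.
by congr subexp; apply: functional_extensionality => n; rewrite addnn.
Qed.

Lemma subexpM1 f g : subexp 1 f -> subexp 1 g -> subexp 1 (fun n => f n * g n)%N.
Proof. exact: subexpM. Qed.

Ltac subexp_auto := repeat first
  [ apply: subexp_cst | apply: subexp_id | apply: subexpD | apply: subexpM1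
  | apply: (subexpS (lexx 1)) | apply: subexp_double ].

Lemma subexp_sum (I : Type) (r : seq I) (f : I -> nat -> nat) :
  (forall i, subexp 1 (f i)) -> subexp 1 (fun n => \sum_(i <- r) f i n)%N.
Proof.
move=> hf; elim: r => [|i r IH].
  have := subexp_cst 0; congr subexp; apply: functional_extensionality => n; by rewrite big_nil.
have := subexpD (hf i) IH; congr subexp; apply: functional_extensionality => n.
by rewrite big_cons.
Qed.

Lemma subexp_num_clauses : subexp 1 num_clauses.
Proof.
apply: subexp_sum => i; elim: (i : nat) => [|k IH]; first exact: subexp_cst.
have : subexp 1 (fun n => (n * 2) * (n * 2) ^ k)%N by apply: subexpM1 => //; subexp_auto.
by congr subexp; apply: functional_extensionality => n; rewrite expnS.
Qed.

Variables (L0 d p q : nat).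
Hypothesis q_gt0 : (0 < q)%N.
Hypothesis q_lt_p : (q < p)%N.
Let a : R := p%:R / q%:R.

Lemma subexp_refute : subexp 1 (fun n => cost (refute n (num_clauses n) (n + d) d)).
Proof.
have : forall k, subexp 1 (fun n => cost (refute n (num_clauses n) (n + d) k)).
  elim=> [|k IH] /=; first by subexp_auto; apply: subexp_num_clauses.
  by subexp_auto.
exact.
Qed.

Lemma subexp_ppsz_trial : subexp 1 (fun n => cost (ppsz_trial L0 d n)).
Proof.
rewrite /ppsz_trial /=; subexp_auto; (apply: subexp_refute || apply: subexp_num_clauses).
Qed.

(** A step is at most [v := a * v + p]; adding the constant [p / (a - 1)] turns this into
    multiplication by [a]. *)
Lemma growth_bound_le n : (growth_bound p q n)%:R <= (1 + p%:R / (a - 1)) * a ^+ n.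
Proof.
have q0 : 0 < q%:R :> R by rewrite ltr0n.
have a1 : 0 < a - 1 by rewrite subr_gt0 /a ltr_pdivlMr // mul1r ltr_nat.
suff H : (growth_bound p q n)%:R + p%:R / (a - 1) <= (1 + p%:R / (a - 1)) * a ^+ n.
  by apply: le_trans H; rewrite lerDl divr_ge0 // ltW.
elim: n => [|n IH]; first by rewrite expr0 mulr1.
rewrite exprS [growth_bound _ _ _]/= natrD.
have h1 : (p * growth_bound p q n %/ q)%:R <= a * (growth_bound p q n)%:R.
  rewrite /a mulrAC ler_pdivlMr // -!natrM ler_nat; exact: leq_trunc_div.
have h2 : p%:R / (a - 1) + p%:R = a * (p%:R / (a - 1)) :> R.
  by field; rewrite lt0r_neq0.
have h3 : a * ((growth_bound p q n)%:R + p%:R / (a - 1)) <= a * ((1 + p%:R / (a - 1)) * a ^+ n).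
  by rewrite ler_wpM2l // /a divr_ge0.
lra.
Qed.

Lemma rate_ge1 : 1 <= a.
Proof. by rewrite /a ler_pdivlMr ?ltr0n // mul1r ler_nat ltnW. Qed.

Lemma subexp_growth_bound : subexp a (growth_bound p q).
Proof.
have a1 := rate_ge1; have q0 : 0 < q%:R :> R by rewrite ltr0n.
have a1' : 0 < a - 1 by rewrite subr_gt0 /a ltr_pdivlMr // mul1r ltr_nat.
move=> c ac; exists (1 + p%:R / (a - 1)); split=> [|n].
  by rewrite addr_ge0 // divr_ge0 // ltW.
apply: le_trans (growth_bound_le n) _; apply: ler_wpM2l.
  by rewrite addr_ge0 // divr_ge0 // ltW.
have a0 : 0 <= a := le_trans ler01 a1.
by apply: lerXn2r; rewrite ?nnegrE // ?(le_trans a0) // ltW.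
Qed.

Lemma subexp_ppsz_time : subexp a (ppsz_time L0 d p q).
Proof.
have a1 := rate_ge1; have gb := subexp_growth_bound.
apply: subexpS => //; apply: subexpD; last first.
  apply: subexpD; last by apply: (subexp_weaken a1); subexp_auto.
  apply: subexpMr => //; rewrite /attempt_time.
  by apply: subexpD; [subexp_auto|exact: subexp_ppsz_trial].
rewrite /ppsz_init /=; repeat first
  [ (apply: (subexp_weaken a1); solve [subexp_auto]) | apply: subexpD | apply: (subexpS a1)
  | (apply: (subexpMr a1 gb); solve [subexp_auto]) | apply: (subexpM a1 subexp_id) ].
Qed.

End Growth.

(** * Powers of two with real exponents and the numerical comparison *)

Definition pow2 (s : R) : R := exp (Rmult (ln 2) s).

Lemma pow2D s t : pow2 (s + t) = pow2 s * pow2 t.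
Proof. by rewrite /pow2 Rmult_plus_distr_l exp_plus. Qed.

Lemma pow2_1 : pow2 1 = 2.
Proof. by rewrite /pow2 Rmult_1_r exp_ln //; apply: Rlt_0_2. Qed.

Lemma pow2_gt0 s : 0 < pow2 s.
Proof. by apply/RltP; apply: exp_pos. Qed.

Lemma pow2X s k : pow2 (s *+ k) = pow2 s ^+ k.
Proof.
elim: k => [|k IH]; first by rewrite mulr0n expr0 /pow2 Rmult_0_r exp_0.
by rewrite mulrS pow2D IH exprS.
Qed.

Lemma ln2_itv : 0 <= (ln 2 : R) <= 1.
Proof.
apply/andP; split; apply/RleP.
  by have := ln_increasing 1 2 Rlt_0_1 (Rlt_plus_1 1); rewrite ln_1; apply: Rlt_le.
case: (Rle_or_lt (ln 2) 1) => // /exp_increasing; rewrite exp_ln; last exact: Rlt_0_2.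
have := exp_ineq1_le 1 => /Rle_not_lt; tauto.
Qed.

Lemma pow2_convex (s t : R) : pow2 (- t) * (1 - ln 2 * (s - t)) <= pow2 (- s).
Proof.
have -> : - s = - t + - (s - t) by ring.
rewrite pow2D ler_wpM2l ?(ltW (pow2_gt0 _)) //.
have := exp_ineq1_le (ln 2 * - (s - t)) => /RleP; rewrite -/(pow2 _).
by rewrite ?RplusE ?RmultE ?R1E ?RoppE mulrN.
Qed.

Lemma pow2_opp s : pow2 (- s) = (pow2 s)^-1.
Proof.
apply: (mulfI (lt0r_neq0 (pow2_gt0 s))); rewrite divff ?lt0r_neq0 ?pow2_gt0 //.
by rewrite -pow2D subrr -(mulr0n 0) pow2X expr0.
Qed.

(* Fixed-point powers, rounded down: [m / D <= b] implies [low_power D m k / D <= b ^ k]. *)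
Fixpoint low_power (D m : Z) (k : positive) : Z :=
  match k with
  | xH => m
  | xO k' => let v := low_power D m k' in Z.div (Z.mul v v) D
  | xI k' => let v := low_power D m k' in Z.div (Z.mul (Z.div (Z.mul v v) D) m) D
  end.

Lemma low_power_le (D m : Z) (b : R) k : Z.lt 0 D -> Z.le 0 m -> 0 <= b ->
  IZR m <= IZR D * b ->
  Z.le 0 (low_power D m k) /\ IZR (low_power D m k) <= IZR D * b ^+ Pos.to_nat k.
Proof.
move=> D0 m0 b0 mb; have DR : 0 < IZR D :> R by apply/RltP/IZR_lt.
have low u v (x y : R) : Z.le 0 u /\ IZR u <= IZR D * x -> Z.le 0 v /\ IZR v <= IZR D * y ->
    0 <= x -> Z.le 0 (Z.div (Z.mul u v) D) /\ IZR (Z.div (Z.mul u v) D) <= IZR D * (x * y).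
  move=> [u0 ux] [v0 vy] x0; split; first by apply: Z.div_pos => //; apply: Z.mul_nonneg_nonneg.
  rewrite -(ler_pM2l DR); apply: (@le_trans _ _ (IZR u * IZR v)).
    rewrite -!RmultE -!mult_IZR; apply/RleP/IZR_le; exact: Z.mul_div_le.
  have -> : IZR D * (IZR D * (x * y)) = (IZR D * x) * (IZR D * y) by ring.
  by apply: ler_pM => //; apply/RleP/IZR_le.
elim: k => [k IH|k IH|] /=; last by rewrite expr1.
  rewrite Pos2Nat.inj_xI multE mul2n -addnn exprSr exprD.
  by apply: (low) => //; [apply: (low) => //; rewrite exprn_ge0|rewrite mulr_ge0 ?exprn_ge0].
rewrite Pos2Nat.inj_xO multE mul2n -addnn exprD.
by apply: low => //; rewrite exprn_ge0.
Qed.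

(* [420 / 757] is a rational between [rho_int 1] and [log 1.46899 / log 2]. *)
Lemma pow2_lt : pow2 (420 / 757) < Rdiv (IZR 146899) (IZR 100000).
Proof.
set b : R := Rdiv _ _; have b0 : 0 <= b.
  by rewrite /b RdivE divr_ge0 //; apply/RleP/IZR_le.
rewrite ltNge; apply/negP => le.
(* Forty fractional bits are precise enough to see [2 ^+ 420 < b ^+ 757] with all roundings
   downwards. *)
pose D := Z.pow 2 40; pose m := Z.div (Z.mul D 146899) 100000.
have DR : 0 < IZR D :> R by apply/RltP/IZR_lt.
have mb : IZR m <= IZR D * b.
  rewrite /b RdivE mulrA ler_pdivlMr; last by apply/RltP/IZR_lt.
  by rewrite -!RmultE -!mult_IZR; apply/RleP/IZR_le.
have m0 : Z.le 0 m by [].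
have [_] := low_power_le 757 (erefl : Z.lt 0 D) m0 b0 mb.
have -> : Pos.to_nat 757 = 757%N by [].
have b2 : b ^+ 757 <= 2 ^+ 420.
  have -> : 2 ^+ 420 = pow2 (420 / 757) ^+ 757.
    rewrite -pow2X -pow2_1 -pow2X; congr pow2.
    by rewrite -[RHS]mulr_natr divfK ?pnatr_eq0.
  by apply: lerXn2r => //; rewrite nnegrE ltW ?pow2_gt0.
rewrite -(ler_pM2l DR) in b2; move=> /le_trans /(_ b2).
rewrite -[2]/(IZR 2) -!RpowE !pow_IZR -RmultE -mult_IZR => /RleP /le_IZR.
by apply/Z.lt_nge; vm_compute.
Qed.

Lemma rational_between (u v : R) : 1 <= u -> u < v ->
  exists p q : nat, (0 < q < p)%N /\ u < p%:R / q%:R < v.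
Proof.
move=> u1 uv; have vu : 0 < v - u by rewrite subr_gt0.
pose q := (Num.trunc (v - u)^-1).+1; pose p := (Num.trunc (u * q%:R)).+1.
have q0 : 0 < q%:R :> R by rewrite ltr0n.
have qvu : 1 < q%:R * (v - u) by rewrite -ltr_pdivrMr // div1r truncnS_gt.
have pu : u * q%:R < p%:R by apply: truncnS_gt.
have pl : p%:R <= u * q%:R + 1.
  by rewrite /p -natr1 lerD2r truncn_le mulr_ge0 // (le_trans ler01).
exists p, q; split; last by rewrite ltr_pdivlMr // pu ltr_pdivrMr //; lra.
rewrite /= -(ltr_nat R); apply: le_lt_trans pu; by rewrite ler_peMl // ltW.
Qed.

Lemma pow2N_small (t : R) : 0 < t -> exists k : nat, (2 ^+ k)^-1 <= t.
Proof.
move=> t0; exists (Num.trunc t^-1).+1; rewrite -[leRHS]invrK lef_pV2 ?posrE ?invr_gt0 ?exprn_gt0 //.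
apply: ltW; apply: (lt_le_trans (truncnS_gt _)).
by rewrite -natrX ler_nat ltnW // ltn_expl.
Qed.

(** This is [prob_trial] with [pow2 (- s)] for [e s], [ln 2] for [l] and the bias [2 ^ - L0]. *)
Lemma success_prob_ge n (F : cnf n) d L0 (S : R) :
  1 / 2 <= S -> (forall (U : {set 'I_n}) g x, satisfies g F -> x \in U ->
    frozen F U g x -> frozen_cost F d R U g x <= S) ->
  satisfiable F -> ((1 - (2 ^+ L0)^-1) / pow2 S) ^+ n <= success_prob L0 d F R.
Proof.
move=> S2 frozen_cost_le sat; have [l0 l1] := andP ln2_itv.
have e_half (s : R) : pow2 (- (s + 1)) = pow2 (- s) / 2.
  by rewrite opprD pow2D pow2_opp (pow2_opp 1) pow2_1 -pow2_opp.
have e_ge0 (s : R) : 0 <= pow2 (- s) by rewrite ltW ?pow2_gt0.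
have e0 : pow2 (- 0) <= 1 by rewrite pow2_opp -(mulr0n 0) pow2X expr0 invr1.
have de1 : (2 ^+ L0)^-1 <= 1 :> R by rewrite invf_le1 ?exprn_gt0 // exprn_ege1 // ler1n.
have nle : n%:R <= (2 ^+ L0)^-1 * 2 ^+ (n + L0) :> R.
  by rewrite exprD mulrCA mulVf ?expf_neq0 ?pnatr_eq0 // mulr1 -natrX ler_nat ltnW // ltn_expl.
have := prob_trial S2 frozen_cost_le e_half pow2_convex e_ge0 e0 l0 l1 de1 nle sat.
apply: le_trans; rewrite exprMn ler_wpM2l ?exprn_ge0 ?subr_ge0 //.
by rewrite mulr_natl -mulNrn pow2X pow2_opp.
Qed.

Lemma success_prob_unsat n (F : cnf n) d L0 :
  ~~ satisfiable F -> success_prob L0 d F R = 0.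
Proof.
move=> unsat; rewrite -[RHS](@prob_cst R (n * (n + L0).+1)); apply: prob_ext => w _.
by case E : (trial F d (n + L0) w) => //; rewrite (trial_sound E) in unsat.
Qed.

Lemma success_prob01 n (F : cnf n) d L0 : 0 <= success_prob L0 d F R <= 1.
Proof.
apply/andP; split; first by apply: prob_ge0.
have := @prob_affine R (n * (n + L0).+1) (fun w => (trial F d (n + L0) w)%:R) 1 (-1).
rewrite -/(success_prob L0 d F R) => e.
suff : 0 <= 1 + -1 * success_prob L0 d F R by clear e; lra.
by rewrite -e {e}; apply: prob_ge0 => w; case: trial => /=; lra.
Qed.

Local Open Scope R_scope.

Theorem theorem2 :
  exists (p : cmd) (T : nat -> nat),
    runs_in_time_on_ksat 4 p T /\
    one_sided_error_ksat 4 p T /\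
    is_bigO (fun n => INR (T n)) (fun n => (146899 / 100000) ^ n).
Proof.
pose S : R := (420 / 757)%R.
have S2 : (1 / 2 <= S)%R by rewrite /S; lra.
have pow2S : (1 <= pow2 S)%R.
  have [l0 _] := andP ln2_itv.
  have := pow2_convex (- S) 0; rewrite pow2_opp -(mulr0n 0%R) pow2X expr0 invr1 mul1r opprK.
  apply: le_trans; rewrite mulr0n subr0 mulrN opprK lerDl mulr_ge0 //; rewrite /S; lra.
have [p [q [/andP[q0 qp] /andP[Sa ab]]]] := rational_between pow2S pow2_lt.
have p0 : (0 < p)%N by apply: ltn_trans qp.
set a : R := (p%:R / q%:R)%R in Sa ab.
have v0 := pow2_gt0 S; have a0 : (0 < a)%R by apply: lt_trans Sa.
(* [L0] is chosen such that [(1 - 2 ^ - L0) / pow2 S * a >= 1]: then [a ^+ n] trials have at least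
   one expected success. *)
have t0 : (0 < 1 - pow2 S / a)%R by rewrite subr_gt0 ltr_pdivrMr // mul1r.
have [L0 hL0] := pow2N_small t0.
have [d frozen_cost_le] := frozen_cost_bound.
exists (ppsz_cmd L0 (4 * d) p q), (ppsz_time L0 (4 * d) p q).
have out n (F : cnf n) (F4 : is_kcnf 4 F) := outcome_ppsz L0 (4 * d) p0 q0 (ltnW qp) F4 R.
split; [|split].
- move=> n F /out[c _ [hlt _]] w; apply: hlt; exact: size_tuple.
- move=> n F F4; have [c pc o] := out n F F4; split=> [unsat w|sat].
    apply: (@outcome0 R _ (ppsz_time L0 (4 * d) p q n) w).
    by move: o; rewrite success_prob_unsat // subr0 expr1n subrr.
  set T := ppsz_time _ _ _ _ _ in o *.
  have -> : prob_accept (ppsz_cmd L0 (4 * d) p q) (enc_cnf F) T =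
      (1 - (1 - success_prob L0 (4 * d) F R) ^+ c)%R.
    have [_ <-] := o; rewrite prob_card /prob_accept INRE RpowE RdivE //.
  have Fall : all (fun C : seq ('I_n * bool) => size C <= 4)%N F.
    by case/andP: F4 => _; apply: sub_all => C /andP[].
  have sge := success_prob_ge L0 S2 (fun U g x => frozen_cost_le n F U g x Fall) sat.
  have cs : (1 <= c%:R * success_prob L0 (4 * d) F R)%R.
    have ca : (a ^+ n <= c%:R)%R.
      rewrite /a expr_div_n ler_pdivrMr ?exprn_gt0 ?ltr0n //.
      by rewrite -!natrX -natrM ler_nat mulnC.
    apply: le_trans (ler_pM _ _ ca sge); rewrite ?exprn_ge0 ?(ltW a0) //; last first.
      by rewrite divr_ge0 ?(ltW v0) // subr_ge0 (le_trans hL0) // gerBl divr_ge0 // ltW.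
    rewrite -exprMn exprn_ege1 // mulrA ler_pdivlMr // mul1r.
    by rewrite mulrC -ler_pdivrMr //; move: hL0; lra.
  have h := exp_half (success_prob01 F (4 * d) L0) cs.
  have two : IZR 2 = (2%:R)%R by rewrite -INRE INR_IZR_INZ.
  apply/RleP; rewrite RdivE two R1E; move: h; lra.
(* [a] is strictly below the target base, which absorbs the polynomial time of each trial. *)
have [C [C0 hC]] := subexp_ppsz_time L0 (4 * d) q0 qp ab.
exists C, 0%N => n _; rewrite !RabsE INRE RpowE.
by apply/RleP; rewrite !ger0_norm // exprn_ge0 // ltW // (lt_trans _ ab).
Qed.
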